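(* Let $1<\lambda<2$, and let the random variable $X$, with density $f$, belong to the domain of normal attraction of the random variable $Z_\lambda$ with Lévy symmetric stable density $\omega$. Suppose in addition that $f$ has bounded Fisher information, $I(f)<+\infty$, and belongs to the domain of attraction of the relative fractional Fisher information, so that $I_\lambda(f)<+\infty$. Let $X_1,X_2,\dots$ be independent copies of $X$, and for $n\ge1$ let $f_n$ be the density of $$T_n=\frac{1}{n^{1/\lambda}}\sum_{j=1}^nX_j.$$ Then $f_n$ converges to $\omega$ in $H^k(\mathbb{R})$ as $n\to\infty$, for all $k\ge0$. Moreover, for all $k\ge 0$, $f_n$ converges to $\omega$ in the homogeneous Sobolev space $\dot H^k(\mathbb{R})$ at the rate $\left[n^{-(2-\lambda)/(4\lambda)}\right]^{2/(2k+3)}$; that is, there exist a constant $C$ and an integer $n_0$ (independent of $n$) such that $$\|f_n-\omega\|_{\dot H^k}\le C\left[n^{-(2-\lambda)/(4\lambda)}\right]^{2/(2k+3)}\qquad\text{for all }n\ge n_0.$$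
   Context: The Fourier transform of $f$ is $\widehat f(\xi)=\int_{\mathbb{R}}e^{-i\xi x}f(x)\,dx$. For $1<\lambda<2$, $Z_\lambda$ denotes a random variable with Lévy symmetric stable density $\omega$ of order $\lambda$, i.e. $\widehat\omega(\xi)=e^{-|\xi|^\lambda}$. Sobolev norms, for $k\ge0$: $\|f\|_{H^k}^2=\int_{\mathbb{R}}|\widehat f(\xi)|^2(1+|\xi|^2)^k\,d\xi$ and $\|f\|_{\dot H^k}^2=\int_{\mathbb{R}}|\xi|^{2k}|\widehat f(\xi)|^2\,d\xi$. (Under the hypotheses, $f_n\in H^k(\mathbb{R})$ is only guaranteed for $n$ sufficiently large, depending on $k$.) Fisher information: if $X$ has a (sufficiently regular, e.g. absolutely continuous) density $f$, $I(X)=I(f)=\int_{\{f>0\}}\frac{|f'(x)|^2}{f(x)}\,dx$; saying that it is bounded includes that the density has this regularity. Fractional derivative: for $0<\nu<1$, $\mathcal{D}_\nu f$ is the function with Fourier transform $\widehat{\mathcal{D}_\nu f}(\xi)=i\,\frac{\xi}{|\xi|}\,|\xi|^\nu\,\widehat f(\xi)$ (equivalently, $\mathcal{D}_\nu f$ is the derivative of the Riesz potential of order $1-\nu$ of $f$). Relative fractional Fisher information: if $X$ has density $f$ with a well-defined fractional derivative of order $\lambda-1$, $$I_\lambda(X)=I_\lambda(f)=\int_{\{f>0\}}\left(\frac{\mathcal{D}_{\lambda-1}f(x)}{f(x)}+\frac{x}{\lambda}\right)^2f(x)\,dx.$$ $X$ (or $f$) is said to lie in the domain of attraction of the relative fractional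 Fisher information if this quantity is finite. Domain of normal attraction: a centered (mean zero) probability density with distribution function $F$ belongs to the domain of normal attraction of $Z_\lambda$ if, as $x\to+\infty$, $x^\lambda F(-x)\to c$ and $x^\lambda(1-F(x))\to c$, where $c=\frac{\Gamma(\lambda)}{\pi}\sin\left(\frac{\pi\lambda}{2}\right)$. *)

(* Defs.v *)
From HB Require Import structures.
From mathcomp Require Import all_boot all_order all_algebra.
From mathcomp Require Import complex.
From mathcomp Require Import all_classical all_reals all_analysis.

Set Implicit Arguments.
Unset Strict Implicit.
Unset Printing Implicit Defensive.

Import Order.TTheory GRing.Theory Num.Theory.
Import numFieldNormedType.Exports.

Local Open Scope classical_set_scope.
Local Open Scope ring_scope.

Section Defs.
Context {R : realType}.
Implicit Types (f g : R -> R) (lam nu k : R).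

Notation mu := (@lebesgue_measure R).

Definition Gamma (a : R) : R :=
  \int[mu]_(t in `]0, +oo[) (t `^ (a - 1) * expR (- t)).

Definition expi (t : R) : R[i] := (cos t +i* sin t)%C.

Definition Cintegral (h : R -> R[i]) : R[i] :=
  ((\int[mu]_x complex.Re (h x)) +i* (\int[mu]_x complex.Im (h x)))%C.

(* Meaningful for integrable [f]; it is only applied to such functions. *)
Definition fourier f (xi : R) : R[i] :=
  Cintegral (fun x => expi (- (xi * x)) * (f x)%:C%C).

Definition is_density f : Prop :=
  [/\ measurable_fun setT f, forall x, 0 <= f x &
      (\int[mu]_x (f x)%:E = 1)%E].

Definition is_stable_density lam (omega : R -> R) : Prop :=
  is_density omega /\
  forall xi, fourier omega xi = (expR (- (`|xi| `^ lam)))%:C%C.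

Definition distribution_function f (x : R) : R := \int[mu]_(t in `]-oo, x]) f t.

Definition normal_attraction lam f : Prop :=
  let F := distribution_function f in
  let c := Gamma lam / pi * sin (pi * lam / 2) in
  [/\ is_density f,
      mu.-integrable setT (fun x => (x * f x)%:E) /\ \int[mu]_x (x * f x) = 0,
      x `^ lam * F (- x) @[x --> +oo%R] --> c &
      x `^ lam * (1 - F x) @[x --> +oo%R] --> c].

Definition abs_continuous_on (a b : R) f : Prop :=
  forall eps : R, 0 < eps -> exists2 delta : R, 0 < delta &
    forall (m : nat) (u v : nat -> R),
      (forall i, (i < m)%N -> a <= u i <= v i /\ v i <= b) ->
      trivIset `I_m (fun i => `]u i, v i[%classic) ->
      \sum_(i < m) (v i - u i) < delta ->
      \sum_(i < m) `|f (v i) - f (u i)| < eps.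

Definition locally_abs_continuous f : Prop :=
  forall a b : R, abs_continuous_on a b f.

(* [f^`()] is the pointwise derivative, which exists almost everywhere when
   [f] is locally absolutely continuous. *)
Definition fisher f : \bar R :=
  \int[mu]_(x in [set x | 0 < f x]) (`|(f^`()%classic) x| ^+ 2 / f x)%:E.

Definition bounded_fisher f : Prop :=
  locally_abs_continuous f /\ (fisher f < +oo)%E.

(* [g] is a version of the derivative of order [nu] of [f], for [0 < nu < 1].
   Asking that [g] be integrable, so that its Fourier transform is the above
   integral, loses nothing for a density [f] with bounded Fisher information:
   then f' is integrable, hence
     \int |f(x) - f(x - h)| dx <= min (2 ||f||_1) (|h| ||f'||_1),
   and the derivative of order [nu], a multiple of
     x |-> \int (f(x) - f(x - h)) sgn(h) |h|^(-1 - nu) dh, is integrable. *)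
Definition is_fractional_derivative nu f g : Prop :=
  mu.-integrable setT (EFin \o g) /\
  forall xi, fourier g xi =
    'i%C * (xi / `|xi|)%:C%C * (`|xi| `^ nu)%:C%C * fourier f xi.

(* [g] stands for the derivative of order [lam - 1] of [f]. *)
Definition relative_fractional_fisher lam f g : \bar R :=
  \int[mu]_(x in [set x | 0 < f x]) ((g x / f x + x / lam) ^+ 2 * f x)%:E.

Definition fractional_fisher_attraction lam f : Prop :=
  exists2 g, is_fractional_derivative (lam - 1) f g &
    (relative_fractional_fisher lam f g < +oo)%E.

Definition sobolev_norm k f : \bar R :=
  sqrte (\int[mu]_xi
    (ComplexField.Normc.normc (fourier f xi) ^+ 2 * (1 + `|xi| ^+ 2) `^ k)%:E)%E.

Definition homogeneous_sobolev_norm k f : \bar R :=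
  sqrte (\int[mu]_xi (`|xi| `^ (2 * k) * ComplexField.Normc.normc (fourier f xi) ^+ 2)%:E)%E.

(* Only the tail of [u] need lie in the space. *)
Definition cvg_sobolev k (u : nat -> R -> R) f : Prop :=
  [/\ (sobolev_norm k f < +oo)%E,
      \forall n \near \oo, (sobolev_norm k (u n) < +oo)%E &
      sobolev_norm k (u n \- f) @[n --> \oo] --> 0%E].

End Defs.

Section Probability.
Context {d : measure_display} {T : measurableType d} {R : realType}.
Variable P : probability T R.

Definition has_density (X : T -> R) (f : R -> R) : Prop :=
  is_density f /\
  forall A : set R, measurable A ->
    P (X @^-1` A) = (\int[@lebesgue_measure R]_(x in A) (f x)%:E)%E.

Definition mutually_independent (X : nat -> T -> R) : Prop :=
  forall (s : seq nat) (A : nat -> set R), uniq s ->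
    (forall i, measurable (A i)) ->
    P (\bigcap_(i in [set` s]) (X i @^-1` A i)) =
    (\prod_(i <- s) P (X i @^-1` A i))%E.

(* [X] is indexed from 0: [X j] is the (j+1)-st variable. *)
Definition normalized_sum (lam : R) (X : nat -> T -> R) (n : nat) (w : T) : R :=
  (n%:R `^ lam^-1)^-1 * \sum_(j < n) X j w.

End Probability.

(* Main.v *)
Require Import Defs.
From HB Require Import structures.
From mathcomp Require Import all_boot all_order all_algebra.
From mathcomp Require Import complex.
From mathcomp Require Import all_classical all_reals all_analysis.
From mathcomp Require Import measurable_realfun.
From mathcomp Require Import ring lra.
Import Order.TTheory GRing.Theory Num.Theory.
Import numFieldNormedType.Exports.
Local Open Scope classical_set_scope.
Local Open Scope ring_scope.

(** Write [phi] for the characteristic function of [f], [g] for its derivative of order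
    [lam - 1], and [r] for [g + x * f / lam], so that the relative information is the
    integral of [r ^ 2 / f] over the set where [f] is positive.

    The stable density makes [r] vanish, and on the Fourier side [r] is the right-hand
    side of a linear equation,
      [phi' + lam * xi ^ (lam - 1) * phi = - i * lam * (transform of r)] for [xi > 0],
    whose homogeneous solution is the stable characteristic function.  By Cauchy-Schwarz
    [`|x| ^ s * r] is integrable as soon as [f] has a moment of order [2 * s], and the
    domain of normal attraction provides it for [2 * s < lam].  The choice
    [s = (3 * lam - 2) / 4] yields
      [`|phi xi - exp (- `|xi| ^ lam)| <= B * `|xi| ^ (1 + s)]
    ([char_function_near_zero]), where [(1 + s) / lam - 1 = (2 - lam) / (4 * lam)] is the
    exponent of the announced rate.

    The estimate of [r] needs [r = 0] off the support of [f], where the relative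
    information says nothing, that is [g = 0] there
    ([fractional_derivative_zero_set]).  Since the derivative is not local this is not
    obvious.  The Fisher information enters here: [f] grows at most linearly from its zeros
    ([fisher_linear_bound]), so that at a zero [x] the singular integral
      [potential f x = \int f y * sgn (y - x) * `|y - x| ^ (- lam) dy]
    converges, and averaging [g] over small tents near [x] gives a multiple of it.  At the
    ends of the intervals where [f > 0] the finiteness of the relative information forces
    these averages to vanish, while across the zeros of [f] the kernel is monotone; together
    the potential has to vanish at every zero ([potential_le0] and its reflection), and the
    Lebesgue differentiation theorem concludes.

    The transform of [f_n] is [phi (xi / n ^ (1 / lam)) ^ n]
    ([fourier_normalized_sum]).  Comparing it with the [n]-th power of the stable
    characteristic function, small frequencies contribute [n ^ (- (2 - lam) / (4 * lam))] by
    the estimate above, and the others are exponentially small, because [phi] decays like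
    [`|xi| ^ (1 - lam)] ([g] is integrable) and stays away from modulus one
    ([fourier_double] propagates this from infinity down to any given frequency).  The result
    is a bound on the error with an arbitrary polynomial weight ([power_comparison]), so the
    rate [n ^ (- (2 - lam) / (4 * lam))] holds in every Sobolev space; it is better than the
    announced one, a power with exponent [2 / (2 * k + 3) < 1] of it. *)

Set Implicit Arguments.
Unset Strict Implicit.
Unset Printing Implicit Defensive.

(** * Integrability on the line *)

Lemma integrable_dom {d} {T : measurableType d} {R : realType}
    (m : {measure set T -> \bar R}) (D : set T) (f g : T -> R) :
  measurable D -> measurable_fun D f -> (forall x, D x -> `|f x| <= g x) ->
  m.-integrable D (EFin \o g) -> m.-integrable D (EFin \o f).
Proof.
move=> mD mf fg ig; apply: (le_integrable mD) ig; first exact/measurable_EFinP.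
move=> x Dx /=; rewrite lee_fin.
by rewrite (le_trans (fg _ Dx))// ler_norm.
Qed.

Lemma Rintegral_dom {d} {T : measurableType d} {R : realType}
    (m : {measure set T -> \bar R}) (D : set T) (f g : T -> R) :
  measurable D -> measurable_fun D f -> (forall x, D x -> `|f x| <= g x) ->
  m.-integrable D (EFin \o g) ->
  `|\int[m]_(x in D) f x| <= \int[m]_(x in D) g x.
Proof.
move=> mD mf fg ig; have if_ := integrable_dom mD mf fg ig.
apply: (le_trans (le_normr_Rintegral mD if_)).
apply: le_Rintegral => //.
exact: integrable_norm.
Qed.

Section real_integrable.
Context {d} {T : measurableType d} {R : realType}.
Context (m : {measure set T -> \bar R}) (D : set T) (mD : measurable D).
Implicit Types f g : T -> R.

Lemma integrable_addR f g : m.-integrable D (EFin \o f) ->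
  m.-integrable D (EFin \o g) ->
  m.-integrable D (EFin \o (fun x => f x + g x)).
Proof. by move=> fi gi; have := integrableD mD fi gi. Qed.

Lemma integrable_subR f g : m.-integrable D (EFin \o f) ->
  m.-integrable D (EFin \o g) ->
  m.-integrable D (EFin \o (fun x => f x - g x)).
Proof. by move=> fi gi; have := integrableB mD fi gi. Qed.

Lemma integrable_mulR c f : m.-integrable D (EFin \o f) ->
  m.-integrable D (EFin \o (fun x => c * f x)).
Proof. by move=> fi; have := integrableZl mD c fi. Qed.

Lemma integrable_normR f : m.-integrable D (EFin \o f) ->
  m.-integrable D (EFin \o (fun x => `|f x|)).
Proof. exact: integrable_norm. Qed.

Lemma integrable_measR f : m.-integrable D (EFin \o f) -> measurable_fun D f.
Proof. by move=> /integrableP[/measurable_EFinP]. Qed.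

End real_integrable.

Section almost_everywhere.
Context {d} {T : measurableType d} {R : realType}.
Context (m : {measure set T -> \bar R}).

Lemma ae_mono (P Q : T -> Prop) : (forall x, P x -> Q x) ->
  {ae m, forall x, P x} -> {ae m, forall x, Q x}.
Proof.
move=> PQ [N [mN N0 sN]]; exists N; split => //.
by apply: subset_trans sN => x nQ Px; apply: nQ; exact: PQ.
Qed.

End almost_everywhere.

Section power_integrals.
Context {R : realType}.
Notation mu := (@lebesgue_measure R).

(** Exhausting the domain turns bounds on the integrals over compact pieces
    into integrability. *)
Lemma ge0_integrable_bigcup (F : (set R)^nat) (f : R -> R) (M : R) :
  {homo F : n m / (n <= m)%N >-> (n <= m)%O} ->
  (forall i, measurable (F i)) ->
  measurable_fun (\bigcup_i F i) f ->
  (forall x, 0 <= f x) ->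
  (forall i, (\int[mu]_(x in F i) (f x)%:E <= M%:E)%E) ->
  mu.-integrable (\bigcup_i F i) (EFin \o f).
Proof.
move=> ndF mF mf f0 FM.
apply/integrableP; split; first exact/measurable_EFinP.
under eq_integral do rewrite /= ger0_norm//.
apply: (@le_lt_trans _ _ M%:E); last exact: ltry.
have mfF i : measurable_fun (F i) (EFin \o f).
  by apply/measurable_EFinP; apply: measurable_funS mf => //;
    [exact: bigcup_measurable | exact: bigcup_sup].
have cv : (\int[mu]_(x in F i) (f x)%:E)%E @[i --> \oo] -->
    (\int[mu]_(x in \bigcup_i F i) (f x)%:E)%E.
  by apply: ge0_nondecreasing_set_cvg_integral => // i x _; rewrite lee_fin.
apply: (cvge_to_le cv); exact: nearW.
Qed.

Lemma measurable_powR_norm (p : R) :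
  measurable_fun setT (fun x : R => `|x| `^ p).
Proof.
by apply: (measurableT_comp (measurable_powR p)).
Qed.

Lemma powR_FTC2 (q a b : R) : 0 < a -> a < b -> q + 1 != 0 ->
  (\int[mu]_(x in `[a, b]) (x `^ q)%:E =
   ((b `^ (q + 1) - a `^ (q + 1)) / (q + 1))%:E)%E.
Proof.
move=> a0 ab q1.
pose F x := x `^ (q + 1) / (q + 1) : R.
have dF (x : R) : 0 < x -> is_derive x 1 F (x `^ q).
  move=> x0; rewrite /F.
  have -> : (fun x => x `^ (q + 1) / (q + 1)) =
            (q + 1)^-1 \*: (fun x : R => x `^ (q + 1)).
    by apply/funext => y /=; rewrite mulrC.
  have H := is_derive1_powR (q + 1) x0.
  apply: is_derive_eq.
  by rewrite addrK /GRing.scale/= mulrA mulVf// mul1r.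
have cF (x : R) : 0 < x -> {for x, continuous F}.
  move=> x0; apply: differentiable_continuous.
  by apply/derivable1_diffP; have [] := dF x x0.
rewrite (@continuous_FTC2 _ _ F)//.
- by rewrite -EFinB /F mulrBl.
- apply: derivable_within_continuous => x; rewrite in_itv/= => /andP[ax _].
  by apply: derivable_powR; rewrite in_itv/= (lt_le_trans a0 ax).
- split.
  + move=> x; rewrite in_itv/= => /andP[ax _].
    by have [] := dF x (lt_trans a0 ax).
  + by apply: cvg_at_right_filter; exact: cF.
  + by apply: cvg_at_left_filter; apply: cF; exact: lt_trans ab.
- move=> x; rewrite in_itv/= => /andP[ax _].
  by rewrite derive1E; have [_ ->] := dF x (lt_trans a0 ax).
Qed.

End power_integrals.

Section scaling.
Context {R : realType}.
Notation mu := (@lebesgue_measure R).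

Let aff (c b x : R) : measurableTypeR R := c * x + b.

Let measurable_aff c b : measurable_fun setT (aff c b).
Proof. by apply: measurable_funD => //; exact: measurable_funM. Qed.

Let lebesgue_measure_aff (c b : R) (A : set R) : c != 0 -> measurable A ->
  mu A = (`|c|%:E * mu (aff c b @^-1` A))%E.
Proof.
move=> c0 mA.
have c0' : 0 <= `|c| by [].
pose m2 : {measure set (measurableTypeR R) -> \bar R} :=
  mscale (NngNum c0') (pushforward mu (aff c b)).
rewrite (@lebesgue_measure_unique _ (m2 (measurable_aff c b))) //= => _ [[u v]] _ <-.
rewrite /= /mscale /=.
rewrite [X in (_ * X)%E](_ : _ = mu (aff c b @^-1` `]u, v]))//.
have [c_gt0|] := ltP 0 c.
  have -> : aff c b @^-1` `]u, v] = `]c^-1 * (u - b), c^-1 * (v - b)]%classic.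
    apply/seteqP; split => x /=; rewrite !in_itv/= /aff.
      by rewrite ltr_pdivrMl// ler_pdivlMl// lerBrDr ltrBlDr.
    by rewrite ltr_pdivrMl// ler_pdivlMl// lerBrDr ltrBlDr.
  rewrite !lebesgue_measure_itv/= !lte_fin ltr_pM2l ?invr_gt0// ltrD2r.
  case: ifPn => _; last by rewrite mule0.
  rewrite -!EFinB -EFinM gtr0_norm//; congr EFin; field.
  by rewrite gt_eqF.
rewrite le_eqVlt (negbTE c0)/= => c_lt0.
have -> : aff c b @^-1` `]u, v] = `[c^-1 * (v - b), c^-1 * (u - b)[%classic.
  apply/seteqP; split => x /=; rewrite !in_itv/= /aff.
    by rewrite ler_ndivrMl// ltr_ndivlMl// lerBrDr ltrBlDr andbC.
  by rewrite ler_ndivrMl// ltr_ndivlMl// lerBrDr ltrBlDr andbC.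
rewrite !lebesgue_measure_itv/= !lte_fin ltr_nM2l ?invr_lt0// ltrD2r.
case: ifPn => _; last by rewrite mule0.
rewrite -!EFinB -EFinM ltr0_norm//; congr EFin; field.
by rewrite lt_eqF.
Qed.

Lemma ge0_integral_affine (c b : R) (h : R -> \bar R) : c != 0 ->
  measurable_fun setT h -> (forall x, 0 <= h x)%E ->
  (\int[mu]_x h x = `|c|%:E * \int[mu]_x h (c * x + b)%R)%E.
Proof.
move=> c0 mh h0.
have c0' : 0 <= `|c| by [].
pose m2 :
  {measure set (measurableTypeR R) -> \bar R} :=
  mscale (NngNum c0') (pushforward mu (aff c b)).
transitivity (\int[m2 (measurable_aff c b)]_x h x)%E.
  apply: eq_measure_integral => A mA _.
  exact: lebesgue_measure_aff.
rewrite ge0_integral_mscale//=.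
congr (_ * _)%E; rewrite ge0_integral_pushforward//.
exact: measurable_aff c b.
Qed.

Lemma integrable_affine (c b : R) (h : R -> R) : c != 0 ->
  mu.-integrable setT (EFin \o h) ->
  mu.-integrable setT (EFin \o (fun x => h (c * x + b))).
Proof.
move=> c0 /integrableP[/measurable_EFinP mh hoo].
have mhc : measurable_fun setT (fun x => h (c * x + b)).
  by apply: (measurableT_comp mh); exact: (measurable_aff c b).
apply/integrableP; split; first exact/measurable_EFinP.
move: hoo; rewrite (ge0_integral_affine b c0)//; last first.
  by apply/measurable_EFinP; exact: (measurableT_comp _ mh).
rewrite ltey; apply: contraNT; rewrite -leNgt leye_eq => /eqP ->.
by rewrite gt0_muley// lte_fin normr_gt0.
Qed.

Lemma Rintegral_affine (c b : R) (h : R -> R) : c != 0 ->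
  mu.-integrable setT (EFin \o h) ->
  \int[mu]_x h (c * x + b) = `|c|^-1 * \int[mu]_x h x.
Proof.
move=> c0.
have pos (k : R -> R) : (forall x, 0 <= k x) -> mu.-integrable setT (EFin \o k) ->
    \int[mu]_x k (c * x + b) = `|c|^-1 * \int[mu]_x k x.
  move=> k0 ik; have ikc := integrable_affine b c0 ik.
  have /integrableP[mk _] := ik.
  rewrite [in RHS]/Rintegral (ge0_integral_affine b c0 mk)//.
  have fk := integrable_fin_num measurableT ikc.
  rewrite /Rintegral fineM// mulrA mulVf ?mul1r// normr_eq0//.
move=> ih.
have in_ := integrable_normR ih.
have ib := integrable_subR measurableT in_ ih.
transitivity (\int[mu]_x (`|h (c * x + b)| - (`|h (c * x + b)| - h (c * x + b)))).
  by apply: eq_Rintegral => x _; rewrite subKr.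
rewrite (RintegralB measurableT (integrable_affine b c0 in_) (integrable_affine b c0 ib)).
rewrite (pos (fun x => `|h x|))// (pos (fun x => `|h x| - h x))//; last first.
  by move=> x; rewrite subr_ge0 ler_norm.
rewrite -mulrBr -RintegralB//; congr (_ * _).
by apply: eq_Rintegral => x _; rewrite subKr.
Qed.

Lemma integrable_scale (c : R) (h : R -> R) : c != 0 ->
  mu.-integrable setT (EFin \o h) ->
  mu.-integrable setT (EFin \o (fun x => h (c * x))).
Proof.
move=> c0 /(integrable_affine 0 c0); congr (_.-integrable _ (_ \o _)).
by apply/funext => x; rewrite addr0.
Qed.

Lemma Rintegral_scale (c : R) (h : R -> R) : c != 0 ->
  mu.-integrable setT (EFin \o h) ->
  \int[mu]_x h (c * x) = `|c|^-1 * \int[mu]_x h x.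
Proof.
move=> c0 ih; rewrite -(Rintegral_affine 0 c0 ih).
by apply: eq_Rintegral => x _; rewrite addr0.
Qed.

Lemma integrable_shift (b : R) (h : R -> R) : mu.-integrable setT (EFin \o h) ->
  mu.-integrable setT (EFin \o (fun x => h (x - b))).
Proof.
move=> /(integrable_affine (- b) (oner_neq0 R)); congr (_.-integrable _ (_ \o _)).
by apply/funext => x; rewrite mul1r.
Qed.

Lemma Rintegral_shift (b : R) (h : R -> R) : mu.-integrable setT (EFin \o h) ->
  \int[mu]_x h (x - b) = \int[mu]_x h x.
Proof.
move=> ih; have := Rintegral_affine (- b) (oner_neq0 R) ih.
rewrite normr1 invr1 mul1r => <-.
by apply: eq_Rintegral => x _; rewrite mul1r.
Qed.

End scaling.

Section power_integrable.
Context {R : realType}.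
Notation mu := (@lebesgue_measure R).

Let split_powR (q p x : R) : R := if `|x| <= 1 then `|x| `^ q else `|x| `^ (- p).

Let split_powR_ge0 q p x : 0 <= split_powR q p x.
Proof. by rewrite /split_powR; case: ifP => _; exact: powR_ge0. Qed.

Let measurable_split_powR q p : measurable_fun setT (split_powR q p).
Proof.
apply: measurable_fun_ifT; first by apply: measurable_fun_ler.
- exact: measurable_powR_norm.
- exact: measurable_powR_norm.
Qed.

Let F (i : nat) : set R := `[i.+2%:R^-1, i.+2%:R].

Let bigcupF : \bigcup_i F i = `]0, +oo[%classic :> set R.
Proof.
apply/seteqP; split => x.
  move=> [i _]; rewrite /F /= !in_itv/= andbT => /andP[+ _].
  by apply: lt_le_trans; rewrite invr_gt0.
rewrite /= in_itv/= andbT => x0.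
pose n := Num.truncn (Num.max x x^-1).
exists n => //; rewrite /F /= in_itv/=.
have m0 : 0 <= Num.max x x^-1 by rewrite le_max ltW.
have h : Num.max x x^-1 <= n.+2%:R.
  apply: (@le_trans _ _ n.+1%:R); last by rewrite ler_nat.
  by apply/ltW; exact: truncnS_gt.
move: h; rewrite ge_max => /andP[h1 h2].
by rewrite h1 andbT invf_ple// posrE.
Qed.

Let ndF : {homo F : n m / (n <= m)%N >-> (n <= m)%O}.
Proof.
move=> n m nm; apply/subsetPset => x; rewrite /F /= !in_itv/= => /andP[h1 h2].
rewrite (le_trans _ h1)/= ?(le_trans h2) ?ler_nat//.
by rewrite lef_pV2 ?posrE// ler_nat.
Qed.

Lemma integrable_powR_split (q p : R) : -1 < q -> 1 < p ->
  mu.-integrable setT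
    (EFin \o (fun x => if `|x| <= 1 then `|x| `^ q else `|x| `^ (- p))).
Proof.
move=> q1 p1; rewrite -[X in EFin \o X]/(split_powR q p).
have q1' : 0 < q + 1 by rewrite -ltrBlDr sub0r.
have p1' : - p + 1 < 0 by rewrite addrC subr_lt0.
have posI : mu.-integrable `]0, +oo[ (EFin \o split_powR q p).
  rewrite -bigcupF.
  apply: (@ge0_integrable_bigcup _ _ _ ((q + 1)^-1 + (p - 1)^-1)) => //.
  - by move=> i; exact: measurable_itv.
  - by apply: measurable_funTS; exact: measurable_split_powR.
  move=> i.
  have i0 : 0 < i.+2%:R^-1 :> R by rewrite invr_gt0.
  have i1 : i.+2%:R^-1 < 1 :> R by rewrite invf_lt1// ltr1n.
  have i2 : 1 < i.+2%:R :> R by rewrite ltr1n.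
  have -> : F i = `[i.+2%:R^-1, 1] `|` `]1, i.+2%:R] :> set R.
    rewrite /F -itv_bndbnd_setU// ?bnd_simp//; exact: ltW.
  rewrite ge0_integral_setU//=; last 3 first.
  - apply/measurable_EFinP; apply: measurable_funTS.
    exact: measurable_split_powR.
  - by move=> x _; rewrite lee_fin.
  - apply/disj_setPS => y [/=]; rewrite !in_itv/= => /andP[_ y1] /andP[].
    by rewrite ltNge y1.
  rewrite EFinD; apply: leeD.
    rewrite (eq_integral (fun x : measurableTypeR R => (x `^ q)%:E)); last first.
      move=> x; rewrite inE/= in_itv/= => /andP[ix x1].
      by rewrite /split_powR ger0_norm ?x1// (le_trans _ ix)// ltW.
    rewrite powR_FTC2 ?gt_eqF// lee_fin powR1 ler_pdivrMr// mulVf ?gt_eqF//.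
  rewrite (eq_integral (fun x : measurableTypeR R => (x `^ (- p))%:E)); last first.
    move=> x; rewrite inE/= in_itv/= => /andP[x1 xi].
    have x0 : 0 <= x by rewrite (le_trans _ (ltW x1)).
    by rewrite /split_powR ger0_norm// leNgt x1.
  rewrite integral_itv_obnd_cbnd; last first.
    by apply/measurable_EFinP; apply: measurable_funTS; exact: measurable_powR.
  rewrite powR_FTC2 ?lt_eqF// lee_fin powR1 ler_ndivrMr//.
  rewrite (_ : - p + 1 = - (p - 1)); last by ring.
  rewrite mulrN mulVf ?gt_eqF ?subr_gt0// lerBrDr addNr.
  exact: powR_ge0.
have posI' : mu.-integrable setT (EFin \o (fun x => split_powR q p x * (0 < x)%R%:R)).
  move: posI => /integrable_mkcond; rewrite restrict_EFin => /(_ (measurable_itv _)).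
  congr (mu.-integrable setT (EFin \o _)); apply/funext => x.
  rewrite patchE; case: ifPn; rewrite ?inE ?notin_setE/= in_itv/= andbT.
    by move=> ->; rewrite mulr1.
  by move=> /negP/negbTE ->; rewrite mulr0.
have negI : mu.-integrable setT
    (EFin \o (fun x => split_powR q p (-1 * x) * (0 < -1 * x)%R%:R)).
  by apply: (integrable_scale _ posI'); rewrite oppr_eq0 oner_eq0.
have sumI := integrable_addR measurableT posI' negI.
have onI : mu.-integrable setT (EFin \o \1_(`[0, 0] : set R)).
  exact: integrable_indic_itv.
apply: integrable_dom (integrable_addR measurableT sumI
  (integrable_mulR measurableT (split_powR q p 0) onI)) => //.
  exact: measurable_split_powR.
move=> x _; rewrite ger0_norm//.
have sN : split_powR q p (-1 * x) = split_powR q p x.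
  by rewrite /split_powR mulN1r normrN.
rewrite sN mulN1r indicE.
have [x0|x0|->] := ltgtP 0 x.
- rewrite mulr1 -addrA lerDl addr_ge0// mulr_ge0//.
- by rewrite oppr_gt0 x0 mulr1 mulr0 add0r lerDl mulr_ge0.
- by rewrite mem_set ?mulr1 ?lerDr ?addr_ge0 ?mulr_ge0//= in_itv/= lexx.
Qed.
End power_integrable.

Lemma density_integrable {R : realType} (h : R -> R) : is_density h ->
  (@lebesgue_measure R).-integrable setT (EFin \o h).
Proof.
move=> [mh h0 h1]; apply/integrableP; split; first exact/measurable_EFinP.
under eq_integral do rewrite /= ger0_norm//.
by rewrite h1 ltry.
Qed.

(** * Absolutely continuous functions are indefinite integrals *)

Section interval_families.
Context {R : realType}.
Implicit Types (a b x y : R) (f : R -> R) (p q : R * R) (s : seq (R * R)).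

(** A pair [(v, u)] stands for the interval with left end [u] and right end
    [v]: this is how the pieces of a partition come out of [variation_zip]. *)
Definition gap p : set R := `]p.2, p.1[%classic.

Definition gaps_disjoint s := pairwise (fun p q => `[< gap p `&` gap q = set0 >]) s.

Definition gaps_length s : R := \sum_(p <- s) (p.1 - p.2).

Lemma abs_continuous_on_seq a b f (eps : R) : abs_continuous_on a b f -> 0 < eps ->
  exists2 delta : R, 0 < delta & forall s, gaps_disjoint s ->
    (forall p, p \in s -> a <= p.2 <= p.1 /\ p.1 <= b) ->
    gaps_length s < delta -> \sum_(p <- s) `|f p.1 - f p.2| < eps.
Proof.
move=> fAC e0; have [delta d0 H] := fAC _ e0; exists delta => // s ds sab ls.
pose u i := (nth (a, a) s i).2; pose v i := (nth (a, a) s i).1.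
have := H (size s) u v; rewrite (big_nth (a, a)) big_mkord; apply.
- by move=> i ilt; apply: sab; exact: mem_nth.
- apply/trivIsetP => i j; rewrite /= => ilt jlt.
  wlog ij : i j ilt jlt / (i < j)%N.
    move=> W; rewrite neq_ltn => /orP[] ij; first by apply: W => //; rewrite ltn_eqF.
    by rewrite setIC; apply: W => //; rewrite ltn_eqF.
  by move=> _; have /pairwiseP-/(_ (a, a)) := ds; move=> /(_ i j ilt jlt ij) /asboolP.
- by move: ls; rewrite /gaps_length (big_nth (a, a)) big_mkord.
Qed.

Lemma itv_partition_gaps a b (l : seq R) : itv_partition a b l ->
  let s := zip l (a :: l) in
  [/\ a <= b, gaps_disjoint s, (forall p, p \in s -> a <= p.2 <= p.1 /\ p.1 <= b)
    & gaps_length s = b - a].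
Proof.
elim: l a => [|x l IH] a abl; cbv zeta.
  rewrite /= (itv_partition_nil abl); split => //.
  by rewrite /gaps_length big_nil subrr.
have xb := itv_partition_cons abl; have [xleb dl ml ll] := IH _ xb.
rewrite (_ : zip _ _ = (x, a) :: zip l (x :: l))//.
have ax : a <= x by case: abl => /= /andP[/ltW].
split.
- exact: le_trans xleb.
- rewrite /gaps_disjoint pairwise_cons; apply/andP; split => //.
  apply/allP => p /ml [/andP[xp p21] p1b]; apply/asboolP/seteqP; split => // y.
  rewrite /gap /= !in_itv/= => -[/andP[_ yx] /andP[py _]].
  by have := lt_trans py yx; rewrite ltNge xp.
- move=> p; rewrite inE => /predU1P[->/=|/ml[/andP[xp p21] p1b]].
    by rewrite lexx ax.
  by rewrite (le_trans ax).
- by rewrite /gaps_length big_cons -/(gaps_length _) ll /=; ring.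
Qed.

(** Splitting every interval of a family further does not change its total
    length, so a bound on the increments over all short families is a bound on
    their total variations. *)
Lemma sum_total_variation_le a b f (eps delta : R) :
  (forall s, gaps_disjoint s ->
    (forall p, p \in s -> a <= p.2 <= p.1 /\ p.1 <= b) ->
    gaps_length s < delta -> \sum_(p <- s) `|f p.1 - f p.2| <= eps) ->
  forall L s, gaps_disjoint (L ++ s) ->
    (forall p, p \in L ++ s -> a <= p.2 <= p.1 /\ p.1 <= b) ->
    gaps_length (L ++ s) < delta ->
  (\sum_(p <- L) total_variation p.2 p.1 f +
   (\sum_(p <- s) `|f p.1 - f p.2|)%:E <= eps%:E)%E.
Proof.
move=> H; elim=> [|p L IH] s ds sab ls.
  by rewrite big_nil add0e lee_fin; exact: H.
have := ds; rewrite /gaps_disjoint cat_cons pairwise_cons => /andP[/allP dp dLs].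
have [/andP[ap p21] pb] := sab p (mem_head _ _).
have sab' q : q \in L ++ s -> a <= q.2 <= q.1 /\ q.1 <= b.
  by move=> qLs; apply: sab; rewrite inE qLs orbT.
have len_cons : gaps_length ((p :: L) ++ s) = p.1 - p.2 + gaps_length (L ++ s).
  by rewrite /gaps_length big_cons.
have rest := IH s dLs sab'.
have {}rest : (\sum_(p0 <- L) total_variation p0.2 p0.1 f +
   (\sum_(p0 <- s) `|f p0.1 - f p0.2|)%:E <= eps%:E)%E.
  by apply: rest; apply: le_lt_trans ls; rewrite len_cons lerDr subr_ge0.
set rst := (X in (X <= _)%E) in rest.
have rst0 : (0 <= rst)%E.
  apply: adde_ge0; last by rewrite lee_fin sumr_ge0.
  rewrite big_seq; apply: sume_ge0 => q qL; apply: total_variation_ge0.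
  by have [] := sab' q _; rewrite ?mem_cat ?qL// => /andP[].
have rfin : rst \is a fin_num.
  by rewrite ge0_fin_numE// (le_lt_trans rest)// ltry.
rewrite big_cons -addeA -/rst -(fineK rfin) -leeBrDr// -EFinB.
apply: ge_ereal_sup => _ [_ [l pl <-] <-].
rewrite EFinB leeBrDr// fineK// variation_zip//.
have [_ dq mq lq] := itv_partition_gaps pl.
set q := zip l (p.2 :: l) in dq mq lq *.
have mem_gap r : r \in q -> gap r `<=` gap p.
  move=> /mq[/andP[h1 h2] h3] y; rewrite /gap/= !in_itv/= => /andP[y1 y2].
  by rewrite (le_lt_trans h1)//= (lt_le_trans y2).
have := IH (q ++ s); rewrite big_cat/= EFinD addeA addeAC addeC; apply.
- move: dLs; rewrite /gaps_disjoint !pairwise_cat => /and3P[rLs -> ->].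
  rewrite -/(gaps_disjoint q) dq !andbT/= allrel_catr rLs andbT; apply/andP; split.
    apply/allrelP => r t rL tq; apply/asboolP/seteqP; split => // y [ry ty].
    have pr' : gap p `&` gap r = set0 by apply/asboolP/dp; rewrite mem_cat rL.
    by rewrite -pr'; split => //; exact: mem_gap ty.
  apply/allrelP => r t rq ts; apply/asboolP/seteqP; split => // y [ry ty].
  have pt' : gap p `&` gap t = set0 by apply/asboolP/dp; rewrite mem_cat ts orbT.
  by rewrite -pt'; split => //; exact: mem_gap ry.
- move=> r; rewrite !mem_cat => /or3P[rL|/mq[/andP[h1 ->] h3]|rs].
  + by apply: sab'; rewrite mem_cat rL.
  + by rewrite (le_trans ap)// (le_trans h3).
  + by apply: sab'; rewrite mem_cat rs orbT.
- apply: le_lt_trans ls; rewrite len_cons /gaps_length !big_cat/=.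
  by rewrite -[\sum_(_ <- q) _]/(gaps_length q) lq addrCA.
Qed.

End interval_families.

Section stieltjes_density.
Context {R : realType} (F : cumulative R R).
Notation mu := (@lebesgue_measure R).
Hypothesis bndF : exists M : R, forall x y, F y - F x <= M.
Hypothesis acF : forall eps : R, 0 < eps -> exists2 delta : R, 0 < delta &
  forall s : seq (R * R), gaps_disjoint s -> (forall p, p \in s -> p.2 <= p.1) ->
    gaps_length s < delta -> \sum_(p <- s) (F p.1 - F p.2) <= eps.

Let nu := lebesgue_stieltjes_measure F.

Let nu_itv x y : x <= y -> nu `]x, y]%classic = (F y - F x)%:E.
Proof.
move=> xy; rewrite /nu /lebesgue_stieltjes_measure /measure_extension/=.
rewrite measurable_mu_extE/=; last exact: is_ocitv.
by rewrite wlength_itv_bnd.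
Qed.

Let nu_fin : fin_num_fun nu.
Proof.
have [M HM] := bndF.
suff : (nu setT <= M%:E)%E.
  by move=> nuT; apply: lty_fin_num_fun; exact: le_lt_trans nuT (ltry _).
rewrite -(bigcup_itvT false false).
pose I n : set R := `]- (n%:R), n%:R]%classic.
have cv : (nu \o I) n @[n --> \oo] --> nu (\bigcup_n I n).
  apply: nondecreasing_cvg_mu; rewrite /I//; first exact: bigcup_measurable.
  by move=> *; apply/subsetPset/subset_itv; rewrite leBSide/= ?lerN2 ler_nat.
apply: (cvge_to_le cv); apply: nearW => n /=.
by rewrite nu_itv ?lee_fin ?HM// ge0_cp.
Qed.

(** An open interval of finite length, seen as a pair: the increment of [F]
    over it bounds its Stieltjes measure. *)
Let open_itv_pair (I : set R) : open I -> is_interval I -> (mu I < +oo)%E ->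
  exists p : R * R, [/\ p.2 <= p.1, gap p `<=` I, (mu I = (p.1 - p.2)%:E)%E &
    (nu I <= (F p.1 - F p.2)%:E)%E].
Proof.
move=> oI iI muI.
have [I0|/set0P[z Iz]] := eqVneq I set0.
  exists (0, 0); rewrite I0 /gap /= set_itv_ge ?bnd_simp// !subrr.
  by split => //; rewrite ?/nu measure0.
have := iI => /is_intervalP; move: (Rhull I) => [[b1 u|[]] [b2 v|[]]] IE;
  move: Iz muI; rewrite IE ?lebesgue_measure_itv ?in_itv//= ?ltxx ?lexx ?ltNyy//=.
- move=> zuv _.
  have bnd x : I x -> u <= x <= v.
    rewrite IE /= in_itv/=; case: b1 b2 {IE zuv} => -[]/= /andP[h1 h2];
      apply/andP; split; lra.
  have shift x : I x -> exists2 e : R, 0 < e & I (x - e) /\ I (x + e).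
    move=> Ix; have /nbhs_ballP[e/= e0 xe] := open_nbhs_nbhs (conj oI Ix).
    exists (e / 2); first by rewrite divr_gt0.
    split; apply: xe; rewrite /ball/=.
      by rewrite opprB addrC subrK gtr0_norm ?divr_gt0// ltr_pdivrMr// ltr_pMr// ltr1n.
    by rewrite opprD addrA subrr sub0r normrN gtr0_norm ?divr_gt0// ltr_pdivrMr// ltr_pMr// ltr1n.
  have Iz : I z by rewrite IE.
  have uv : u < v.
    have [e e0 [/bnd/andP[+ _] /bnd/andP[_ +]]] := shift z Iz; lra.
  exists (v, u); split => /=; first exact: ltW.
  - move=> x; rewrite /gap /= in_itv/= => /andP[ux xv].
    have [ux' xv'] := (ltW ux, ltW xv).
    by case: b1 b2 {IE zuv bnd} => -[]; rewrite in_itv/= ?ux ?xv ?ux' ?xv'.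
  - by rewrite lte_fin uv.
  - rewrite -nu_itv; last exact: ltW.
    rewrite -IE; apply: le_measure; rewrite ?inE//; first exact: open_measurable.
    move=> x Ix; rewrite /= in_itv/=; have /andP[_ ->] := bnd x Ix; rewrite andbT.
    have [e e0 [/bnd/andP[+ _] _]] := shift x Ix; lra.
- by rewrite itv_boundlr/= andbF.
- by rewrite ltry.
- by rewrite ltNyr.
Qed.

Let nu_dominated : nu `<< mu.
Proof.
apply/null_content_dominatesP => A mA muA0.
apply/eqP; rewrite eq_le measure_ge0 andbT.
apply/lee_addgt0Pr => e e0; rewrite add0e.
have [delta d0 H] := acF e0.
have muAfin : (mu A < +oo)%E by rewrite [X in (X < _)%E]muA0 ltry.
have [U [oU AU muU]] := lebesgue_regularity_outer mA muAfin d0.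
have mU : measurable U by exact: open_measurable.
have {}muU : (mu U < delta%:E)%E.
  apply: le_lt_trans muU; rewrite -{1}(setDUK AU) setUC.
  apply: le_trans (measureU2 _ _ _) _ => //; first exact: measurableD.
  by rewrite [X in (_ + X)%E]muA0 adde0.
pose I := open_disjoint_itv oU.
have oI q : open (I q) by exact: open_disjoint_itv_open.
have mI q : measurable (I q) by exact: open_measurable.
have tI : trivIset setT I by exact: open_disjoint_itv_trivIset.
have UI : U = \bigcup_q I q by exact: open_disjoint_itv_bigcup.
have IU q : I q `<=` U by rewrite UI => x; exists q.
have muI q : (mu (I q) < +oo)%E.
  apply: le_lt_trans (lt_trans muU (ltry _)).
  by apply: le_measure; [rewrite inE; exact: mI|rewrite inE; exact: mU|exact: IU].
have /choice[p Hp] := fun q => open_itv_pair (oI q) (@open_disjoint_itv_is_interval _ _ oU q) (muI q).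
apply: (@le_trans _ _ (nu U)); first by apply: le_measure; [rewrite inE|rewrite inE; exact: mU|].
have -> : nu U = (\sum_(0 <= i <oo) nu (I i))%E.
  by rewrite {1}UI; apply: measure_semi_bigcup => //; rewrite -UI.
apply: lime_le; first by apply: is_cvg_nneseries => i _ _; exact: measure_ge0.
apply: nearW => m.
apply: (@le_trans _ _ (\sum_(0 <= i < m) ((F (p i).1 - F (p i).2)%:E))%E).
  by apply: lee_sum => i _; have [] := Hp i.
rewrite sumEFin lee_fin -(big_map p xpredT (fun r => F r.1 - F r.2)).
apply: H.
- rewrite /gaps_disjoint pairwise_map; apply/(pairwiseP 0%N) => i j.
  rewrite !inE !size_iota subn0 => im jm ij.
  rewrite /index_iota subn0 !nth_iota// !add0n.
  do 2 apply/asboolP; rewrite -subset0 => x [].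
  have [_ h1 _ _] := Hp i; have [_ h2 _ _] := Hp j.
  move=> /h1 xi /h2 xj; move/trivIsetP : tI => /(_ i j Logic.I Logic.I).
  by rewrite ltn_eqF// => /(_ isT) <-.
- by move=> r /mapP[i _ ->]; have [] := Hp i.
- rewrite /gaps_length big_map -lte_fin -sumEFin; apply: le_lt_trans muU.
  rewrite (eq_bigr (fun i => mu (I i))); last by move=> i _; have [] := Hp i.
  have -> : mu U = (\sum_(0 <= i <oo) mu (I i))%E.
    by rewrite {1}UI; apply: measure_semi_bigcup => //; rewrite -UI.
  by apply: nneseries_lim_ge => i _ _.
Qed.

(** Radon-Nikodym for the Stieltjes measure of [F], whose domination by the Lebesgue
    measure is the absolute continuity of [F]. *)
Lemma stieltjes_density : exists2 h : R -> R, mu.-integrable setT (EFin \o h) &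
  forall x y, x <= y -> F y - F x = \int[mu]_(t in `]x, y]) h t.
Proof.
pose nuF : {finite_measure set (measurableTypeR R) -> \bar R} :=
  HB.pack (lebesgue_stieltjes_measure F)
    (Measure_isFinite.Build _ _ _ (lebesgue_stieltjes_measure F) nu_fin).
have [k [k0 kfin ik nuE]] := @radon_nikodym_sigma_finite _ _ _
  [the {sigma_finite_measure set _ -> \bar R} of mu] nuF nu_dominated.
have fk : EFin \o (fine \o k) = k by apply/funext => t; rewrite /= fineK.
exists (fine \o k); first by rewrite fk.
move=> x y xy; apply: EFin_inj; rewrite -nu_itv//.
rewrite [LHS](nuE `]x, y]%classic)// /Rintegral fineK; last first.
  have ikr : mu.-integrable `]x, y]%classic (EFin \o (fine \o k)).
    by rewrite fk; exact: integrableS ik.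
  exact: (integrable_fin_num _ ikr).
by apply: eq_integral => t _; rewrite /= fineK.
Qed.

End stieltjes_density.

Section abs_continuous_density.
Context {R : realType} (a b : R) (f : R -> R).
Notation mu := (@lebesgue_measure R).
Hypothesis ab : a <= b.
Hypothesis fAC : abs_continuous_on a b f.

Let clamp x := Num.max a (Num.min b x).

Let clamp_itv x : a <= clamp x <= b.
Proof. by rewrite /clamp le_max lexx /= ge_max ab ge_min lexx. Qed.

Let clamp_id x : a <= x <= b -> clamp x = x.
Proof. by move=> /andP[ax xb]; rewrite /clamp min_r// max_r. Qed.

Let clamp_nd x y : x <= y -> clamp x <= clamp y.
Proof.
move=> xy; rewrite /clamp ge_max !le_max lexx/=; apply/orP; right.
by rewrite le_min ge_min lexx/= ge_min xy orbT.
Qed.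

Let clamp_dist x y : x <= y -> clamp y - clamp x <= y - x.
Proof.
by move=> xy; rewrite /clamp !maxEle !minEle; do !case: ifPn => //;
  rewrite -?ltNge => *; lra.
Qed.

Let gap_clamp (p : R * R) : gap (clamp p.1, clamp p.2) `<=` gap p.
Proof.
move=> x; rewrite /gap/= !in_itv/= /clamp !maxEle !minEle.
by do !case: ifPn => //; rewrite -?ltNge => *; apply/andP; split; lra.
Qed.

Let TV_short (eps : R) : 0 < eps -> exists2 delta : R, 0 < delta &
  forall s : seq (R * R), gaps_disjoint s -> (forall p, p \in s -> p.2 <= p.1) ->
    gaps_length s < delta ->
    (\sum_(p <- s) total_variation (clamp p.2) (clamp p.1) f <= eps%:E)%E.
Proof.
move=> e0; have [delta d0 H] := abs_continuous_on_seq fAC e0.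
exists delta => // s ds s21 ls.
pose c (p : R * R) := (clamp p.1, clamp p.2).
have H' s' : gaps_disjoint s' -> (forall p, p \in s' -> a <= p.2 <= p.1 /\ p.1 <= b) ->
    gaps_length s' < delta -> \sum_(p <- s') `|f p.1 - f p.2| <= eps.
  by move=> h1 h2 h3; exact/ltW/H.
have := sum_total_variation_le H' (L := map c s) (s := [::]).
rewrite cats0 big_nil adde0 big_map; apply.
- rewrite /gaps_disjoint pairwise_map; apply: sub_pairwise ds => p q /asboolP pq.
  apply/asboolP; rewrite -subset0 -pq => x [xp xq].
  by split; exact: gap_clamp.
- move=> p /mapP[q qs ->] /=; have /andP[-> _] := clamp_itv q.2.
  by rewrite clamp_nd ?s21//; have /andP[_ ->] := clamp_itv q.1.
- apply: le_lt_trans ls; rewrite /gaps_length big_map.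
  by rewrite big_seq [leRHS]big_seq; apply: ler_sum => p ps; exact/clamp_dist/s21.
Qed.

Let TV_fin x y : a <= x -> x <= y -> y <= b -> total_variation x y f \is a fin_num.
Proof.
move=> ax xy yb; have [delta d0 H] := TV_short ltr01.
have H1 u v : a <= u -> u <= v -> v <= b -> v - u < delta ->
    (total_variation u v f <= 1%:E)%E.
  move=> au uv vb vud; have := H [:: (v, u)]; rewrite big_seq1/=.
  rewrite !clamp_id ?au ?vb ?(le_trans au)//  ?(le_trans uv)//; apply.
  - by [].
  - by move=> p; rewrite inE => /eqP ->.
  - by rewrite /gaps_length big_seq1.
have step n : x + n%:R * (delta / 2) <= y ->
    (total_variation x (x + n%:R * (delta / 2)) f < +oo)%E.
  elim: n => [_|n IH].
    by rewrite mul0r addr0 total_variationxx.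
  rewrite -natr1 mulrDl mul1r addrA; set z := x + n%:R * (delta / 2) => zy.
  have xz : x <= z by rewrite lerDl mulr_ge0// ltW// divr_gt0.
  have d2 : 0 < delta / 2 by rewrite divr_gt0.
  have zy' : z <= y by rewrite (le_trans _ zy)// lerDl ltW.
  rewrite (total_variationD _ xz); last by rewrite lerDl ltW.
  rewrite lte_add_pinfty//; first exact: IH.
  apply: (@le_lt_trans _ _ 1%:E); last exact: ltry.
  apply: H1; first exact: le_trans xz.
  - by rewrite lerDl ltW.
  - exact: le_trans yb.
  - by lra.
pose n := Num.truncn ((y - x) / (delta / 2)).
have d2 : 0 < delta / 2 by rewrite divr_gt0.
have q0 : 0 <= (y - x) / (delta / 2) by rewrite divr_ge0 ?subr_ge0// ltW.
have /andP[n1 n2] := truncn_itv q0.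
have zy : x + n%:R * (delta / 2) <= y by rewrite -lerBrDl -ler_pdivlMr.
have xz : x <= x + n%:R * (delta / 2) by rewrite lerDl mulr_ge0// ltW.
rewrite ge0_fin_numE ?total_variation_ge0// (total_variationD _ xz zy).
rewrite lte_add_pinfty ?step//.
apply: (@le_lt_trans _ _ 1%:E); last exact: ltry.
apply: H1 => //; first exact: le_trans xz.
move: n2; rewrite ltr_pdivrMr// -natr1 mulrDl mul1r -/n; lra.
Qed.

(** [half_variation 1] and [half_variation (-1)] are the nondecreasing functions of the
    Jordan decomposition; clamping extends them to the line. *)
Let half_variation (s : R) x : R :=
  (fine (total_variation a (clamp x) f) + s * f (clamp x)) / 2.

Let half_variationB s x y : `|s| = 1 -> x <= y ->
  0 <= half_variation s y - half_variation s x
    <= fine (total_variation (clamp x) (clamp y) f).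
Proof.
move=> s1 xy; have xy' := clamp_nd xy.
have /andP[ax xb] := clamp_itv x; have /andP[ay yb] := clamp_itv y.
rewrite /half_variation (total_variationD _ ax xy') fineD ?TV_fin//.
have : `|s * (f (clamp y) - f (clamp x))| <=
    fine (total_variation (clamp x) (clamp y) f).
  by rewrite normrM s1 mul1r -lee_fin fineK ?TV_fin// total_variation_ge.
rewrite ler_norml mulrBr => /andP[h1 h2].
by apply/andP; split; lra.
Qed.

Let half_variation_density s : `|s| = 1 ->
  exists2 h : R -> R, mu.-integrable setT (EFin \o h) &
  forall x y, x <= y ->
    half_variation s y - half_variation s x = \int[mu]_(t in `]x, y]) h t.
Proof.
move=> s1.
have nd : nondecreasing (half_variation s).
  by move=> x y xy; rewrite -subr_ge0; have /andP[] := half_variationB s1 xy.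
have ac (eps : R) : 0 < eps -> exists2 delta : R, 0 < delta &
    forall l : seq (R * R), gaps_disjoint l -> (forall p, p \in l -> p.2 <= p.1) ->
    gaps_length l < delta ->
    \sum_(p <- l) (half_variation s p.1 - half_variation s p.2) <= eps.
  move=> e0; have [delta d0 H] := TV_short e0; exists delta => // l dl l21 ll.
  have tvfin (p : R * R) : p \in l ->
      total_variation (clamp p.2) (clamp p.1) f \is a fin_num.
    move=> pl; have /andP[a2 _] := clamp_itv p.2; have /andP[_ b1] := clamp_itv p.1.
    by rewrite TV_fin// clamp_nd// l21.
  rewrite -lee_fin; apply: le_trans (H l dl l21 ll).
  rewrite big_seq [leRHS]big_seq -sumEFin; apply: lee_sum => p pl.
  rewrite -[leRHS]fineK ?tvfin// lee_fin.
  by have /andP[] := half_variationB s1 (l21 p pl).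
have rc x : half_variation s y @[y --> x^'+] --> half_variation s x.
  apply/cvgrPdist_le => e e0; have [delta d0 H] := ac _ e0.
  near=> y.
  have xy : x <= y by near: y; exact: nbhs_right_ge.
  have yd : y - x < delta.
    by rewrite ltrBlDl; near: y; apply: nbhs_right_lt; rewrite ltrDl.
  rewrite distrC ger0_norm ?subr_ge0 ?nd//.
  have := H [:: (y, x)]; rewrite big_seq1/=; apply => //.
    by move=> p; rewrite inE => /eqP ->.
  by rewrite /gaps_length big_seq1.
pose F : cumulative R R :=
  HB.pack (half_variation s) (isCumulative.Build R _ R (half_variation s) nd rc).
apply: (@stieltjes_density R F) => //.
exists (fine (total_variation a b f)) => x y.
have [xy|/ltW/nd] := leP x y; last first.
  rewrite -subr_le0 => /le_trans; apply; apply: fine_ge0; exact: total_variation_ge0.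
have /andP[_ /le_trans] := half_variationB s1 xy; apply.
have /andP[ax xb] := clamp_itv x; have /andP[ay yb] := clamp_itv y.
have xy' := clamp_nd xy.
rewrite fine_le ?TV_fin// (total_variationD _ ax xb) (total_variationD _ xy' yb).
rewrite addeA (addeC (total_variation a _ f)) -addeA leeDl// adde_ge0//;
  exact: total_variation_ge0.
Unshelve. all: by end_near. Qed.

Lemma abs_continuous_density : exists2 h : R -> R, mu.-integrable setT (EFin \o h) &
  forall x y, a <= x -> x <= y -> y <= b -> f y - f x = \int[mu]_(t in `]x, y]) h t.
Proof.
have [h1 ih1 H1] := half_variation_density (normr1 R).
have [h2 ih2 H2] := half_variation_density (normrN1 R).
exists (fun t => h1 t - h2 t); first exact: integrable_subR.
move=> x y ax xy yb.
rewrite RintegralB//; last 2 first.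
- exact: integrableS ih1.
- exact: integrableS ih2.
rewrite -H1// -H2// /half_variation !clamp_id ?ax ?yb ?(le_trans ax) ?(le_trans xy)//.
by lra.
Qed.

End abs_continuous_density.

Section linear_bound_at_zeros.
Context {R : realType}.
Notation mu := (@lebesgue_measure R).
Implicit Types (f : R -> R) (a b x : R).

Lemma derive1_zero_at_zero f x : (forall y, 0 <= f y) -> f x = 0 ->
  derivable f x 1 -> f^`()%classic x = 0.
Proof.
move=> f0 fx0 /derivableP; rewrite -derive1E => /is_derive1_caratheodory[g [fE cg <-]].
have [g_lt0|g_gt0|//] := ltgtP (g x) 0.
  have /cvgr_lt/(_ _ g_lt0) : g y @[y --> x] --> g x by exact: cg.
  move=> /nbhs_ballP[e /= e0 /(_ (x + e / 2))].
  rewrite /ball/= opprD addrA subrr sub0r normrN gtr0_norm ?divr_gt0//.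
  rewrite ltr_pdivrMr// ltr_pMr// ltr1n => /(_ isT) gneg.
  have := f0 (x + e / 2); have := fE (x + e / 2).
  rewrite fx0 subr0 [x + _]addrC addrK addrC => ->.
  by rewrite leNgt nmulr_rlt0// divr_gt0.
have /cvgr_gt/(_ _ g_gt0) : g y @[y --> x] --> g x by exact: cg.
move=> /nbhs_ballP[e /= e0 /(_ (x - e / 2))].
rewrite /ball/= opprB addrCA subrr addr0 gtr0_norm ?divr_gt0//.
rewrite ltr_pdivrMr// ltr_pMr// ltr1n => /(_ isT) gpos.
have := f0 (x - e / 2); have := fE (x - e / 2).
rewrite fx0 subr0 addrAC subrr sub0r => ->.
by rewrite leNgt pmulr_rlt0// oppr_lt0 divr_gt0.
Qed.

Lemma abs_continuous_ae_derivable a b f (h : R -> R) :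
  mu.-integrable setT (EFin \o h) ->
  (forall x y, a <= x -> x <= y -> y <= b -> f y - f x = \int[mu]_(t in `]x, y]) h t) ->
  {ae mu, forall x, x \in `]a, b[ -> derivable f x 1 /\ f^`()%classic x = h x}.
Proof.
move=> ih fE.
have li : locally_integrable setT h by apply: open_integrable_locally => //; exact: openT.
have ii y : mu.-integrable [set` Interval (BRight a) (BRight y)] (EFin \o h).
  exact: integrableS ih.
apply: ae_mono (FTC1 ii li) => x /= H; rewrite in_itv/= => /andP[ax xb].
have [|dF F'] := H; first by rewrite lte_fin.
set F := (fun x : R => _) in dF F'.
pose F1 y := F y + f a.
have nearE : \forall y \near x, F1 y = f y.
  near=> y; rewrite /F1 /F -fE//; first by rewrite subrK.
    by apply/ltW; near: y; exact: lt_nbhsr.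
  by apply/ltW; near: y; exact: lt_nbhsl.
have dF1 : is_derive x 1 F1 (h x).
  have HF : is_derive x 1 F (h x) by rewrite -F' derive1E; exact/derivableP.
  have -> : F1 = F + cst (f a) by [].
  by apply: is_derive_eq; rewrite addr0.
have df := near_eq_is_derive nearE dF1.
by split; [case: df|rewrite derive1E; case: df].
Unshelve. all: by end_near. Qed.

Lemma ge0_le_integralT {d} {T : measurableType d} (m : {measure set T -> \bar R})
    (f1 f2 : T -> \bar R) :
  (forall t, 0 <= f1 t)%E -> (forall t, f1 t <= f2 t)%E ->
  (\int[m]_t f1 t <= \int[m]_t f2 t)%E.
Proof.
move=> f10 f12; rewrite !ge0_integralTE//; last by move=> t; exact: le_trans (f12 t).
by apply: le_ereal_sup => _ [k kf <-]; exists k => // t; exact: le_trans (f12 t).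
Qed.

Lemma amgm (k u v : R) : 0 < k -> 0 < v -> `|u| <= 2^-1 * (k * (u ^+ 2 / v) + v / k).
Proof.
move=> k0 v0; rewrite -subr_ge0.
have -> : 2^-1 * (k * (u ^+ 2 / v) + v / k) - `|u| =
    (k * `|u| - v) ^+ 2 / (2 * k * v).
  by rewrite -[u ^+ 2]real_normK ?num_real//; field; rewrite !gt_eqF.
by rewrite divr_ge0 ?sqr_ge0// !mulr_ge0// ltW.
Qed.

Lemma measurable_pos f : measurable_fun setT f -> measurable [set x | 0 < f x].
Proof.
move=> mf; rewrite (_ : [set x | 0 < f x] = setT `&` f @^-1` `]0, +oo[).
  exact: mf.
by apply/seteqP; split => x /=; rewrite in_itv/= andbT => // -[].
Qed.

Lemma measurable_inv_ge0 f : measurable_fun setT f -> (forall x, 0 <= f x) ->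
  measurable_fun setT (fun x => (f x)^-1).
Proof.
move=> mf f0; have -> : (fun x => (f x)^-1) = (fun x => f x `^ (-1)).
  by apply/funext => x; rewrite powR_inv1.
exact: (measurableT_comp (measurable_powR _) mf).
Qed.

Let fisher_increment f a b (M k : R) : measurable_fun setT f -> (forall y, 0 <= f y) ->
  bounded_fisher f -> a < b -> 0 < k -> (forall t, a <= t <= b -> f t <= M) ->
  forall s t, a <= s -> s <= t -> t <= b ->
  `|f t - f s| <= 2^-1 * (k * fine (fisher f) + M / k * (b - a)).
Proof.
move=> mf f0 [fAC fI] ab k0 fM s t as_ st tb.
have [h ih fE] := abs_continuous_density (ltW ab) (fAC a b).
have [N [mN N0 sN]] := abs_continuous_ae_derivable ih fE.
have mh := integrable_measR ih.
have goodN x : a < x < b -> ~ N x -> derivable f x 1 /\ f^`()%classic x = h x.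
  move=> axb nN; apply: contrapT => H; apply: nN; apply: sN => /= H1.
  by apply: H; apply: H1; rewrite in_itv.
have M0 : 0 <= M by apply: le_trans (fM a _); rewrite ?f0// lexx ltW.
have fisher0 : (0 <= fisher f)%E.
  by apply: integral_ge0 => x /= fx; rewrite lee_fin divr_ge0// sqr_ge0.
have fisherE : (fine (fisher f))%:E = fisher f.
  by rewrite fineK// ge0_fin_numE.
pose D : set R := (`]a, b[%classic `\` N) `&` [set x | 0 < f x].
have mD : measurable D.
  apply: measurableI; first exact: measurableD.
  exact: measurable_pos.
pose q : R -> R := fun x => (h x ^+ 2 / f x) * \1_D x.
have q0 x : 0 <= q x by rewrite mulr_ge0// divr_ge0// sqr_ge0.
have mq : measurable_fun setT q.
  apply: measurable_funM; last exact: measurable_indic.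
  apply: measurable_funM; first exact: measurable_funX.
  exact: measurable_inv_ge0.
have qI : (\int[mu]_x (q x)%:E <= fisher f)%E.
  rewrite /fisher [leRHS]integral_mkcond; apply: ge0_le_integralT => x.
    by rewrite lee_fin.
  rewrite patchE /q indicE; case: ifPn; last first.
    rewrite notin_setE/= => fx; rewrite memNset ?mulr0//.
    by move=> [_].
  rewrite inE/= => fx; have [[[axb nN] _]|nD] := pselect (D x).
    have [|_ ->] := goodN x _ nN; first by move: axb; rewrite /= in_itv.
    by rewrite lee_fin real_normK ?num_real// mem_set ?mulr1.
  by rewrite memNset// mulr0 lee_fin divr_ge0// sqr_ge0.
have ihI : mu.-integrable `]s, t]%classic (EFin \o h) by exact: integrableS ih.
have ihI' : mu.-integrable `]s, t[%classic (EFin \o h) by exact: integrableS ih.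
rewrite fE// -Rintegral_itv_bndo_bndc//.
apply: (le_trans (le_normr_Rintegral _ ihI')) => //.
pose ind : R -> R := \1_(`]a, b[%classic).
pose B x := 2^-1 * (k * q x + M / k * ind x).
have kM : 0 <= M / k by rewrite divr_ge0// ltW.
have B0 x : 0 <= B x.
  by rewrite mulr_ge0// addr_ge0// mulr_ge0// ltW.
have mB : measurable_fun setT B.
  apply: measurable_funM => //; apply: measurable_funD; first exact: measurable_funM.
  by apply: measurable_funM => //; exact: measurable_indic.
have hB : (\int[mu]_(x in `]s, t[) `|h x|%:E <= \int[mu]_(x in `]s, t[) (B x)%:E)%E.
  apply: ae_ge0_le_integral => //.
  - by apply/measurable_EFinP; apply: measurableT_comp => //; exact: measurable_funTS.
  - by move=> x _; rewrite lee_fin.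
  - by apply/measurable_EFinP; exact: measurable_funTS.
  exists N; split => // x /= H; apply: contrapT => nN; apply: H; rewrite in_itv/=.
  move=> /andP[sx xt]; rewrite lee_fin.
  have axb : a < x < b by rewrite (le_lt_trans as_ sx) (lt_le_trans xt tb).
  have [df <-] := goodN x axb nN.
  have := f0 x; rewrite le_eqVlt => /predU1P[fx|fx].
    by rewrite derive1_zero_at_zero// normr0.
  have Dx : D x by split => //; split.
  apply: (le_trans (amgm _ k0 fx)); rewrite /B ler_wpM2l//; apply: lerD.
    by rewrite ler_wpM2l ?(ltW k0)// /q indicE mem_set// mulr1 (goodN x axb nN).2.
  rewrite /ind indicE mem_set ?mulr1 ?ler_wpM2r ?invr_ge0 ?(ltW k0) ?fM//.
  by have /andP[/ltW-> /ltW->] := axb.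
have BI : (\int[mu]_(x in `]s, t[) (B x)%:E <=
    (2^-1 * (k * fine (fisher f) + M / k * (b - a)))%:E)%E.
  apply: (@le_trans _ _ (\int[mu]_x (B x)%:E)%E).
    apply: ge0_subset_integral => //; first exact/measurable_EFinP.
    by move=> x _; rewrite lee_fin.
  rewrite /B; under eq_integral do rewrite EFinM.
  rewrite ge0_integralZl//; last 2 first.
  - by apply/measurable_EFinP; apply: measurable_funD; apply: measurable_funM => //;
      exact: measurable_indic.
  - by move=> x _; rewrite lee_fin addr_ge0// mulr_ge0// ltW.
  rewrite EFinM; apply: lee_wpmul2l; first by rewrite lee_fin.
  under eq_integral do rewrite EFinD.
  rewrite ge0_integralD//; last 4 first.
  - by move=> x _; rewrite lee_fin mulr_ge0// ltW.
  - by apply/measurable_EFinP; exact: measurable_funM.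
  - by move=> x _; rewrite lee_fin mulr_ge0.
  - by apply/measurable_EFinP; apply: measurable_funM => //; exact: measurable_indic.
  rewrite EFinD; apply: leeD.
    under eq_integral do rewrite EFinM.
    rewrite ge0_integralZl//; last 3 first.
    - exact/measurable_EFinP.
    - by move=> x _; rewrite lee_fin.
    - by rewrite lee_fin ltW.
    by rewrite EFinM; apply: lee_wpmul2l; rewrite ?fisherE// lee_fin ltW.
  under eq_integral do rewrite EFinM.
  rewrite ge0_integralZl//; last 2 first.
  - by apply/measurable_EFinP; exact: measurable_indic.
  - by move=> x _; rewrite lee_fin.
  rewrite (EFinM (M / k) (b - a)); apply: lee_wpmul2l; first by rewrite lee_fin.
  rewrite integral_indic//= setIT.
  by rewrite lebesgue_measure_itv/= lte_fin ab -EFinB.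
rewrite -lee_fin; apply: le_trans BI; apply: le_trans hB.
rewrite /Rintegral fineK//.
exact: (integrable_fin_num _ (integrable_normR ihI')).
Qed.

(** On an interval of length [L] containing a zero of [f], let [M] be the supremum of
    [f].  Integrating [`|f'| <= (k * f' ^ 2 / f + f / k) / 2] from the zero gives
    [M <= (k * I + M * L / k) / 2] with [I] the Fisher information, and [k = L] turns this
    into [M <= L * I]. *)
Lemma fisher_linear_bound f : measurable_fun setT f -> (forall y, 0 <= f y) ->
  bounded_fisher f ->
  forall x y, f x = 0 -> f y <= fine (fisher f) * `|y - x|.
Proof.
move=> mf f0 fI.
have core a b z : a < b -> a <= z <= b -> f z = 0 ->
    forall t, a <= t <= b -> f t <= fine (fisher f) * (b - a).
  move=> ab azb fz.
  pose A : set R := [set f t | t in `[a, b]%classic].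
  have inc (M k : R) : 0 < k -> (forall t, a <= t <= b -> f t <= M) ->
      forall t, a <= t <= b -> f t <= 2^-1 * (k * fine (fisher f) + M / k * (b - a)).
    move=> k0 fM t atb; have H := fisher_increment mf f0 fI ab k0 fM.
    rewrite -[f t]subr0 -fz; apply: (le_trans (ler_norm _)).
    have [az zb] := andP azb; have [at_ tb] := andP atb.
    have [zt|tz] := leP z t; first exact: H.
    by rewrite distrC; apply: H => //; exact: ltW.
  have L0 : 0 < b - a by rewrite subr_gt0.
  have [M0 HM0] : exists M, forall t, a <= t <= b -> f t <= M.
    have [h ih fE] := abs_continuous_density (ltW ab) (fI.1 a b).
    have I u v : \int[mu]_(x in `]u, v]) h x <= \int[mu]_x `|h x|.
      have ihI : mu.-integrable `]u, v]%classic (EFin \o h) by exact: integrableS ih.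
      apply: (le_trans (ler_norm _)); apply: (le_trans (le_normr_Rintegral _ ihI)) => //.
      have ihn := integrable_normR ih.
      rewrite /Rintegral fine_le ?(integrable_fin_num _ ihn)//.
        exact: (integrable_fin_num _ (integrable_normR ihI)).
      apply: ge0_subset_integral => //.
      by apply/measurable_EFinP; exact: integrable_measR ihn.
    exists (f a + \int[mu]_x `|h x|) => t /andP[at_ tb].
    by rewrite -lerBlDl fE.
  have Asup : has_sup A.
    split; first by exists (f z), z => //; rewrite in_itv.
    by exists M0 => _ [t tab <-]; apply: HM0; move: tab; rewrite /= in_itv.
  have fsup t : a <= t <= b -> f t <= sup A.
    by move=> tab; apply: ub_le_sup; [exact: Asup.2|exists t => //; rewrite /= in_itv].
  have : sup A <= 2^-1 * ((b - a) * fine (fisher f) + sup A / (b - a) * (b - a)).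
    apply: ge_sup; first exact: Asup.1.
    move=> _ [t tab <-]; apply: inc => //.
  rewrite divfK ?gt_eqF// => H t /fsup; rewrite mulrC; lra.
move=> x y fx; have [xy|yx|<-] := ltgtP x y.
- rewrite gtr0_norm ?subr_gt0//; apply: (core _ _ x) => //; first by rewrite lexx ltW.
  by rewrite lexx ltW.
- rewrite ltr0_norm ?subr_lt0// opprB; apply: (core _ _ x) => //.
    by rewrite lexx ltW.
  by rewrite lexx ltW.
- by rewrite fx subrr normr0 mulr0.
Qed.

End linear_bound_at_zeros.

(** * Trigonometric kernels *)

Section Fubini_kernel.
Context {d1 d2} {T1 : measurableType d1} {T2 : measurableType d2} {R : realType}.
Context (m1 : {sigma_finite_measure set T1 -> \bar R}).
Context (m2 : {sigma_finite_measure set T2 -> \bar R}).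

Lemma integrable_mul_bounded (a k : T1 -> R) : m1.-integrable setT (EFin \o a) ->
  measurable_fun setT k -> (forall y, `|k y| <= 1) ->
  m1.-integrable setT (EFin \o (fun y => a y * k y)).
Proof.
move=> ia mk k1; apply: integrable_dom (integrable_normR ia) => //.
  by apply: measurable_funM => //; exact: integrable_measR ia.
by move=> x _; rewrite normrM ler_piMr.
Qed.

Let kernel (g : T1 -> R) (a : T2 -> R) (k : T1 -> T2 -> R) (z : T1 * T2) : R :=
  g z.1 * (a z.2 * k z.1 z.2).

Let integrable_kernel (g : T1 -> R) (a : T2 -> R) (k : T1 -> T2 -> R) :
  m1.-integrable setT (EFin \o g) -> m2.-integrable setT (EFin \o a) ->
  measurable_fun setT (fun z : T1 * T2 => k z.1 z.2) ->
  (forall x y, `|k x y| <= 1) ->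
  (m1 \x m2)%E.-integrable setT (EFin \o kernel g a k).
Proof.
move=> ig ia mk k1.
have mF : measurable_fun setT (kernel g a k).
  apply: measurable_funM.
    apply: (measurableT_comp (integrable_measR ig)); exact: measurable_fst.
  apply: measurable_funM => //.
  apply: (measurableT_comp (integrable_measR ia)); exact: measurable_snd.
have mF' : measurable_fun setT (EFin \o kernel g a k) by exact/measurable_EFinP.
have mabs : measurable_fun setT (abse \o (EFin \o kernel g a k)).
  exact: measurableT_comp.
have ina := integrable_normR ia.
have ing := integrable_normR ig.
have A0 : (0 <= \int[m2]_y (`|a y|)%:E)%E.
  by apply: integral_ge0 => y _; rewrite lee_fin.
apply/(integrable12ltyP _ _ mF').
apply: (@le_lt_trans _ _ (\int[m1]_x (`|g x|%:E * \int[m2]_y `|a y|%:E))%E).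
  apply: ge0_le_integral => //.
  - by move=> x _; apply: integral_ge0.
  - by have := @measurable_fun_fubini_tonelli_F _ _ _ _ _ m2 _ mabs
      (fun z => abse_ge0 _); apply.
  - by apply: emeasurable_funM => //; exact: measurable_int ing.
  - move=> x _; rewrite -ge0_integralZl_EFin//; last exact: measurable_int ina.
    apply: ge0_le_integral => //.
    + by apply/measurable_EFinP; apply: measurableT_comp => //;
        apply/(measurableT_comp mF)/pair1_measurable.
    + by apply/measurable_EFinP; apply: measurable_funM => //;
        exact: integrable_measR ina.
    + move=> y _; rewrite /= lee_fin /kernel/= !normrM.
      by rewrite ler_wpM2l// ler_piMr.
rewrite ge0_integralZr//; last exact: measurable_int ing.
apply: lte_mul_pinfty.
- by apply: integral_ge0.
- exact: integrable_fin_num ing.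
- exact: integrable_lty ina.
Qed.

Lemma integrable_kernel_inner (g : T1 -> R) (a : T2 -> R) (k : T1 -> T2 -> R) :
  m1.-integrable setT (EFin \o g) -> m2.-integrable setT (EFin \o a) ->
  measurable_fun setT (fun z : T1 * T2 => k z.1 z.2) ->
  (forall x y, `|k x y| <= 1) ->
  m1.-integrable setT (EFin \o (fun x => g x * \int[m2]_y (a y * k x y))).
Proof.
move=> ig ia mk k1.
have iF := integrable_kernel ig ia mk k1.
apply: eq_integrable (integrable_fubini_F iF) => // x _.
have iak : m2.-integrable setT (EFin \o (fun y => a y * k x y)).
  apply: integrable_dom (integrable_normR ia) => //.
    apply: measurable_funM; first exact: integrable_measR ia.
    exact: (measurableT_comp mk (pair1_measurable x)).
  by move=> y _; rewrite normrM ler_piMr.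
rewrite /= EFinM fineK; last exact: integrable_fin_num iak.
by rewrite -integralZl.
Qed.

Lemma Fubini_kernel (g : T1 -> R) (a : T2 -> R) (k : T1 -> T2 -> R) :
  m1.-integrable setT (EFin \o g) -> m2.-integrable setT (EFin \o a) ->
  measurable_fun setT (fun z : T1 * T2 => k z.1 z.2) ->
  (forall x y, `|k x y| <= 1) ->
  \int[m1]_x (g x * \int[m2]_y (a y * k x y)) =
  \int[m2]_y (a y * \int[m1]_x (g x * k x y)).
Proof.
move=> ig ia mk k1.
have iF := integrable_kernel ig ia mk k1.
have iak x : m2.-integrable setT (EFin \o (fun y => a y * k x y)).
  apply: integrable_dom (integrable_normR ia) => //.
    apply: measurable_funM; first exact: integrable_measR ia.
    exact: (measurableT_comp mk (pair1_measurable x)).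
  by move=> y _; rewrite normrM ler_piMr.
have igk y : m1.-integrable setT (EFin \o (fun x => g x * k x y)).
  apply: integrable_mul_bounded => //.
  exact: (measurableT_comp mk (pair2_measurable y)).
transitivity (fine (\int[m1]_x \int[m2]_y (EFin \o kernel g a k) (x, y))%E).
  congr fine; apply: eq_integral => x _.
  rewrite EFinM fineK; last exact: integrable_fin_num (iak x).
  by rewrite -integralZl//; exact: iak.
rewrite (Fubini iF); congr fine; apply: eq_integral => y _.
rewrite EFinM fineK; last exact: integrable_fin_num (igk y).
rewrite -integralZl//; last exact: igk.
by apply: eq_integral => x _; rewrite /kernel /= -!EFinM; congr EFin; ring.
Qed.

End Fubini_kernel.

Section mean_value.
Context {R : realType}.

Lemma lipschitz_derive (F dF : R -> R) (M : R) :
  (forall x : R, is_derive x 1 F (dF x)) -> (forall x, `|dF x| <= M) ->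
  forall x y, `|F x - F y| <= M * `|x - y|.
Proof.
move=> FdF dFM.
have cF : continuous F.
  by move=> x; apply: differentiable_continuous; apply/derivable1_diffP; case: (FdF x).
have H x y : x <= y -> `|F x - F y| <= M * `|x - y|.
  move=> xy; rewrite distrC (distrC x).
  have [c _ ->] := MVT_segment xy (fun z _ => FdF z)
    (continuous_subspaceT cF).
  by rewrite normrM ler_wpM2r.
move=> x y; have [/H//|/ltW/H] := leP x y.
by rewrite distrC (distrC x).
Qed.

Lemma norm_sin_le (x : R) : `|sin x| <= `|x|.
Proof.
have := @lipschitz_derive sin cos 1 (@is_derive_sin R) (@cos_max R) x 0.
by rewrite sin0 !subr0 mul1r.
Qed.

Lemma one_sub_cos_ge0 (x : R) : 0 <= 1 - cos x.
Proof. by rewrite subr_ge0 cos_le1. Qed.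

Lemma one_sub_cos_le2 (x : R) : 1 - cos x <= 2.
Proof. by rewrite lerBlDl -lerBlDr; have := cos_geN1 x; lra. Qed.

Lemma one_sub_cos_le_norm (x : R) : 1 - cos x <= `|x|.
Proof.
have h (y : R) : `|- sin y| <= 1 by rewrite normrN sin_max.
have := lipschitz_derive (@is_derive_cos R) h 0 x.
rewrite cos0 sub0r normrN mul1r; apply: le_trans; exact: ler_norm.
Qed.

Lemma one_sub_cos_le_sqr (x : R) : 1 - cos x <= x ^+ 2.
Proof.
have -> : x = (x / 2) *+ 2 by rewrite -mulr_natr divfK.
rewrite cos_mulr2n.
have : `|sin (x / 2)| ^+ 2 <= `|x / 2| ^+ 2.
  by rewrite ler_pXn2r ?nnegrE// norm_sin_le.
rewrite !real_normK ?num_real//; have := cos2Dsin2 (x / 2).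
rewrite (_ : (x / 2 *+ 2) ^+ 2 = 4 * (x / 2) ^+ 2); last by ring.
set s := sin _ ^+ 2; set c := cos _ ^+ 2; set t := (x / 2) ^+ 2.
have : 0 <= t by exact: sqr_ge0.
lra.
Qed.

End mean_value.

Section signed_power.
Context {R : realType}.
Implicit Types a b x y : R.

Definition signed_powR a x : R := x / `|x| * `|x| `^ a.

Lemma signed_powR0 a : signed_powR a 0 = 0.
Proof. by rewrite /signed_powR !mul0r. Qed.

Lemma signed_powRN a x : signed_powR a (- x) = - signed_powR a x.
Proof. by rewrite /signed_powR normrN !mulNr. Qed.

Lemma signed_powR_gt0E a x : 0 < x -> signed_powR a x = x `^ a.
Proof. by move=> x0; rewrite /signed_powR gtr0_norm// divff ?mul1r// gt_eqF. Qed.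

Lemma signed_powRM a x y :
  signed_powR a (x * y) = signed_powR a x * signed_powR a y.
Proof. by rewrite /signed_powR normrM powRM// invfM; ring. Qed.

Lemma norm_signed_powR_le a x : `|signed_powR a x| <= `|x| `^ a.
Proof.
have [->|x0] := eqVneq x 0; first by rewrite signed_powR0 normr0 powR_ge0.
rewrite /signed_powR normrM normrM normfV normr_id divff ?normr_eq0// mul1r.
by rewrite ger0_norm// powR_ge0.
Qed.

Lemma measurable_signed_powR a : measurable_fun setT (signed_powR a).
Proof.
apply: measurable_funM; last exact: measurable_powR_norm.
have -> : (fun x : R => x / `|x|) =
    (fun x => \1_`]0, +oo[%classic x - \1_`]-oo, 0[%classic x).
  apply/funext => x; rewrite !indicE /= !mem_setE !in_itv/= andbT.
  have [x0|x0|x0] := ltgtP 0 x; last by rewrite -x0 mul0r subr0.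
  - by rewrite gtr0_norm// divff ?gt_eqF// subr0.
  - by rewrite ltr0_norm// invrN mulrN divff ?lt_eqF// sub0r.
by apply: measurable_funB; apply: measurable_indic; exact: measurable_itv.
Qed.

End signed_power.

(** * A Fourier-free form of the fractional derivative *)

Section fractional_kernel.
Context {R : realType} (nu : R) (nu01 : 0 < nu < 1).
Notation mu := (@lebesgue_measure R).
Implicit Types c x y xi : R.

Lemma integrable_signed_powR_mul (h : R -> R) c : 0 <= c ->
  measurable_fun setT h -> (forall xi, `|h xi| <= 2) ->
  (forall xi, `|h xi| <= c * `|xi|) ->
  mu.-integrable setT (EFin \o (fun xi => signed_powR (nu - 2) xi * h xi)).
Proof.
move=> c0 mh h2 hc; have /andP[nu0 nu1] := nu01.
have I : mu.-integrable setT (EFin \o (fun x : R =>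
    (2 + c) * if `|x| <= 1 then `|x| `^ (nu - 1) else `|x| `^ (- (2 - nu)))).
  apply: (integrable_mulR measurableT); apply: integrable_powR_split; lra.
apply: integrable_dom I => //.
  by apply: measurable_funM => //; exact: measurable_signed_powR.
move=> x _; rewrite normrM.
have s := norm_signed_powR_le (nu - 2) x.
have [->|x0] := eqVneq x 0.
  rewrite signed_powR0 normr0 mul0r mulr_ge0 ?addr_ge0//.
  by case: ifP => _; exact: powR_ge0.
case: ifP => x1; last first.
  rewrite opprB mulrC; apply: ler_pM => //.
  by rewrite (le_trans (h2 x))// lerDl.
have -> : `|x| `^ (nu - 1) = `|x| `^ (nu - 2) * `|x|.
  rewrite -[X in _ * X]powRr1// -powRD ?normr_eq0 ?x0 ?implybT//; congr (_ `^ _).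
  by ring.
rewrite mulrCA; apply: ler_pM => //; apply: (le_trans (hc x)).
by rewrite ler_wpM2r// lerDr.
Qed.

Lemma integrable_powR_N2_mul (h : R -> R) c : 0 <= c ->
  measurable_fun setT h -> (forall xi, `|h xi| <= 2) ->
  (forall xi, `|h xi| <= c * `|xi| ^+ 2) ->
  mu.-integrable setT (EFin \o (fun xi => `|xi| `^ (-2) * h xi)).
Proof.
move=> c0 mh h2 hc.
have I : mu.-integrable setT (EFin \o (fun x : R =>
    (2 + c) * if `|x| <= 1 then `|x| `^ 0 else `|x| `^ (- 2))).
  by apply: (integrable_mulR measurableT); apply: integrable_powR_split; lra.
apply: integrable_dom I => //.
  by apply: measurable_funM => //; exact: measurable_powR_norm.
move=> x _; rewrite normrM (ger0_norm (powR_ge0 _ _)).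
have [->|x0] := eqVneq x 0.
  rewrite normr0 ler01 powR0 ?oppr_eq0 ?pnatr_eq0// mul0r mulr_ge0 ?addr_ge0//.
case: ifP => x1; last first.
  rewrite mulrC; apply: ler_wpM2r; first exact: powR_ge0.
  by rewrite (le_trans (h2 x))// lerDl.
rewrite powRr0 mulr1.
apply: (@le_trans _ _ (`|x| `^ (-2) * (c * `|x| ^+ 2))).
  by rewrite ler_wpM2l// powR_ge0.
rewrite mulrCA powR_invn// mulVf ?mulr1 ?lerDr//.
by rewrite expf_eq0/= normr_eq0.
Qed.

Let measurable_cos_mul c : measurable_fun setT (fun xi => cos (c * xi)).
Proof.
apply: (measurableT_comp (continuous_measurable_fun (@continuous_cos R))).
exact: measurable_funM.
Qed.

Let measurable_sin_mul c : measurable_fun setT (fun xi => sin (c * xi)).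
Proof.
apply: (measurableT_comp (continuous_measurable_fun (@continuous_sin R))).
exact: measurable_funM.
Qed.

Let measurable_cosN c : measurable_fun setT (fun xi => 1 - cos (c * xi)).
Proof. exact: measurable_funB. Qed.

Let norm_cosN x : `|1 - cos x| = 1 - cos x.
Proof. by rewrite ger0_norm// one_sub_cos_ge0. Qed.

Lemma integrable_kernel_even c :
  mu.-integrable setT (EFin \o (fun xi => `|xi| `^ (-2) * (1 - cos (c * xi)))).
Proof.
apply: (@integrable_powR_N2_mul _ (c ^+ 2)) => //; first exact: sqr_ge0.
  by move=> xi; rewrite norm_cosN one_sub_cos_le2.
move=> xi; rewrite norm_cosN real_normK ?num_real// -exprMn.
exact: one_sub_cos_le_sqr.
Qed.

Lemma integrable_kernel_odd c :
  mu.-integrable setT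
    (EFin \o (fun xi => signed_powR (nu - 2) xi * (1 - cos (c * xi)))).
Proof.
apply: (@integrable_signed_powR_mul _ `|c|) => //.
  by move=> xi; rewrite norm_cosN one_sub_cos_le2.
by move=> xi; rewrite norm_cosN -normrM; exact: one_sub_cos_le_norm.
Qed.

Lemma integrable_kernel_sin c :
  mu.-integrable setT
    (EFin \o (fun xi => signed_powR (nu - 2) xi * sin (c * xi))).
Proof.
apply: (@integrable_signed_powR_mul _ `|c|) => //.
  by move=> xi; apply: (le_trans (sin_max _)); lra.
by move=> xi; rewrite -normrM; exact: norm_sin_le.
Qed.

(** Both integrals have closed forms in terms of [pi] and the Gamma function; only the
    scaling of the kernels and [even_cst != 0] matter below. *)
Definition even_cst : R := \int[mu]_xi (`|xi| `^ (-2) * (1 - cos xi)).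
Definition odd_cst : R := \int[mu]_xi (signed_powR (nu - 2) xi * sin xi).

Lemma integral_kernel_even c :
  \int[mu]_xi (`|xi| `^ (-2) * (1 - cos (c * xi))) = even_cst * `|c|.
Proof.
have [->|c0] := eqVneq c 0.
  rewrite normr0 mulr0 (_ : (fun _ => _) = cst 0); last first.
    by apply/funext => x; rewrite mul0r cos0 subrr mulr0.
  by rewrite Rintegral_cst// mul0r.
have := Rintegral_scale c0 (integrable_kernel_even 1).
rewrite [X in _ = _ * X](_ : _ = even_cst); last first.
  by apply: eq_Rintegral => x _; rewrite mul1r.
move=> H.
transitivity (`|c| ^+ 2 * (`|c|^-1 * even_cst)); last first.
  rewrite mulrA expr2 mulfK ?normr_eq0//; exact: mulrC.
rewrite -H -RintegralZl//; last exact: integrable_scale (integrable_kernel_even 1).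
apply: eq_Rintegral => x _; rewrite mul1r normrM powRM// !mulrA.
rewrite (powR_invn 2 (normr_ge0 c)) divff ?mul1r//.
by rewrite expf_eq0/= normr_eq0.
Qed.

Lemma integral_kernel_sin c :
  \int[mu]_xi (signed_powR (nu - 2) xi * sin (c * xi)) =
  odd_cst * signed_powR (1 - nu) c.
Proof.
have [->|c0] := eqVneq c 0.
  rewrite signed_powR0 mulr0 (_ : (fun _ => _) = cst 0); last first.
    by apply/funext => x; rewrite mul0r sin0 mulr0.
  by rewrite Rintegral_cst// mul0r.
have := Rintegral_scale c0 (integrable_kernel_sin 1).
rewrite [X in _ = _ * X](_ : _ = odd_cst); last first.
  by apply: eq_Rintegral => x _; rewrite mul1r.
move=> H.
have c0' : `|c| != 0 by rewrite normr_eq0.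
have sc : c / `|c| * (c / `|c|) = 1.
  have [/gtr0_norm->|/ltr0_norm->|/eqP] := ltgtP 0 c; last by rewrite eq_sym (negbTE c0).
    by rewrite divff// mulr1.
  by rewrite invrN mulrN divff// mulrNN mulr1.
transitivity (signed_powR (2 - nu) c * (`|c|^-1 * odd_cst)); last first.
  rewrite mulrA mulrC; congr (_ * _); rewrite /signed_powR -mulrA; congr (_ * _).
  by rewrite -powR_inv1// -powRD ?c0' ?implybT//; congr (_ `^ _); ring.
rewrite -H -RintegralZl//; last exact: integrable_scale (integrable_kernel_sin 1).
have E : signed_powR (2 - nu) c * signed_powR (nu - 2) c = 1.
  rewrite /signed_powR mulrACA sc mul1r -powRD ?c0' ?implybT//.
  by rewrite (_ : 2 - nu + _ = 0) ?powRr0//; ring.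
apply: eq_Rintegral => x _; rewrite mul1r signed_powRM.
by rewrite mulrA [X in _ = X * _]mulrA E mul1r.
Qed.

Lemma even_cst_neq0 : even_cst != 0.
Proof.
apply/eqP => K0.
have i1 := integrable_kernel_even 1.
have : (\int[mu]_xi `|(`|xi| `^ (-2) * (1 - cos (1 * xi)))%:E|)%E = 0%E.
  transitivity (\int[mu]_xi (`|xi| `^ (-2) * (1 - cos (1 * xi)))%:E)%E.
    apply: eq_integral => x _; rewrite gee0_abs// lee_fin mulr_ge0 ?powR_ge0//.
  rewrite -(fineK (integrable_fin_num _ i1))//; congr EFin.
  transitivity even_cst => //; apply: eq_Rintegral => x _.
  by rewrite mul1r.
move/(ae_eq_integral_abs _ measurableT (measurable_int _ i1)) => [N [mN N0 sN]].
have : (mu `]0%R, 2%R[%classic <= mu N)%E.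
  apply: le_measure; rewrite ?inE//; apply: subset_trans sN => x.
  rewrite /= in_itv/= => /andP[x0 x2] H.
  have /eqP := H I; rewrite /= mul1r eqe mulf_eq0 powR_eq0 normr_eq0 gt_eqF//=.
  rewrite subr_eq0 => /eqP cx.
  have := @sin2_gt0 R x; rewrite x0 x2 => /(_ isT).
  have := cos2Dsin2 x; rewrite -cx expr1n => /eqP.
  rewrite -subr_eq0 addrC addrA addNr add0r sqrf_eq0 => /eqP ->.
  by rewrite ltxx.
rewrite N0 lebesgue_measure_itv/= lte_fin ltr0n/= -EFinB lee_fin subr0.
by rewrite leNgt ltr0n.
Qed.

End fractional_kernel.

Section fourier_parts.
Context {R : realType}.
Notation mu := (@lebesgue_measure R).
Implicit Types (f g : R -> R) (x xi : R).

Definition cos_transform f xi : R := \int[mu]_x (f x * cos (xi * x)).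
Definition sin_transform f xi : R := \int[mu]_x (f x * sin (xi * x)).

Lemma fourierE f xi : mu.-integrable setT (EFin \o f) ->
  fourier f xi = (cos_transform f xi +i* - sin_transform f xi)%C.
Proof.
move=> fi; rewrite /fourier /Cintegral; congr (_ +i* _)%C.
  apply: eq_Rintegral => x _ /=.
  by rewrite cosN mulr0 subr0 mulrC.
transitivity (\int[mu]_x (-1 * (f x * sin (xi * x)))).
  apply: eq_Rintegral => x _ /=.
  by rewrite sinN mulr0 add0r mulrC; ring.
rewrite RintegralZl ?mulN1r//; apply: (integrable_mul_bounded fi) => [|y]; last first.
  exact: sin_max.
apply: (measurableT_comp (continuous_measurable_fun (@continuous_sin R))).
exact: measurable_funM.
Qed.

Lemma measurable_cos_affine (a b : R) : measurable_fun setT (fun x => cos (a * (x - b))).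
Proof.
apply: (measurableT_comp (continuous_measurable_fun (@continuous_cos R))).
by apply: measurable_funM => //; exact: measurable_funB.
Qed.

Lemma measurable_sin_affine (a b : R) : measurable_fun setT (fun x => sin (a * (x - b))).
Proof.
apply: (measurableT_comp (continuous_measurable_fun (@continuous_sin R))).
by apply: measurable_funM => //; exact: measurable_funB.
Qed.

Lemma measurable_cos_mul (a : R) : measurable_fun setT (fun x => cos (a * x)).
Proof. by have := measurable_cos_affine a 0; under eq_fun do rewrite subr0. Qed.

Lemma measurable_sin_mul (a : R) : measurable_fun setT (fun x => sin (a * x)).
Proof. by have := measurable_sin_affine a 0; under eq_fun do rewrite subr0. Qed.

Lemma integrable_cos_mul f a : mu.-integrable setT (EFin \o f) ->
  mu.-integrable setT (EFin \o (fun x => f x * cos (a * x))).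
Proof.
move=> fi; apply: (integrable_mul_bounded fi); first exact: measurable_cos_mul.
by move=> y; exact: cos_max.
Qed.

Lemma integrable_sin_mul f a : mu.-integrable setT (EFin \o f) ->
  mu.-integrable setT (EFin \o (fun x => f x * sin (a * x))).
Proof.
move=> fi; apply: (integrable_mul_bounded fi); first exact: measurable_sin_mul.
by move=> y; exact: sin_max.
Qed.

Lemma fractional_derivative_transform nu f g xi :
  mu.-integrable setT (EFin \o f) -> is_fractional_derivative nu f g ->
  cos_transform g xi = signed_powR nu xi * sin_transform f xi /\
  sin_transform g xi = - (signed_powR nu xi * cos_transform f xi).
Proof.
move=> fi [gi /(_ xi)]; rewrite !fourierE// => -[].
rewrite /signed_powR => e1 e2; split.
  by rewrite e1; ring.
by apply: oppr_inj; rewrite e2; ring.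
Qed.

Lemma cos_integral_shift f xi x0 : mu.-integrable setT (EFin \o f) ->
  \int[mu]_x (f x * cos (xi * (x - x0))) =
  cos (xi * x0) * cos_transform f xi + sin (xi * x0) * sin_transform f xi.
Proof.
move=> fi; rewrite /cos_transform /sin_transform.
have ic := integrable_cos_mul xi fi; have is_ := integrable_sin_mul xi fi.
rewrite -!RintegralZl// -RintegralD//; last 2 first.
- exact: integrable_mulR.
- exact: integrable_mulR.
by apply: eq_Rintegral => x _; rewrite mulrBr cosB; ring.
Qed.

Lemma sin_integral_shift f xi x0 : mu.-integrable setT (EFin \o f) ->
  \int[mu]_x (f x * sin (xi * (x - x0))) =
  cos (xi * x0) * sin_transform f xi - sin (xi * x0) * cos_transform f xi.
Proof.
move=> fi; rewrite /cos_transform /sin_transform.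
have ic := integrable_cos_mul xi fi; have is_ := integrable_sin_mul xi fi.
rewrite -!RintegralZl// -RintegralB//; last 2 first.
- exact: integrable_mulR.
- exact: integrable_mulR.
by apply: eq_Rintegral => x _; rewrite mulrBr sinB; ring.
Qed.

(** Pairing the fractional derivative with the tent function of half-width [e]
    at [x0].  Both sides are superpositions of the frequencies [xi] with the
    weights [`|xi| `^ (-2) * (1 - cos (e * xi))]: on the left these are the
    Fourier coefficients of the tent, while multiplying them by the symbol of
    the derivative gives those of a second difference of a signed power.  The
    constants are never evaluated. *)
Lemma fractional_derivative_tent nu f g x0 e : 0 < nu < 1 ->
  mu.-integrable setT (EFin \o f) -> is_fractional_derivative nu f g ->
  even_cst * \int[mu]_x (g x * (`|x - x0 + e| + `|x - x0 - e| - 2 * `|x - x0|)) =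
  odd_cst nu * \int[mu]_x (f x * (2 * signed_powR (1 - nu) (x - x0)
     - signed_powR (1 - nu) (x - x0 + e) - signed_powR (1 - nu) (x - x0 - e))).
Proof.
move=> nu01 fi fg; have [gi _] := fg.
pose a1 xi := `|xi| `^ (-2) * (1 - cos (e * xi)) : R.
pose a2 xi := signed_powR (nu - 2) xi * (1 - cos (e * xi)) : R.
have ia1 : mu.-integrable setT (EFin \o a1) by exact: integrable_kernel_even.
have ia2 : mu.-integrable setT (EFin \o a2) by exact: integrable_kernel_odd.
have mz : measurable_fun setT (fun z : R * R => z.2 * (z.1 - x0)).
  apply: measurable_funM; first exact: measurable_snd.
  by apply: measurable_funB => //; exact: measurable_fst.
have E1 x : \int[mu]_xi (a1 xi * cos (xi * (x - x0))) =
    even_cst / 2 * (`|x - x0 + e| + `|x - x0 - e| - 2 * `|x - x0|).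
  rewrite (_ : even_cst / 2 * _ = 2^-1 * (even_cst * `|x - x0 + e| +
      even_cst * `|x - x0 - e| - 2 * (even_cst * `|x - x0|))); last by ring.
  rewrite -!integral_kernel_even.
  have ik := @integrable_kernel_even R.
  rewrite -RintegralZl// -RintegralD// -RintegralB//; last 2 first.
  - exact: integrable_addR.
  - exact: integrable_mulR.
  rewrite -RintegralZl//; last first.
    by apply: integrable_subR => //; [exact: integrable_addR|exact: integrable_mulR].
  apply: eq_Rintegral => xi _; rewrite /a1; move: (x - x0) => u.
  by rewrite (mulrDl u e xi) (mulrBl xi u e) (mulrC u xi) cosD cosB; field.
have E2 x : \int[mu]_xi (a2 xi * sin (xi * (x - x0))) =
    odd_cst nu / 2 * (2 * signed_powR (1 - nu) (x - x0)
     - signed_powR (1 - nu) (x - x0 + e) - signed_powR (1 - nu) (x - x0 - e)).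
  rewrite (_ : odd_cst nu / 2 * _ = 2^-1 * (
      2 * (odd_cst nu * signed_powR (1 - nu) (x - x0))
      - odd_cst nu * signed_powR (1 - nu) (x - x0 + e)
      - odd_cst nu * signed_powR (1 - nu) (x - x0 - e))); last by ring.
  rewrite -!integral_kernel_sin//.
  have ik := integrable_kernel_sin nu01.
  rewrite -RintegralZl// -RintegralB//; last exact: integrable_mulR.
  rewrite -RintegralB//; last by apply: integrable_subR => //; exact: integrable_mulR.
  rewrite -RintegralZl//; last first.
    by apply: integrable_subR => //; apply: integrable_subR => //; exact: integrable_mulR.
  apply: eq_Rintegral => xi _; rewrite /a2; move: (x - x0) => u.
  by rewrite (mulrDl u e xi) (mulrBl xi u e) (mulrC u xi) sinD sinB; field.
apply: (@mulfI _ 2^-1); first by rewrite invr_eq0.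
have L (K : R) (h k : R -> R) (c : R -> R -> R) (a : R -> R) :
    (forall x, \int[mu]_xi (a xi * c x xi) = K / 2 * k x) ->
    mu.-integrable setT (EFin \o h) -> mu.-integrable setT (EFin \o a) ->
    measurable_fun setT (fun z : R * R => c z.1 z.2) ->
    (forall x xi, `|c x xi| <= 1) ->
    2^-1 * (K * \int[mu]_x (h x * k x)) =
    \int[mu]_xi (a xi * \int[mu]_x (h x * c x xi)).
  move=> Ek ih ia mc c1; rewrite -(Fubini_kernel ih ia mc c1).
  have I := integrable_kernel_inner ih ia mc c1.
  have [K0|K0] := eqVneq K 0.
    rewrite K0 mul0r mulr0 (_ : (fun _ => _) = cst 0); last first.
      by apply/funext => x; rewrite Ek K0 !mul0r mulr0.
    by rewrite Rintegral_cst// mul0r.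
  rewrite mulrA -RintegralZl//; last first.
    have := integrable_mulR measurableT (2 / K) I; congr (_.-integrable _ (_ \o _)).
    by apply/funext => x; rewrite Ek; field.
  by apply: eq_Rintegral => x _; rewrite Ek; field.
have mcos : measurable_fun setT (fun z : R * R => cos (z.2 * (z.1 - x0))).
  exact: (measurableT_comp (continuous_measurable_fun (@continuous_cos R))).
have msin : measurable_fun setT (fun z : R * R => sin (z.2 * (z.1 - x0))).
  exact: (measurableT_comp (continuous_measurable_fun (@continuous_sin R))).
refine (etrans (L _ g _ _ a1 E1 gi ia1 mcos (fun x xi => cos_max _))
  (etrans _ (esym (L _ f _ _ a2 E2 fi ia2 msin (fun x xi => sin_max _))))).
apply: eq_Rintegral => xi _.
rewrite cos_integral_shift// sin_integral_shift//.
have [-> ->] := fractional_derivative_transform xi fi fg.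
have -> : a2 xi = a1 xi * signed_powR nu xi.
  rewrite /a1 /a2 [RHS]mulrAC; congr (_ * _).
  have [->|xi0] := eqVneq xi 0; first by rewrite !signed_powR0 mulr0.
  rewrite /signed_powR mulrCA -powRD ?normr_eq0 ?xi0 ?implybT//.
  by congr (_ * _ `^ _); ring.
by ring.
Qed.

End fourier_parts.

(** * Second differences of a signed power *)

Section second_difference.
Context {R : realType} (al : R) (al01 : 0 < al < 1).
Implicit Types (u v e c : R).

Let al0 : 0 < al. Proof. by case/andP: al01. Qed.
Let al1 : al < 1. Proof. by case/andP: al01. Qed.

Let is_derive_powR (p : R) (x : R) : 0 < x ->
  is_derive x 1 (fun y => y `^ p) (p * x `^ (p - 1)).
Proof. exact: is_derive1_powR. Qed.

Lemma powR_second_difference v e : 0 < e -> e < v ->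
  exists2 c, v - e < c < v + e &
    2 * v `^ al - (v - e) `^ al - (v + e) `^ al =
    e ^+ 2 * (al * (1 - al) * c `^ (al - 2)).
Proof.
move=> e0 ev.
pose D (x : R) := x `^ al - (x - e) `^ al.
have dD (x : R) : e < x -> is_derive x 1 D (al * x `^ (al - 1) - al * (x - e) `^ (al - 1)).
  move=> ex.
  have d1 := is_derive_powR al (lt_trans e0 ex).
  have xe : 0 < x - e by rewrite subr_gt0.
  have d2 : is_derive x 1 (fun y => (y - e) `^ al) (al * (x - e) `^ (al - 1)).
    have d3 : is_derive (x - e) 1 (fun y => y `^ al) (al * (x - e) `^ (al - 1)).
      exact: is_derive_powR.
    have d4 : is_derive x 1 (fun y : R => y - e) 1.
      by apply: is_derive_eq; rewrite subr0.
    have := @is_derive1_comp R (fun y => y `^ al) (fun y => y - e) x _ _ d3 d4.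
    by rewrite mulr1.
  exact: is_deriveB.
have ve : v < v + e by rewrite ltrDl.
have [c1 c1itv E1] : exists2 c1, c1 \in `]v, (v + e)[ &
    D (v + e) - D v = (al * c1 `^ (al - 1) - al * (c1 - e) `^ (al - 1)) * (v + e - v).
  apply: MVT => // [x|].
    by rewrite in_itv/= => /andP[vx _]; apply: dD; exact: lt_trans vx.
  apply: derivable_within_continuous => x; rewrite in_itv/= => /andP[vx _].
  by have [] := dD x (lt_le_trans ev vx).
move: c1itv; rewrite in_itv/= => /andP[vc1 c1v].
have ec1 : e < c1 := lt_trans ev vc1.
have dP (x : R) : c1 - e <= x -> is_derive x 1 (fun y => y `^ (al - 1))
    ((al - 1) * x `^ (al - 1 - 1)).
  by move=> cx; apply: is_derive_powR; apply: lt_le_trans cx; rewrite subr_gt0.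
have [c2 c2itv E2] : exists2 c2, c2 \in `](c1 - e), c1[ &
    c1 `^ (al - 1) - (c1 - e) `^ (al - 1) = (al - 1) * c2 `^ (al - 1 - 1) * (c1 - (c1 - e)).
  apply: (@MVT _ (fun y => y `^ (al - 1)) (fun x => (al - 1) * x `^ (al - 1 - 1))).
  - by rewrite ltrBlDr ltrDl.
  - by move=> x; rewrite in_itv/= => /andP[cx _]; apply: dP; exact: ltW.
  - apply: derivable_within_continuous => x; rewrite in_itv/= => /andP[cx _].
    by have [] := dP x cx.
move: c2itv; rewrite in_itv/= => /andP[h1 h2].
exists c2; first by apply/andP; split; lra.
have E3 : al - 1 - 1 = al - 2 by ring.
rewrite E3 in E2.
have : D (v + e) - D v = (v + e) `^ al - v `^ al - (v `^ al - (v - e) `^ al).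
  by rewrite /D addrK.
rewrite E1 -mulrBr E2 => H; move: H.
set A := v `^ al; set B := (v - e) `^ al; set C := (v + e) `^ al; set P := c2 `^ _.
move=> H; have -> : 2 * A - B - C = - (C - A - (A - B)) by ring.
by rewrite -H; ring.
Qed.

(** Centred at [u - e]: below, [u] is the distance to a zero of the density, and the tents
    have this zero as an end point. *)
Definition second_difference e u : R :=
  2 * signed_powR al (u - e) - signed_powR al u - signed_powR al (u - 2 * e).

Lemma second_differenceN e u : second_difference e (- u) = - second_difference (- e) u.
Proof.
rewrite /second_difference -(signed_powRN al u).
rewrite (_ : - u - e = - (u - - e)); last by ring.
rewrite (_ : - u - 2 * e = - (u - 2 * - e)); last by ring.
by rewrite !signed_powRN; ring.
Qed.

Let second_difference_pos e u : e != 0 -> 0 < u -> 4 * `|e| <= u ->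
  exists2 c, `|c - u| <= 2 * `|e| &
    second_difference e u = e ^+ 2 * (al * (1 - al) * c `^ (al - 2)).
Proof.
move=> e0 u0 eu.
have [en|ep|/eqP] := ltgtP e 0; last by rewrite (negbTE e0).
  rewrite ltr0_norm// in eu *.
  have [||c /andP[c1 c2] H] := @powR_second_difference (u - e) (- e); [lra|lra|].
  exists c; first by rewrite ler_norml; apply/andP; split; lra.
  rewrite /second_difference !signed_powR_gt0E ?subr_gt0; [|lra|lra|lra].
  move: H; rewrite (_ : u - e - - e = u); last by ring.
  rewrite (_ : u - e + - e = u - 2 * e); last by ring.
  by rewrite sqrrN => <-.
rewrite gtr0_norm// in eu *.
have [||c /andP[c1 c2] H] := @powR_second_difference (u - e) e; [lra|lra|].
exists c; first by rewrite ler_norml; apply/andP; split; lra.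
rewrite /second_difference !signed_powR_gt0E ?subr_gt0; [|lra|lra|lra].
move: H; rewrite subrK (_ : u - e - e = u - 2 * e); last by ring.
by move=> <-; ring.
Qed.

Lemma second_difference_far e u : e != 0 -> u != 0 -> 4 * `|e| <= `|u| ->
  exists2 c, `|c - `|u| | <= 2 * `|e| &
    second_difference e u = e ^+ 2 * (al * (1 - al) * (u / `|u| * c `^ (al - 2))).
Proof.
move=> e0 u0 eu.
have [un|up|/eqP] := ltgtP u 0; last by rewrite (negbTE u0).
  have e0' : - e != 0 by rewrite oppr_eq0.
  rewrite (ltr0_norm un) in eu *.
  have un' : 0 < - u by rewrite oppr_gt0.
  have eu' : 4 * `|- e| <= - u by rewrite normrN.
  have [c cu H] := second_difference_pos e0' un' eu'.
  exists c; first by rewrite normrN in cu.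
  rewrite invrN mulrN divff// -[u in LHS]opprK second_differenceN H sqrrN.
  by ring.
rewrite (gtr0_norm up) in eu *.
have [c cu H] := second_difference_pos e0 up eu.
by exists c => //; rewrite H divff// mul1r.
Qed.

(** The bound is uniform in [e], so that it can dominate a limit [e --> 0]: for small [e]
    it comes from the mean value theorem, and for [e] comparable with [u] from the size
    of the three terms.  The latter case gives the constant, [24 * 4 ^ 2]. *)
Lemma second_difference_le e u : u != 0 ->
  `|second_difference e u| <= 384 * e ^+ 2 * `|u| `^ (al - 2).
Proof.
move=> u0; have [->|e0] := eqVneq e 0.
  by rewrite /second_difference mulr0 !subr0 expr0n/= mulr0 mul0r [2 * _]mulr_natl mulr2n
    addrK subrr normr0.
have au0 : 0 < `|u| by rewrite normr_gt0.
have ae0 : 0 < `|e| by rewrite normr_gt0.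
have [eu|ue] := leP (4 * `|e|) `|u|.
  have [c cu ->] := second_difference_far e0 u0 eu.
  have sg : `|u / `|u| | = 1 by rewrite normrM normfV normr_id divff// gt_eqF.
  have h0 := al0; have h1 := al1.
  have a2 : 0 <= al * (1 - al) <= 1 by apply/andP; split; nra.
  have [a3 a4] := andP a2.
  move: sg; set sg := u / _ => sg1.
  rewrite normrM (ger0_norm (sqr_ge0 e)) normrM (ger0_norm a3) normrM sg1 mul1r.
  rewrite (ger0_norm (powR_ge0 _ _)) (mulrC 384) -(mulrA (_ ^+ 2)) ler_wpM2l ?sqr_ge0//.
  have cu2 : `|u| / 2 <= c by move: cu; rewrite ler_norml => /andP[? ?]; lra.
  have c0 : 0 < c by lra.
  apply: (@le_trans _ _ (c `^ (al - 2))).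
    by rewrite ler_piMl// powR_ge0.
  have -> : al - 2 = - (2 - al) by ring.
  rewrite !powRN.
  apply: (@le_trans _ _ ((`|u| / 2) `^ (2 - al))^-1).
    rewrite lef_pV2 ?posrE ?powR_gt0//; last by rewrite divr_gt0.
    by rewrite ge0_ler_powR ?nnegrE//; lra.
  rewrite powRM// invfM mulrC ler_wpM2r ?invr_ge0 ?powR_ge0//.
  have h : (2^-1 : R) `^ (2 - al) = (2 `^ (2 - al))^-1.
    by rewrite -powR_inv1// -powRrM mulN1r powRN.
  rewrite h invrK; apply: (@le_trans _ _ (2 `^ 2)).
    by apply: ler_powR; lra.
  by rewrite powR_mulrn//; lra.
have P6 : (6 * `|e|) `^ al <= 6 * `|e| `^ al.
  rewrite powRM// ler_wpM2r ?powR_ge0//.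
  by apply: ler1_powR; [lra|exact: ltW].
have B t : `|t| <= 6 * `|e| -> `|signed_powR al t| <= 6 * `|e| `^ al.
  move=> t6; apply: le_trans (norm_signed_powR_le _ _) _; apply: le_trans P6.
  by rewrite ge0_ler_powR ?nnegrE// ?mulr_ge0// ltW.
have h0 := al0; have h1 := al1.
have b1 : `|u - e| <= 6 * `|e| by apply: (le_trans (ler_normB _ _)); lra.
have b2 : `|u| <= 6 * `|e| by lra.
have b3 : `|u - 2 * e| <= 6 * `|e|.
  by apply: (le_trans (ler_normB _ _)); rewrite normrM (ger0_norm (ler0n _ 2)); lra.
apply: (@le_trans _ _ (24 * `|e| `^ al)).
  rewrite /second_difference; apply: le_trans (ler_normB _ _) _.
  apply: le_trans (lerD (ler_normB _ _) (lexx _)) _.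
  rewrite normrM (ger0_norm (ler0n _ 2)).
  by have := B _ b1; have := B _ b2; have := B _ b3; lra.
have -> : `|e| `^ al = e ^+ 2 * `|e| `^ (al - 2).
  have -> : e ^+ 2 = `|e| `^ 2 by rewrite powR_mulrn// real_normK ?num_real.
  rewrite -powRD; last by rewrite (gt_eqF ae0) implybT.
  by congr (_ `^ _); ring.
rewrite mulrA (_ : 384 * e ^+ 2 * _ = 24 * e ^+ 2 * (16 * `|u| `^ (al - 2))); last by ring.
apply: ler_wpM2l; first by apply: mulr_ge0 => //; exact: sqr_ge0.
have -> : al - 2 = - (2 - al) by ring.
rewrite !powRN.
apply: (@le_trans _ _ ((`|u| / 4) `^ (2 - al))^-1).
  rewrite lef_pV2 ?posrE ?powR_gt0// ?divr_gt0//.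
  by rewrite ge0_ler_powR ?nnegrE//; lra.
rewrite powRM// invfM mulrC ler_wpM2r ?invr_ge0 ?powR_ge0//.
have h : (4^-1 : R) `^ (2 - al) = (4 `^ (2 - al))^-1.
  by rewrite -powR_inv1// -powRrM mulN1r powRN.
rewrite h invrK; apply: (@le_trans _ _ (4 `^ 2)).
  by apply: ler_powR; lra.
by rewrite powR_mulrn//; lra.
Qed.

End second_difference.

(** * The singular potential at the zeros of a density *)

Section dominated_convergence_real.
Context {d : measure_display} {T : measurableType d} {R : realType}.
Variables (m : measure T R).

Lemma Rintegral_dominated_cvg (F : nat -> T -> R) (h G : T -> R) :
  (forall n, measurable_fun setT (F n)) -> measurable_fun setT h ->
  (forall x, F n x @[n --> \oo] --> h x) ->
  m.-integrable setT (EFin \o G) -> (forall n x, `|F n x| <= G x) ->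
  \int[m]_x F n x @[n --> \oo] --> \int[m]_x h x.
Proof.
move=> mF mh Fh iG FG.
have iF n : m.-integrable setT (EFin \o F n).
  by apply: (integrable_dom measurableT (mF n) _ iG) => x _; exact: FG.
have ih : m.-integrable setT (EFin \o h).
  apply: (integrable_dom measurableT mh _ iG) => x _.
  have h1 : `|F n x| @[n --> \oo] --> `|h x| by apply: cvg_norm; exact: Fh.
  by apply: (cvgr_to_le h1); apply: nearW => n; exact: FG.
apply: fine_cvg; rewrite fineK; last exact: integrable_fin_num.
apply: (@dominated_cvg _ _ _ m setT measurableT (fun n => EFin \o F n) (EFin \o h) (EFin \o G)) => //.
- by move=> n; apply/measurable_EFinP.
- by move=> x _; apply: cvg_EFin; [exact: nearW|exact: Fh].
- by move=> n x _ /=; rewrite lee_fin.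
Qed.

End dominated_convergence_real.

Lemma powR_antitone {R : realType} (q a b : R) :
  q <= 0 -> 0 < a -> a <= b -> b `^ q <= a `^ q.
Proof.
move=> q0 a0 ab; rewrite -(opprK q) !(powRN _ (- q)).
have b0 := lt_le_trans a0 ab.
rewrite lef_pV2 ?posrE ?powR_gt0//.
by apply: ge0_ler_powR; rewrite ?oppr_ge0 ?nnegrE//; exact: ltW.
Qed.

Section potential.
Context {R : realType} (al : R) (al01 : 0 < al < 1).
Notation mu := (@lebesgue_measure R).

Let al0 : 0 < al. Proof. by case/andP: al01. Qed.
Let al1 : al < 1. Proof. by case/andP: al01. Qed.

(** Up to a constant, the second derivative of the convolution of [f] with the signed
    power [al].  The kernel is not locally integrable: the integral converges only at
    points where [f] is small. *)
Definition potential (f : R -> R) (x : R) : R :=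
  \int[mu]_y (f y * signed_powR (al - 2) (y - x)).

Variables (f : R -> R) (K : R).
Hypothesis f_ge0 : forall x, 0 <= f x.
Hypothesis f_int : mu.-integrable setT (EFin \o f).
Hypothesis f_lin : forall x y, f x = 0 -> f y <= K * `|y - x|.

Let mf : measurable_fun setT f. Proof. exact: integrable_measR f_int. Qed.

Let cut (t : R) : R := if `|t| <= 1 then `|t| `^ (al - 1) else `|t| `^ (- 2).

Let cut_int : mu.-integrable setT (EFin \o cut).
Proof. by apply: integrable_powR_split; [have := al0; lra|lra]. Qed.

Let cut_ge0 t : 0 <= cut t. Proof. by rewrite /cut; case: ifP => _; exact: powR_ge0. Qed.

Let K_ge0 x : f x = 0 -> 0 <= K.
Proof.
move=> fx; have := f_lin (x + 1) fx; rewrite addrAC subrr add0r normr1 mulr1.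
exact: le_trans.
Qed.

Let linear_kernel_le x y : f x = 0 ->
  f y * `|signed_powR (al - 2) (y - x)| <= K * `|y - x| `^ (al - 1).
Proof.
move=> fx; have [->|yx] := eqVneq y x.
  by rewrite fx mul0r mulr_ge0 ?powR_ge0 ?(K_ge0 fx).
have t0 : 0 < `|y - x| by rewrite normr_gt0 subr_eq0.
have -> : `|y - x| `^ (al - 1) = `|y - x| * `|y - x| `^ (al - 2).
  rewrite -[X in X * _]powRr1// -powRD; last by rewrite (gt_eqF t0) implybT.
  by congr (_ `^ _); ring.
by rewrite mulrA ler_pM// ?f_lin// norm_signed_powR_le.
Qed.

Lemma measurable_shift_kernel (h : R -> R) x :
  measurable_fun setT h -> measurable_fun setT (fun y : R => h (y - x)).
Proof. by move=> mh; apply: measurableT_comp => //; exact: measurable_funB. Qed.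

Lemma potential_integrable x : f x = 0 ->
  mu.-integrable setT (EFin \o (fun y => f y * signed_powR (al - 2) (y - x))).
Proof.
move=> fx.
apply: (@integrable_dom _ _ _ mu setT _ (fun y => K * cut (y - x) + f y) measurableT).
- apply: measurable_funM => //; apply: (@measurable_shift_kernel (signed_powR (al - 2))).
  exact: measurable_signed_powR.
- move=> y _; rewrite normrM (ger0_norm (f_ge0 y)) /cut; case: ifPn => [yx|].
    by apply: le_trans (linear_kernel_le y fx) _; rewrite lerDl.
  rewrite -ltNge => yx; apply: (@le_trans _ _ (f y)); last first.
    by rewrite lerDr mulr_ge0 ?powR_ge0// (K_ge0 fx).
  rewrite ler_piMr//; apply: le_trans (norm_signed_powR_le _ _) _.
  have h0 := al0; have h1 := al1.
  apply: (@le_trans _ _ (1 `^ (al - 2))); last by rewrite powR1.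
  by apply: powR_antitone => //; [lra|exact: ltW].
- apply: integrable_addR => //; apply: integrable_mulR => //.
  exact: (integrable_shift x cut_int).
Qed.

Let potential_integrand_le p q y : p < q -> f p = 0 -> f q = 0 ->
  (p < y < q -> f y = 0) ->
  f y * signed_powR (al - 2) (y - p) <= f y * signed_powR (al - 2) (y - q).
Proof.
move=> pq fp fq H; have [fy|fy] := eqVneq (f y) 0; first by rewrite fy !mul0r.
apply: ler_wpM2l => //.
have h1 := al1; have al2 : al - 2 <= 0 by lra.
have [yp|py|E] := ltgtP y p; last by rewrite E fp eqxx in fy.
  rewrite -(opprB p) -(opprB q) !signed_powRN lerN2 !signed_powR_gt0E; [|lra|lra].
  by apply: powR_antitone => //; lra.
have [yq|qy|E] := ltgtP y q; last by rewrite E fq eqxx in fy.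
  by rewrite H ?py ?yq// eqxx in fy.
rewrite !signed_powR_gt0E; [|lra|lra].
by apply: powR_antitone => //; lra.
Qed.

(** The kernel decreases on each half-line, so only the mass between the two
    points can push the potential down, and that mass is small because the
    density vanishes linearly at both. *)
Lemma potential_gap p q : p < q -> f p = 0 -> f q = 0 ->
  (forall t, p < t < q -> f t = 0) -> potential f p <= potential f q.
Proof.
move=> pq fp fq H; apply: le_Rintegral => //; [exact: potential_integrable..|].
by move=> y _; exact: potential_integrand_le (H y).
Qed.

Let double_le (k k1 e I : R) : I * (2 * k1) < e -> k * I <= k1 * I -> k * I + k * I <= e.
Proof. lra. Qed.

Lemma potential_le_near eta : 0 < eta -> exists2 l, 0 < l &
  forall p q, p < q -> q - p < l -> f p = 0 -> f q = 0 ->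
    potential f p <= potential f q + eta.
Proof.
move=> eta0; pose K1 := `|K| + 1.
have K10 : 0 < K1 by rewrite ltr_wpDl.
have e0 : 0 < eta / (2 * K1) by rewrite divr_gt0// mulr_gt0.
have [d0 [d00 dP]] := integral_normr_continuous cut_int e0.
pose l := Num.min 1 (d0 / 4).
have l0 : 0 < l by rewrite lt_min ltr01 divr_gt0.
have l1 : l <= 1 by rewrite ge_min lexx.
have ld : l <= d0 / 4 by rewrite ge_min lexx orbT.
pose A : set R := `]- l, l[%classic.
have mA : measurable A by exact: measurable_itv.
have muA : (mu A < d0%:E)%E.
  rewrite lebesgue_measure_itv/= lte_fin ifT; last by lra.
  by rewrite -EFinB lte_fin; lra.
have {dP} cutA := dP A mA muA.
pose c := cut \_ A.
have c_int : mu.-integrable setT (EFin \o c).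
  have : mu.-integrable setT ((EFin \o cut) \_ A).
    have H := (@integrable_mkcond _ _ R mu A (EFin \o cut) mA).1.
    by apply: H; apply: (integrableS measurableT).
  by rewrite restrict_EFin.
have c_ge0 t : 0 <= c t by rewrite /c patchE; case: ifP.
have c_val : \int[mu]_t c t < eta / (2 * K1).
  rewrite -Rintegral_mkcond; apply: le_lt_trans cutA.
  have cutAi : mu.-integrable A (EFin \o cut) by exact: (integrableS measurableT).
  apply: le_Rintegral => //; last by move=> x _; exact: ler_norm.
  exact: (integrable_normR cutAi).
exists l => // p q pq qpl fp fq.
have K0 := K_ge0 fp.
have ip := integrable_shift p c_int; have iq := integrable_shift q c_int.
pose h y := f y * signed_powR (al - 2) (y - q) + K * (c (y - p) + c (y - q)).
have ih : mu.-integrable setT (EFin \o h).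
  apply: integrable_addR => //; first exact: potential_integrable.
  by apply: integrable_mulR => //; exact: integrable_addR.
have key : potential f p <= \int[mu]_y h y.
  apply: le_Rintegral => //; first exact: potential_integrable.
  move=> y _; rewrite /h.
  have [/andP[py yq]|ny] := boolP (p < y < q); last first.
    apply: (@le_trans _ _ (f y * signed_powR (al - 2) (y - q))).
      by apply: potential_integrand_le => // H; rewrite H in ny.
    by rewrite lerDl mulr_ge0// addr_ge0.
  have E u : `|u| < l -> c u = `|u| `^ (al - 1).
    move=> ul; rewrite /c patchE ifT; last first.
      by rewrite inE /A/= in_itv/= -ltr_norml.
    by rewrite /cut ifT//; apply/ltW/(lt_le_trans ul).
  rewrite !E; last 2 first.
  - by rewrite ltr_norml; apply/andP; split; lra.
  - by rewrite ltr_norml; apply/andP; split; lra.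
  have b1 := linear_kernel_le y fp; have b2 := linear_kernel_le y fq.
  have b3 := ler_norm (signed_powR (al - 2) (y - p)).
  have b4 := ler_norm (- signed_powR (al - 2) (y - q)); rewrite normrN in b4.
  have := ler_wpM2l (f_ge0 y) b3; have := ler_wpM2l (f_ge0 y) b4.
  by rewrite mulrN mulrDr; lra.
apply: le_trans key _; rewrite RintegralD//; last 2 first.
- exact: potential_integrable.
- by apply: integrable_mulR => //; exact: integrable_addR.
rewrite lerD2l RintegralZl//; last exact: integrable_addR.
rewrite RintegralD// !Rintegral_shift//.
have K_le : K <= K1 by rewrite /K1 (le_trans (ler_norm K))// lerDl.
move: c_val; rewrite ltr_pdivlMr ?mulr_gt0// => c_val.
have c0 : 0 <= \int[mu]_x c x by apply: Rintegral_ge0.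
have := ler_wpM2r c0 K_le; rewrite mulrDr.
exact: double_le c_val.
Qed.

Hypothesis f_cont : continuous f.

Let pos_near x : 0 < f x -> exists2 e, 0 < e & forall t, `|t - x| < e -> 0 < f t.
Proof.
move=> fx; have cx : f y @[y --> x] --> f x by exact: f_cont.
have [e /= e0 H] : \forall y \near x, 0 < f y := cvgr_gt _ cx _ fx.
by exists e => // t tx; apply: H; rewrite /ball/= distrC.
Qed.

(** [edge] is the only place where information on the density beyond its
    linear vanishing enters: the potential is zero at the left end of every
    interval on which the density is positive. *)
Hypothesis edge : forall a b, a < b -> f a = 0 ->
  (forall t, a < t < b -> 0 < f t) -> potential f a = 0.

(** A zero approached from the right by points of positivity is a limit of left ends of
    intervals of positivity, where the potential vanishes. *)
Let potential_limit_le0 q : f q = 0 ->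
  (forall l, 0 < l -> exists2 u, q < u < q + l & 0 < f u) -> potential f q <= 0.
Proof.
move=> fq acc; apply/ler_addgt0Pr => eta eta0; rewrite add0r.
have [l l0 near] := potential_le_near eta0.
have [u /andP[qu ul] fu] := acc l l0.
pose Z : set R := [set t | q <= t <= u /\ f t = 0].
have Zq : Z q by split => //; rewrite lexx ltW.
have ubZ : ubound Z u by move=> t [/andP[]].
have supZ : has_sup Z by split; [exists q|exists u].
pose a := sup Z.
have aq : q <= a by apply: ub_le_sup => //; exists u.
have au : a <= u by apply: ge_sup => //; exists q.
have fa : f a = 0.
  apply: contrapT => /eqP fa; have fa0 : 0 < f a by rewrite lt_def fa f_ge0.
  have [e e0 H] := pos_near fa0.
  have [z [zqu fz] az] := sup_adherent e0 supZ.
  have za : z <= a by apply: ub_le_sup => //; exists u.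
  by have := H z; rewrite fz ltxx ler0_norm ?subr_le0// => H'; apply/notF/H'; rewrite /a; lra.
have {}au : a < u by rewrite lt_neqAle au andbT; apply/eqP => E; move: fu; rewrite -E fa ltxx.
have ga : potential f a = 0.
  apply: edge au fa _ => t /andP[at_ tu]; rewrite lt_def f_ge0 andbT; apply/eqP => ft.
  have : t <= a by apply: ub_le_sup; [exists u|split => //; lra].
  by rewrite leNgt at_.
have [E|qa] := eqVneq q a; first by rewrite E ga ltW.
have {}qa : q < a by rewrite lt_neqAle qa aq.
by have := near q a qa _ fq fa; rewrite ga add0r; apply; lra.
Qed.

(** To the right of a zero, either [f] vanishes identically, and the kernel is negative on
    the rest of its mass; or the zeros extend without interruption up to a point [q]
    approached by points of positivity, and the potential is larger at [q]. *)
Lemma potential_le0 x : f x = 0 -> potential f x <= 0.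
Proof.
move=> fx; pose P : set R := [set t | x < t /\ 0 < f t].
have [[t0 Pt0]|nP] := pselect (exists t, P t); last first.
  have -> : 0 = \int[mu]_(y in [set: measurableTypeR R]) (0 : R).
    by rewrite Rintegral_cst// mul0r.
  apply: le_Rintegral => //; first exact: potential_integrable.
    by apply: integrable0.
  move=> y _; have [yx|xy|->] := ltgtP y x; last by rewrite fx mul0r.
    rewrite -(opprB x) signed_powRN mulrN oppr_le0 mulr_ge0// signed_powR_gt0E ?subr_gt0//.
    exact: powR_ge0.
  have -> : f y = 0; last by rewrite mul0r.
  apply/eqP; rewrite eq_le f_ge0 andbT leNgt; apply/negP => fy; apply: nP; by exists y.
have lbP : lbound P x by move=> t [/ltW].
have infP : has_inf P by split; [exists t0|exists x].
pose q := inf P.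
have xq : x <= q by apply: lb_le_inf => //; exists t0.
have gap t : x < t < q -> f t = 0.
  move=> /andP[xt tq]; apply/eqP; rewrite eq_le f_ge0 andbT leNgt; apply/negP => ft.
  by have : q <= t by [apply: ge_inf; [exists x|split]]; rewrite leNgt tq.
have fq : f q = 0.
  apply: contrapT => /eqP fq; have fq0 : 0 < f q by rewrite lt_def fq f_ge0.
  have [E|xq'] := eqVneq x q; first by rewrite -E fx eqxx in fq.
  have {}xq' : x < q by rewrite lt_neqAle xq' xq.
  have [e e0 H] := pos_near fq0.
  pose t := Num.max ((x + q) / 2) (q - e / 2).
  have t1 : (x + q) / 2 <= t by rewrite le_max lexx.
  have t2 : q - e / 2 <= t by rewrite le_max lexx orbT.
  have t3 : t < q by rewrite gt_max; apply/andP; split; lra.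
  have := H t; rewrite gap; last by apply/andP; split; lra.
  by rewrite ltxx ltr0_norm ?subr_lt0// => H'; apply/notF/H'; lra.
have gq : potential f q <= 0.
  apply: potential_limit_le0 => // l l0.
  have [u [xu fu] uq] := inf_adherent l0 infP.
  exists u => //; rewrite uq andbT lt_neqAle; apply/andP; split.
    by apply/eqP => E; rewrite -E fq ltxx in fu.
  by apply: ge_inf; [exists x|split].
have [->//|xq'] := eqVneq x q.
by apply: le_trans gq; apply: potential_gap => //; rewrite lt_neqAle xq' xq.
Qed.

End potential.

(** * The fractional derivative off the support *)

Section tent_averages.
Context {R : realType} (nu : R) (nu01 : 0 < nu < 1).
Notation mu := (@lebesgue_measure R).
Implicit Types (f g : R -> R) (x y e t : R).

Let nu0 : 0 < nu. Proof. by case/andP: nu01. Qed.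
Let nu1 : nu < 1. Proof. by case/andP: nu01. Qed.
Let al : R := 1 - nu.
Let al01 : 0 < al < 1. Proof. by have := nu0; have := nu1; rewrite /al => *; apply/andP; split; lra. Qed.

(** The triangle of height [2 * `|e|] over the interval of half-width [`|e|]. *)
Definition tent e t : R := `|t + e| + `|t - e| - 2 * `|t|.

Lemma tent_ge0 e t : 0 <= tent e t.
Proof.
rewrite /tent subr_ge0; have := ler_normD (t + e) (t - e).
by rewrite (_ : t + e + (t - e) = 2 * t); [rewrite normrM ger0_norm|ring].
Qed.

Lemma tent_le e t : tent e t <= 2 * `|e|.
Proof. by rewrite /tent; have := ler_normD t e; have := ler_normB t e; lra. Qed.

Lemma tent_eq0 e t : `|e| <= `|t| -> tent e t = 0.
Proof.
rewrite /tent => et; have [t0|t0|t0] := ltgtP t 0; last first.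
- by move: et; rewrite t0 normr0 normr_le0 => /eqP ->; rewrite addr0 subr0 normr0 mulr0 !addr0 subr0.
- move: et; rewrite (gtr0_norm t0) ler_norml => /andP[h1 h2].
  by rewrite !ger0_norm; lra.
move: et; rewrite (ltr0_norm t0) ler_norml => /andP[h1 h2].
by rewrite !ler0_norm; lra.
Qed.

Lemma tent_ge e t : `|t| <= `|e| / 2 -> `|e| <= tent e t.
Proof.
rewrite /tent => et.
have : `|2 * e| <= `|t + e| + `|t - e|.
  by rewrite (_ : 2 * e = t + e - (t - e)); [exact: ler_normB|ring].
by rewrite normrM ger0_norm//; lra.
Qed.

Lemma measurable_tent e x : measurable_fun setT (fun y => tent e (y - x)).
Proof.
rewrite /tent; apply: measurable_funB; last first.
  apply: measurable_funM => //; apply: measurableT_comp => //; exact: measurable_funB.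
by apply: measurable_funD; apply: measurableT_comp => //; [apply: measurable_funD|apply: measurable_funB] => //;
  exact: measurable_funB.
Qed.

Lemma measurable_second_difference e : measurable_fun setT (second_difference al e).
Proof.
have ms b : measurable_fun setT (fun u : R => signed_powR al (u - b)).
  apply: (@measurable_shift_kernel _ (signed_powR al)); exact: measurable_signed_powR.
apply: measurable_funB; last exact: ms.
apply: measurable_funB; last exact: measurable_signed_powR.
by apply: measurable_funM.
Qed.

Lemma second_difference_cvg (e : nat -> R) (u : R) : u != 0 ->
  (forall n, e n != 0) -> e n @[n --> \oo] --> 0 ->
  second_difference al (e n) u / e n ^+ 2 @[n --> \oo] -->
    al * (1 - al) * signed_powR (al - 2) u.
Proof.
move=> u0 en0 ecvg.
have au0 : 0 < `|u| by rewrite normr_gt0.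
set k := al * (1 - al) * (u / `|u|).
have k1 : `|k| <= 1.
  rewrite /k normrM [X in _ * X]normrM normfV normr_id divff ?gt_eqF// mulr1.
  by have [h0 h1] := andP al01; rewrite ger0_norm; nra.
have pc : {for `|u|, continuous (fun t : R => t `^ (al - 2))}.
  apply: differentiable_continuous; apply/derivable1_diffP.
  by have [] := is_derive1_powR (al - 2) au0.
apply/cvgrPdist_lt => eps eps0.
have [dl /= dl0 H] : \forall t \near `|u|, `| `|u| `^ (al - 2) - t `^ (al - 2)| < eps.
  by move/cvgrPdist_lt: pc => /(_ _ eps0).
near=> n.
have e1 : `|e n| < `|u| / 4.
  near: n; move/cvgrPdist_lt: ecvg => /(_ (`|u| / 4)) [|N _ HN]; first by rewrite divr_gt0.
  by exists N => // n /HN; rewrite sub0r normrN.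
have e2 : `|e n| < dl / 2.
  near: n; move/cvgrPdist_lt: ecvg => /(_ (dl / 2)) [|N _ HN]; first by rewrite divr_gt0.
  by exists N => // n /HN; rewrite sub0r normrN.
have [|c cu ->] := second_difference_far al (en0 n) u0; first by lra.
have en20 : e n ^+ 2 != 0 by rewrite expf_neq0.
rewrite [X in _ - X](_ : _ = k * c `^ (al - 2)); last first.
  by rewrite mulrAC divff// mul1r /k mulrA.
rewrite [X in X - _](_ : _ = k * `|u| `^ (al - 2)); last by rewrite /k /signed_powR; ring.
rewrite -mulrBr normrM; apply: (@le_lt_trans _ _ (1 * `| `|u| `^ (al - 2) - c `^ (al - 2)|)).
  by rewrite ler_wpM2r.
by rewrite mul1r; apply: H; rewrite /= distrC; apply: (le_lt_trans cu); lra.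
Unshelve. all: by end_near. Qed.

Section limits.
Variables (f g : R -> R) (K : R).
Hypothesis f_ge0 : forall x, 0 <= f x.
Hypothesis f_int : mu.-integrable setT (EFin \o f).
Hypothesis f_lin : forall x y, f x = 0 -> f y <= K * `|y - x|.
Hypothesis fg : is_fractional_derivative nu f g.

(** Averages of the fractional derivative against shrinking tents recover, at a
    zero of the density, the singular potential: the second difference of the
    signed power is dominated by a multiple of its second derivative. *)
Lemma tent_average_cvg x (e : nat -> R) : f x = 0 ->
  (forall n, e n != 0) -> e n @[n --> \oo] --> 0 ->
  even_cst * (\int[mu]_y (g y * tent (e n) (y - (x + e n))) / e n ^+ 2) @[n --> \oo] -->
    odd_cst nu * (al * (1 - al) * potential al f x).
Proof.
move=> fx en0 ecvg.
have pi := potential_integrable al01 f_ge0 f_int f_lin fx.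
pose F n y := f y * (second_difference al (e n) (y - x) / e n ^+ 2).
have F_le n y : `|F n y| <= 384 * `|f y * signed_powR (al - 2) (y - x)|.
  have [->|yx] := eqVneq y x; first by rewrite /F fx !mul0r normr0 mulr0.
  have u0 : y - x != 0 by rewrite subr_eq0.
  rewrite /F normrM (normrM _ (signed_powR _ _)) mulrCA; apply: ler_wpM2l => //.
  rewrite (_ : `|signed_powR _ _| = `|y - x| `^ (al - 2)); last first.
    rewrite /signed_powR normrM normrM normfV normr_id divff ?normr_eq0// mul1r.
    by rewrite ger0_norm ?powR_ge0.
  rewrite normrM normfV (ger0_norm (sqr_ge0 (e n))) ler_pdivrMr; last first.
    by rewrite lt_def sqrf_eq0 en0 sqr_ge0.
  by rewrite mulrAC; exact: second_difference_le.
have mF n : measurable_fun setT (F n).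
  apply: measurable_funM; first exact: integrable_measR f_int.
  apply: measurable_funM => //; apply: (@measurable_shift_kernel _ (second_difference al (e n))).
  exact: measurable_second_difference.
have iF n : mu.-integrable setT (EFin \o F n).
  apply: (@integrable_dom _ _ _ mu setT _
    (fun y => 384 * `|f y * signed_powR (al - 2) (y - x)|) measurableT (mF n)).
    by move=> y _; exact: F_le.
  by apply: integrable_mulR => //; exact: integrable_normR.
have E n : even_cst * (\int[mu]_y (g y * tent (e n) (y - (x + e n))) / e n ^+ 2) =
    odd_cst nu * \int[mu]_y F n y.
  rewrite mulrA (fractional_derivative_tent (x + e n) (e n) nu01 f_int fg) -mulrA; congr (_ * _).
  transitivity (\int[mu]_y (e n ^+ 2 * F n y) / e n ^+ 2).
    congr (_ / _); apply: eq_Rintegral => y _; rewrite /F [RHS]mulrCA.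
    rewrite (mulrC (e n ^+ 2)) divfK ?expf_neq0//; congr (_ * _).
    rewrite /second_difference /al (_ : y - (x + e n) = y - x - e n); last by ring.
    by rewrite subrK (_ : y - x - e n - e n = y - x - 2 * e n)//; ring.
  by rewrite RintegralZl// mulrAC divff ?expf_neq0// mul1r.
rewrite (_ : (fun n => _) = (fun n => odd_cst nu * \int[mu]_y F n y)); last by apply/funext.
apply: cvgMr.
have -> : al * (1 - al) * potential al f x =
    \int[mu]_y (al * (1 - al) * (f y * signed_powR (al - 2) (y - x))).
  by rewrite RintegralZl.
have H := @Rintegral_dominated_cvg _ _ _ mu F
  (fun y => al * (1 - al) * (f y * signed_powR (al - 2) (y - x)))
  (fun y => 384 * `|f y * signed_powR (al - 2) (y - x)|).
apply: H.
- exact: mF.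
- by apply: measurable_funM => //; exact: integrable_measR pi.
- move=> y; have [->|yx] := eqVneq y x.
    by rewrite /F fx !mul0r mulr0; under eq_fun do rewrite mul0r; exact: cvg_cst.
  rewrite mulrCA; apply: cvgMr; apply: second_difference_cvg => //.
  by rewrite subr_eq0.
- by apply: integrable_mulR => //; exact: integrable_normR.
- exact: F_le.
Qed.

Let K_ge0 x : f x = 0 -> 0 <= K.
Proof.
move=> fx; have := f_lin (x + 1) fx; rewrite addrAC subrr add0r normr1 mulr1.
exact: le_trans.
Qed.

Let gi : mu.-integrable setT (EFin \o g). Proof. by case: fg. Qed.

Lemma integrable_cst_ball (c x r : R) : mu.-integrable (ball x r) (EFin \o cst c).
Proof.
apply/integrableP; split; first by apply/measurable_EFinP.
rewrite (_ : (fun y => _) = cst `|c|%:E)//.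
rewrite integral_cst; last exact: measurable_ball.
have [r0|r0] := leP 0 r; last first.
  by rewrite (_ : ball x r = set0) ?measure0 ?mule0 ?ltry//; apply/ball0/ltW.
set m := (X in (_ * X)%E); have -> : m = (r *+ 2)%:E by exact: lebesgue_measure_ball.
by rewrite -EFinM ltry.
Qed.

Lemma tent_integral_ball (h : R -> R) x e :
  \int[mu]_y (h y * tent e (y - (x + e))) =
  \int[mu]_(y in ball x (2 * `|e|)) (h y * tent e (y - (x + e))).
Proof.
rewrite [RHS]Rintegral_mkcond; apply: eq_Rintegral => y _; rewrite patchE.
case: ifPn => // /negP yB; rewrite tent_eq0 ?mulr0//.
rewrite leNgt; apply/negP => ye; apply: yB; rewrite inE /ball/=.
rewrite distrC (_ : y - x = y - (x + e) + e); last by ring.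
by apply: (le_lt_trans (ler_normD _ _)); lra.
Qed.

Lemma integrable_tent (h : R -> R) (A : set R) x e : measurable A ->
  mu.-integrable A (EFin \o h) ->
  mu.-integrable A (EFin \o (fun y => h y * tent e (y - (x + e)))).
Proof.
move=> mA hi.
apply: (@integrable_dom _ _ _ mu A _ (fun y => 2 * `|e| * `|h y|) mA).
- apply: measurable_funM; first exact: integrable_measR hi.
  by apply: (measurable_funS measurableT) => //; exact: measurable_tent.
- move=> y _; rewrite normrM mulrC ler_wpM2r// ger0_norm ?tent_ge0//.
  exact: tent_le.
- by apply: integrable_mulR => //; exact: integrable_normR.
Qed.

(** Divided by [harmonic n ^ 2] the tents are an approximation of the identity up to a
    factor between two positive constants, so at a Lebesgue point their averages detect
    the vanishing of the function. *)
Lemma lebesgue_pt_eq0 x : lebesgue_pt g x ->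
  \int[mu]_y (g y * tent (harmonic n) (y - (x + harmonic n))) / harmonic n ^+ 2
    @[n --> \oo] --> 0 -> g x = 0.
Proof.
move=> gx A0.
pose e n : R := harmonic n.
have e0 n : 0 < e n by rewrite /e/= invr_gt0.
have ecvg : e n @[n --> \oo] --> 0 by exact: cvg_harmonic.
pose B n := ball x (2 * `|e n|).
have mB n : measurable (B n) by exact: measurable_ball.
have giB n : mu.-integrable (B n) (EFin \o g).
  exact: (@integrableS _ _ _ mu setT (B n) _ measurableT (mB n) (@subsetT _ _) gi).
have ciB n c : mu.-integrable (B n) (EFin \o cst c) by exact: integrable_cst_ball.
pose tn n y := tent (e n) (y - (x + e n)).
have tiB n : mu.-integrable (B n) (EFin \o tn n).
  have := integrable_tent x (e n) (mB n) (ciB n 1).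
  set h := EFin \o _; suff -> : h = EFin \o tn n by [].
  by apply/funext => y; rewrite /h/= mul1r.
pose q n := \int[mu]_(y in B n) tn n y / e n ^+ 2.
have q1 n : 1 <= q n.
  rewrite ler_pdivlMr ?mul1r ?exprn_gt0//.
  rewrite Rintegral_mkcond.
  pose B' := ball (x + e n) (e n / 2).
  have mB' : measurable B' by exact: measurable_ball.
  have -> : e n ^+ 2 = \int[mu]_y ((cst (e n) \_ B') y).
    rewrite -Rintegral_mkcond Rintegral_cst//.
    set m := (X in fine X); have -> : m = (e n / 2 *+ 2)%:E.
      by apply: lebesgue_measure_ball; rewrite divr_ge0// ltW.
    by rewrite /= -mulr_natr divfK.
  apply: le_Rintegral => //.
  - rewrite -restrict_EFin.
    have H := (@integrable_mkcond _ _ R mu B' (EFin \o cst (e n)) mB').1.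
    by apply: H; exact: integrable_cst_ball.
  - rewrite -restrict_EFin.
    have H := (@integrable_mkcond _ _ R mu (B n) (EFin \o tn n) (mB n)).1.
    by apply: H.
  move=> y _; rewrite !patchE; case: ifPn => [|_]; last by case: ifPn => // _; exact: tent_ge0.
  rewrite inE /B' /ball/= distrC => yB; rewrite ifT; last first.
    rewrite inE /B /ball/= distrC (_ : y - x = y - (x + e n) + e n); last by ring.
    by apply: (le_lt_trans (ler_normD _ _)); have := e0 n; rewrite (gtr0_norm (e0 n)); lra.
  have := @tent_ge (e n) (y - (x + e n)); rewrite (gtr0_norm (e0 n)); apply.
  exact: ltW.
pose I n := \int[mu]_(y in B n) `|g y - g x|.
have idB n : mu.-integrable (B n) (EFin \o (fun y => g y - g x)).
  have := @integrable_subR _ _ _ mu (B n) (mB n) g (cst (g x)) (giB n) (ciB n (g x)).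
  by [].
have D n : `|g x| <= `|\int[mu]_y (g y * tn n y) / e n ^+ 2| + 8 * (I n / (4 * e n)).
  have E : g x * q n = \int[mu]_y (g y * tn n y) / e n ^+ 2 -
      \int[mu]_(y in B n) ((g y - g x) * tn n y) / e n ^+ 2.
    rewrite /q mulrA -mulrBl; congr (_ / _).
    have -> : \int[mu]_y (g y * tn n y) = \int[mu]_(y in B n) (g y * tn n y).
      exact: tent_integral_ball.
    rewrite -RintegralZl//; last exact: (mB n).
    transitivity (\int[mu]_(y in B n) (g y * tn n y - (g y - g x) * tn n y)).
      by apply: eq_Rintegral => y _; rewrite mulrBl opprB addrC subrK.
    apply: (@RintegralB _ _ _ mu (B n) (fun y => g y * tn n y) (fun y => (g y - g x) * tn n y)) => //.
      exact: (mB n).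
      exact: (integrable_tent x (e n) (mB n) (giB n)).
    exact: (@integrable_tent (fun y => g y - g x) _ x (e n) (mB n) (idB n)).
  apply: (@le_trans _ _ `|g x * q n|).
    by rewrite normrM ler_peMr// (le_trans (q1 n))// ler_norm.
  rewrite E; apply: (le_trans (ler_normB _ _)); rewrite lerD2l.
  rewrite normrM normfV (ger0_norm (sqr_ge0 (e n))) ler_pdivrMr ?exprn_gt0//.
  rewrite (_ : 8 * _ * _ = 2 * e n * I n); last by field; rewrite gt_eqF.
  rewrite -RintegralZl//; [|exact: (mB n)|exact: (integrable_normR (idB n))].
  apply: Rintegral_dom => //.
  - exact: (mB n).
  - exact: (integrable_measR (@integrable_tent (fun y => g y - g x) _ x (e n) (mB n) (idB n))).
  - move=> y _; rewrite normrM mulrC ler_wpM2r// ger0_norm ?tent_ge0//.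
    by have := tent_le (e n) (y - (x + e n)); rewrite (gtr0_norm (e0 n)).
  - by apply: integrable_mulR; [exact: (mB n)|exact: (integrable_normR (idB n))].
have J0 : I n / (4 * e n) @[n --> \oo] --> 0.
  have r0 : (2 * `|e n|) @[n --> \oo] --> 0.
    have h : 2 * `|e n| @[n --> \oo] --> 2 * `|0 : R| by apply: cvgMr; exact: cvg_norm.
    by rewrite normr0 mulr0 in h.
  have dav n : davg g x (2 * `|e n|) = (I n / (4 * e n))%:E.
    have fI : (\int[mu]_(y in B n) (`|g y - g x|%R)%:E)%E = (I n)%:E.
      rewrite /I /Rintegral fineK//; apply: integrable_fin_num; first exact: (mB n).
      exact: (integrable_normR (idB n)).
    rewrite /davg /iavg lebesgue_measure_ball ?mulr_ge0//.
    rewrite (gtr0_norm (e0 n)) inver ifF; last by rewrite gt_eqF// mulr2n addr_gt0// mulr_gt0.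
    rewrite [I n / _]mulrC EFinM (_ : 2 * e n *+ 2 = 4 * e n); last by ring.
    by congr (_ * _)%E; rewrite -fI /B (gtr0_norm (e0 n)).
  have dcvg : (I n / (4 * e n))%:E @[n --> \oo] --> (0:R)%:E.
    under eq_cvg do rewrite -dav.
    apply: ((cvge_at_rightP (davg g x) 0 0).1 gx).
    by split=> // n; rewrite mulr_gt0// normr_gt0 gt_eqF.
  exact: (fine_cvg dcvg).
have S0 : `|\int[mu]_y (g y * tn n y) / e n ^+ 2| + 8 * (I n / (4 * e n)) @[n --> \oo] --> 0.
  have h : `|\int[mu]_y (g y * tn n y) / e n ^+ 2| + 8 * (I n / (4 * e n)) @[n --> \oo] -->
      `|0 : R| + 8 * 0 by apply: cvgD; [exact: cvg_norm|exact: cvgMr].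
  by rewrite normr0 mulr0 addr0 in h.
apply/eqP; rewrite -normr_le0; apply: (cvgr_to_ge S0).
by apply: nearW.
Qed.

(** Since the inverse of [0] is [0], this function vanishes where [f] does, and its integral
    over the line is the relative fractional Fisher information. *)
Definition fisher_integrand f g (lam y : R) : R := (g y * (f y)^-1 + y / lam) ^+ 2 * f y.

Variable lam : R.
Hypothesis lam1 : 1 <= lam.
Hypothesis w_int : mu.-integrable setT (EFin \o fisher_integrand f g lam).

Let w := fisher_integrand f g lam.

Let w_ge0 y : 0 <= w y. Proof. by rewrite mulr_ge0 ?sqr_ge0. Qed.

Let norm_g_le y A : 0 < f y -> 0 < A ->
  `|g y| <= 2^-1 * (A * w y + f y / A) + `|y| * f y.
Proof.
move=> fy A0; have fy0 : f y != 0 by rewrite gt_eqF.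
have lam0 : 0 < lam by exact: lt_le_trans lam1.
have h := amgm (g y + y * f y / lam) A0 fy.
have E : (g y + y * f y / lam) ^+ 2 / f y = w y.
  by rewrite /w /fisher_integrand; field; rewrite fy0 gt_eqF.
rewrite E in h.
have -> : g y = g y + y * f y / lam - y * f y / lam by rewrite addrK.
apply: (le_trans (ler_normB _ _)); apply: lerD => //.
rewrite !normrM normfV (gtr0_norm fy) (gtr0_norm lam0) ler_pdivrMr//.
by rewrite ler_peMr// mulr_ge0// ltW.
Qed.

(** On an interval of positivity of length [2 * a] next to a zero, the density is
    at most [2 * K * a], so completing the square with the weight [B * a] bounds
    the tent average by the information carried by the interval, up to [8 * K / B]. *)
Let tent_average_le x s a B dl : f x = 0 -> s ^+ 2 = 1 -> 0 < a -> 2 * a < dl -> a <= 2^-1 ->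
  0 < B -> (forall t, 0 < t < dl -> 0 < f (x + s * t)) ->
  `|\int[mu]_y (g y * tent (s * a) (y - (x + s * a)))| <=
  a ^+ 2 * (B * \int[mu]_(y in ball x (2 * a)) w y + 8 * K / B + 16 * K * (`|x| + 1) * a).
Proof.
move=> fx s1 a0 adl a2 B0 pos.
have K0 := K_ge0 fx.
have ns : `|s| = 1.
  by apply/eqP; rewrite -(@eqrXn2 _ 2)// -normrX s1 normr1 expr1n.
have na : `|s * a| = a by rewrite normrM ns mul1r gtr0_norm.
have mB : measurable (ball x (2 * a) : set (measurableTypeR R)) by exact: measurable_ball.
have wiB : mu.-integrable (ball x (2 * a)) (EFin \o w).
  exact: (@integrableS _ _ _ mu setT _ _ measurableT mB (@subsetT _ _) w_int).
have giB : mu.-integrable (ball x (2 * a)) (EFin \o g).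
  exact: (@integrableS _ _ _ mu setT _ _ measurableT mB (@subsetT _ _) gi).
pose c0 := 2 * a * (K / B + (`|x| + 1) * (2 * K * a)).
have c00 : 0 <= c0.
  by rewrite mulr_ge0 ?addr_ge0 ?divr_ge0 ?mulr_ge0// ltW.
pose h y := B * a ^+ 2 * w y + cst c0 y.
have wi2 : mu.-integrable (ball x (2 * a)) (EFin \o (fun y => B * a ^+ 2 * w y)).
  by apply: (integrable_mulR mB).
have ci := integrable_cst_ball c0 x (2 * a).
have hi : mu.-integrable (ball x (2 * a)) (EFin \o h) by exact: (integrable_addR mB wi2 ci).
rewrite tent_integral_ball na.
apply: (@le_trans _ _ (\int[mu]_(y in ball x (2 * a)) h y)).
  apply: Rintegral_dom => //.
    exact: (integrable_measR (integrable_tent x (s * a) mB giB)).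
  move=> y yB; rewrite /h /cst.
  have [ya|ya] := leP a `|y - (x + s * a)|.
    rewrite tent_eq0 ?na// mulr0 normr0 addr_ge0// mulr_ge0 ?w_ge0//.
    by rewrite mulr_ge0 ?sqr_ge0 ?ltW.
  pose t := s * (y - x).
  have yE : y = x + s * t by rewrite /t mulrA -expr2 s1 mul1r addrC subrK.
  have ta : `|t - a| < a.
    rewrite (_ : t - a = s * (y - (x + s * a))); first by rewrite normrM ns mul1r.
    by rewrite /t mulrBr [in RHS]mulrBr mulrDr mulrA -expr2 s1; ring.
  have ty : `|y - x| = `|t| by rewrite /t normrM ns mul1r.
  move: ta; rewrite ltr_norml => /andP[t1 t2].
  have t0 : 0 < t by lra.
  have fy : 0 < f y by rewrite yE; apply: pos; apply/andP; split; lra.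
  have fyK : f y <= K * (2 * a).
    apply: (le_trans (f_lin y fx)); rewrite ty (gtr0_norm t0) ler_wpM2l//; lra.
  have yx : `|y| <= `|x| + 1.
    rewrite -[y](subrK x) addrC; apply: (le_trans (ler_normD _ _)).
    by rewrite lerD2l ty (gtr0_norm t0); lra.
  have := norm_g_le fy (mulr_gt0 B0 a0) => gy.
  have tt : tent (s * a) (y - (x + s * a)) <= 2 * a.
    by apply: (le_trans (tent_le _ _)); rewrite na.
  rewrite normrM (ger0_norm (tent_ge0 _ _)).
  apply: (@le_trans _ _ ((2^-1 * (B * a * w y + f y / (B * a)) + `|y| * f y) * (2 * a))).
    by rewrite ler_pM// tent_ge0.
  have e1 : f y / (B * a) <= 2 * (K / B).
    rewrite ler_pdivrMr ?mulr_gt0//.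
    by rewrite (_ : 2 * (K / B) * (B * a) = K * (2 * a))//; field; rewrite gt_eqF.
  have e2 : `|y| * f y <= (`|x| + 1) * (2 * K * a).
    by apply: ler_pM => //; rewrite ?(ltW fy)//; apply: le_trans fyK _; rewrite mulrA (mulrC K).
  apply: (@le_trans _ _ ((2^-1 * (B * a * w y + 2 * (K / B)) + (`|x| + 1) * (2 * K * a)) * (2 * a))).
    rewrite ler_wpM2r ?mulr_ge0 ?(ltW a0)//; apply: lerD => //.
    by rewrite ler_wpM2l// lerD2l.
  by rewrite /c0 le_eqVlt; apply/orP; left; apply/eqP; field; rewrite gt_eqF.
rewrite /h RintegralD// RintegralZl// Rintegral_cst//.
set m := (X in fine X); have -> : m = ((2 * a) *+ 2)%:E.
  by apply: lebesgue_measure_ball; rewrite mulr_ge0// ltW.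
rewrite /= /c0 -mulr_natr le_eqVlt; apply/orP; left; apply/eqP.
by set I := Rintegral _ _ _; field; rewrite gt_eqF.
Qed.

(** The sign [s] selects the side of [x] on which [f] is positive. *)
Lemma tent_average_edge x s dl : f x = 0 -> s ^+ 2 = 1 -> 0 < dl ->
  (forall t, 0 < t < dl -> 0 < f (x + s * t)) ->
  \int[mu]_y (g y * tent (s * harmonic n) (y - (x + s * harmonic n))) / (s * harmonic n) ^+ 2
    @[n --> \oo] --> 0.
Proof.
move=> fx s1 dl0 pos; have K0 := K_ge0 fx.
apply/cvgrPdist_lt => eps eps0.
pose B := 24 * (K + 1) / eps.
have B0 : 0 < B by rewrite divr_gt0// mulr_gt0// ltr_wpDl.
have eB : 0 < eps / (3 * B) by rewrite divr_gt0// mulr_gt0.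
have [d0 [d00 dP]] := integral_normr_continuous w_int eB.
pose r : R := Num.min (Num.min (dl / 2) 2^-1) (Num.min (d0 / 5) (eps / (48 * (K + 1) * (`|x| + 1)))).
have x0 : 0 < `|x| + 1 by rewrite ltr_wpDl.
have K1 : 0 < K + 1 by rewrite ltr_wpDl.
have r0 : 0 < r.
  rewrite !lt_min invr_gt0 !divr_gt0//= ?ltr0n// ?mulr_gt0//.
near=> n.
have a0 : 0 < (harmonic n : R) by rewrite /= invr_gt0.
have ar : (harmonic n : R) < r.
  near: n; have hc : harmonic n @[n --> \oo] --> (0 : R) := cvg_harmonic.
  move/cvgrPdist_lt: hc => /(_ r r0) [N _ HN].
  by exists N => // n /HN; rewrite sub0r normrN; apply: le_lt_trans; exact: ler_norm.
move: ar a0; set a : R := harmonic n; rewrite !lt_min => /andP[/andP[r1 r2] /andP[r3 r4]] a0.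
rewrite sub0r normrN normrM normfV (ger0_norm (sqr_ge0 _)) exprMn s1 mul1r.
rewrite ltr_pdivrMr ?exprn_gt0//.
have adl : 2 * a < dl by lra.
apply: (le_lt_trans (tent_average_le fx s1 a0 adl (ltW r2) B0 pos)).
rewrite mulrC ltr_pM2r ?exprn_gt0//.
have mB : measurable (ball x (2 * a) : set (measurableTypeR R)) by exact: measurable_ball.
have muB : (mu (ball x (2 * a)) < d0%:E)%E.
  rewrite lebesgue_measure_ball; last by rewrite mulr_ge0// ltW.
  by rewrite lte_fin; lra.
have wE : \int[mu]_(y in ball x (2 * a)) `|w y| = \int[mu]_(y in ball x (2 * a)) w y.
  by apply: eq_Rintegral => y _; rewrite ger0_norm.
have := dP _ mB muB; rewrite wE; set I := Rintegral _ _ _ => I1.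
have I2 : B * I < eps / 3.
  rewrite -ltr_pdivlMl//; apply: (lt_le_trans I1).
  by rewrite invfM mulrA mulrC.
have h2 : 8 * K / B <= eps / 3.
  rewrite ler_pdivrMr// /B (_ : eps / 3 * _ = 8 * (K + 1)); first by lra.
  by field; rewrite gt_eqF.
have h3 : 16 * K * (`|x| + 1) * a < eps / 3.
  apply: (@le_lt_trans _ _ (16 * (K + 1) * (`|x| + 1) * a)).
    by rewrite ler_wpM2r ?(ltW a0)// ler_wpM2r ?(ltW x0)//; lra.
  move: r4; rewrite ltr_pdivlMr ?mulr_gt0// => r4.
  rewrite (_ : 16 * _ * _ * a = a * (48 * (K + 1) * (`|x| + 1)) / 3); last by field.
  by rewrite ltr_pM2r.
by move: I2 h2 h3; lra.
Unshelve. all: by end_near. Qed.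

Lemma potential_edge x s dl : f x = 0 -> s ^+ 2 = 1 -> 0 < dl ->
  (forall t, 0 < t < dl -> 0 < f (x + s * t)) -> odd_cst nu * potential al f x = 0.
Proof.
move=> fx s1 dl0 pos.
have e0 n : s * harmonic n != 0.
  have s0 : s != 0 by rewrite -sqrf_eq0 s1 oner_eq0.
  by apply: mulf_neq0 => //; rewrite gt_eqF// invr_gt0.
have ecvg : s * harmonic n @[n --> \oo] --> 0.
  have h : s * harmonic n @[n --> \oo] --> s * 0 by apply: cvgMr; exact: cvg_harmonic.
  by rewrite mulr0 in h.
have c1 := tent_average_cvg fx e0 ecvg.
have c2 := tent_average_edge fx s1 dl0 pos.
have c3 : even_cst * (\int[mu]_y (g y * tent (s * harmonic n) (y - (x + s * harmonic n))) /
    (s * harmonic n) ^+ 2) @[n --> \oo] --> even_cst * 0 by exact: cvgMr.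
have E : odd_cst nu * (al * (1 - al) * potential al f x) = even_cst * 0.
  by apply: cvg_unique c1 c3.
move/eqP: E; rewrite mulr0 mulrCA mulf_eq0 => /orP[|/eqP//].
have := nu0; have := nu1; rewrite /al => n1 n0.
by rewrite mulf_eq0 => /orP[/eqP|/eqP]; lra.
Qed.

End limits.
End tent_averages.

Section zero_set.
Context {R : realType}.
Notation mu := (@lebesgue_measure R).

Lemma potential_reflect (al : R) (f : R -> R) (x : R) :
  mu.-integrable setT (EFin \o (fun y => f y * signed_powR (al - 2) (y - - x))) ->
  potential al (fun y => f (- y)) x = - potential al f (- x).
Proof.
move=> fi; have N1 : (-1 : R) != 0 by rewrite oppr_eq0.
have := Rintegral_scale N1 fi; rewrite normrN1 invr1 mul1r -/(potential _ _ _) => <-.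
rewrite -[RHS]mulN1r -RintegralZl//; last first.
  exact: (integrable_scale N1 fi).
apply: eq_Rintegral => y _; rewrite !mulN1r (_ : - y - - x = - (y - x)); last by ring.
by rewrite signed_powRN mulrN opprK.
Qed.

(** At a zero of [f] the tent averages of [g] tend to a multiple of the potential, and at a
    Lebesgue point they see the value of [g].  The potential vanishes because it and its
    opposite, the potential of the reflected function, are both nonpositive. *)
Lemma fractional_derivative_zero_set (lam K : R) (f g : R -> R) :
  1 < lam < 2 -> (forall x, 0 <= f x) -> continuous f ->
  mu.-integrable setT (EFin \o f) ->
  (forall x y, f x = 0 -> f y <= K * `|y - x|) ->
  is_fractional_derivative (lam - 1) f g ->
  mu.-integrable setT (EFin \o fisher_integrand f g lam) ->
  \forall x \ae mu, f x = 0 -> g x = 0.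
Proof.
move=> /andP[l1 l2] f_ge0 f_cont f_int f_lin fg w_int.
have nu01 : 0 < lam - 1 < 1 by apply/andP; split; lra.
have al01 : 0 < 1 - (lam - 1) < 1 by apply/andP; split; lra.
have edge := potential_edge nu01 f_ge0 f_int f_lin fg (ltW l1) w_int.
have G0 x : f x = 0 -> odd_cst (lam - 1) * potential (1 - (lam - 1)) f x = 0.
  move=> fx; have [->|oc] := eqVneq (odd_cst (lam - 1)) 0; first by rewrite mul0r.
  have edge' a s dl : f a = 0 -> s ^+ 2 = 1 -> 0 < dl ->
      (forall t, 0 < t < dl -> 0 < f (a + s * t)) -> potential (1 - (lam - 1)) f a = 0.
    move=> fa s1 dl0 pos; have /eqP := edge a s dl fa s1 dl0 pos.
    by rewrite mulf_eq0 (negbTE oc) => /eqP.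
  have le0 : potential (1 - (lam - 1)) f x <= 0.
    apply: (potential_le0 al01 f_ge0 f_int f_lin f_cont _ fx) => a b ab fa pos.
    apply: (edge' a 1 (b - a)) => //; rewrite ?expr1n ?subr_gt0// => t /andP[t0 tb].
    by apply: pos; rewrite mul1r; apply/andP; split; lra.
  have ge0 : - potential (1 - (lam - 1)) f x <= 0.
    have refl a : f (- a) = 0 -> potential (1 - (lam - 1)) (fun y => f (- y)) a =
        - potential (1 - (lam - 1)) f (- a).
      by move=> fa; apply: potential_reflect; exact: (potential_integrable al01 f_ge0 f_int f_lin fa).
    rewrite -[x in potential _ _ x]opprK -refl ?opprK//; apply: (@potential_le0 _ _ al01 (fun y => f (- y)) K) => //.
    - have := integrable_scale (c := -1) _ f_int; rewrite oppr_eq0 => /(_ (oner_neq0 _)).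
      by congr (_.-integrable _ (_ \o _)); apply/funext => y; rewrite mulN1r.
    - move=> a b fa; rewrite (_ : `|b - a| = `|- b - - a|); first exact: f_lin.
      by rewrite -opprD normrN.
    - move=> y; apply: continuous_comp; [exact: opp_continuous|exact: f_cont].
    - move=> a b ab fa pos; rewrite refl//.
      rewrite (edge' (- a) (-1) (b - a)) ?oppr0 ?sqrrN ?expr1n ?subr_gt0// => t /andP[t0 tb].
      have := pos (a + t); rewrite mulN1r -opprD; apply.
      by apply/andP; split; lra.
    - by rewrite opprK.
  suff -> : potential (1 - (lam - 1)) f x = 0 by rewrite mulr0.
  by apply/eqP; rewrite eq_le le0/= -oppr_le0.
have e0 n : harmonic n != 0 :> R by rewrite gt_eqF// invr_gt0.
have [gi _] := fg.
have gl : locally_integrable setT g by apply: open_integrable_locally => //; exact: openT.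
apply: ae_mono (lebesgue_differentiation gl) => x gx fx.
apply: (lebesgue_pt_eq0 fg gx).
have c1 := tent_average_cvg nu01 f_ge0 f_int f_lin fg fx e0 cvg_harmonic.
rewrite mulrCA G0// mulr0 in c1.
have ec : even_cst != 0 :> R by exact: even_cst_neq0.
have c2 : even_cst^-1 * (even_cst * (\int[mu]_y (g y * tent (harmonic n) (y - (x + harmonic n))) /
    harmonic n ^+ 2)) @[n --> \oo] --> even_cst^-1 * 0 by exact: cvgMr.
rewrite mulr0 in c2; move: c2; apply: cvg_trans; apply: near_eq_cvg.
by apply: nearW => n; rewrite mulKf.
Qed.

End zero_set.

(** * Moments in the domain of normal attraction *)

Section moments.
Context {R : realType}.
Notation mu := (@lebesgue_measure R).
Variables (lam : R) (f : R -> R).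
Hypothesis lam0 : 0 < lam.
Hypothesis attr : normal_attraction lam f.

Let F := distribution_function f.
Let fd : is_density f. Proof. by case: attr. Qed.
Let f0 x : 0 <= f x. Proof. by case: fd. Qed.
Let mf : measurable_fun setT f. Proof. by case: fd. Qed.
Let f1 : (\int[mu]_x (f x)%:E = 1)%E. Proof. by case: fd. Qed.

Let fi := density_integrable fd.

Let F_EFin y : (\int[mu]_(x in `]-oo, y]) (f x)%:E = (F y)%:E)%E.
Proof.
rewrite /F /distribution_function /Rintegral fineK//; apply: integrable_fin_num => //.
exact: (@integrableS _ _ _ mu setT _ _ measurableT (measurable_itv _) (@subsetT _ _) fi).
Qed.

Let tail_EFin y : (\int[mu]_(x in `]y, +oo[) (f x)%:E = (1 - F y)%:E)%E.
Proof.
have U : setT = `]-oo, y] `|` `]y, +oo[%classic :> set R.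
  apply/seteqP; split => x //= _; rewrite !in_itv/= andbT; have [|] := leP x y; by [left|right].
have := f1; rewrite U ge0_integral_setU//=; last 3 first.
- by apply/measurable_EFinP; exact: (measurable_funS measurableT).
- by move=> x _; rewrite lee_fin.
- apply/disj_setPS => x [/=]; rewrite !in_itv/= andbT => xy yx.
  by move: (lt_le_trans yx xy); rewrite ltxx.
rewrite F_EFin => E.
have := congr1 (fun z => z - (F y)%:E)%E E; rewrite addeAC subee// add0e => ->.
by rewrite EFinB.
Qed.

Let F_ge0 y : 0 <= F y.
Proof. by apply: Rintegral_ge0 => x _. Qed.

Let F_le1 y : F y <= 1.
Proof.
rewrite -subr_ge0 -lee_fin -tail_EFin; apply: integral_ge0 => x _; by rewrite lee_fin.
Qed.

Let tail_le : exists2 M, 0 <= M & forall y, 1 <= y -> F (- y) + (1 - F y) <= M * y `^ (- lam).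
Proof.
case: attr => _ _; rewrite -/F; set c := _ * sin _ => h1 h2.
have [N1 [N1r H1]] : \forall x \near +oo%R, `|c - x `^ lam * F (- x)| < 1.
  by move/cvgrPdist_lt: h1; exact.
have [N2 [N2r H2]] : \forall x \near +oo%R, `|c - x `^ lam * (1 - F x)| < 1.
  by move/cvgrPdist_lt: h2; exact.
pose N := Num.max 1 (Num.max N1 N2).
have N11 : 1 <= N by rewrite le_max lexx.
have NN1 : N1 <= N by rewrite !le_max lexx orbT.
have NN2 : N2 <= N by rewrite !le_max lexx !orbT.
have c0 := normr_ge0 c.
exists (2 * (`|c| + 1) + 2 * N `^ lam).
  by rewrite addr_ge0 ?mulr_ge0 ?powR_ge0 ?addr_ge0.
move=> y y1; have y0 : 0 < y by exact: lt_le_trans y1.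
have yl : 0 < y `^ lam by exact: powR_gt0.
rewrite powRN ler_pdivlMr//.
have [Ny|yN] := ltP N y.
  have := H1 y (le_lt_trans NN1 Ny); have := H2 y (le_lt_trans NN2 Ny).
  rewrite !ltr_norml => /andP[a1 a2] /andP[b1 b2].
  have := ler_norm c; have := powR_ge0 N lam.
  by rewrite mulrC mulrDr; lra.
have h : F (- y) + (1 - F y) <= 2 by have := F_le1 (- y); have := F_ge0 y; lra.
apply: (@le_trans _ _ (2 * N `^ lam)); last by rewrite lerDr mulr_ge0// addr_ge0.
apply: ler_pM => //; [by rewrite addr_ge0// subr_ge0|exact: ltW|].
by apply: ge0_ler_powR => //; rewrite ?nnegrE ltW// (lt_le_trans y0).
Qed.

Variable p : R.
Hypothesis p0 : 0 <= p.
Hypothesis p_lt : p < lam.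

Let B (n : nat) : set R := `[- 2 ^+ n, 2 ^+ n]%classic.

Let pow2_gt0 n : 0 < 2 ^+ n :> R. Proof. exact: exprn_gt0. Qed.

Let m_moment : measurable_fun setT (fun x : R => `|x| `^ p * f x).
Proof. by apply: measurable_funM => //; exact: measurable_powR_norm. Qed.

Let shell_le M n : (forall y, 1 <= y -> F (- y) + (1 - F y) <= M * y `^ (- lam)) ->
  (\int[mu]_(x in B n.+1) (`|x| `^ p * f x)%:E <=
   \int[mu]_(x in B n) (`|x| `^ p * f x)%:E + (2 `^ p * M * (2 `^ (p - lam)) ^+ n)%:E)%E.
Proof.
move=> hM.
have n1 : 1 <= 2 ^+ n :> R by rewrite exprn_ege1// ler1n.
pose L : set R := `]-oo, - 2 ^+ n]%classic; pose U : set R := `]2 ^+ n, +oo[%classic.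
pose q : R := (2 ^+ n.+1) `^ p.
have q0 : 0 <= q by exact: powR_ge0.
have mq : measurable_fun setT (fun x : R => (q * f x)%:E).
  by apply/measurable_EFinP; exact: measurable_funM.
have qf x : (0 <= (q * f x)%:E)%E by rewrite lee_fin mulr_ge0.
have pf x : (0 <= (`|x| `^ p * f x)%:E)%E by rewrite lee_fin mulr_ge0 ?powR_ge0.
have mp : measurable_fun setT (fun x : R => (`|x| `^ p * f x)%:E) by exact/measurable_EFinP.
pose S := B n.+1 `\` B n.
have mS : measurable S by apply: measurableD; exact: measurable_itv.
have mBn : measurable (B n) by exact: measurable_itv.
have BU : B n.+1 = B n `|` S.
  rewrite /S setDE setUIr setUv setIT; apply/esym/setUidr; apply: subset_itv; rewrite bnd_simp.
    by rewrite lerN2 ler_eXn2l ?ltr1n.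
  by rewrite ler_eXn2l ?ltr1n.
rewrite BU ge0_integral_setU//; last 2 first.
- exact: (measurable_funS measurableT).
- by apply/disj_setPS => x [xB [_]].
rewrite leeD2l//.
have SLU : S `<=` L `|` U.
  move=> x [/=]; rewrite /B /= !in_itv/= => _ /negP; rewrite negb_and -!ltNge => /orP[|] h.
    by left; rewrite /L/= in_itv/= ltW.
  by right; rewrite /U/= in_itv/= h.
have mL : measurable L by exact: measurable_itv.
have mU : measurable U by exact: measurable_itv.
apply: (@le_trans _ _ (\int[mu]_(x in S) (q * f x)%:E)%E).
  apply: ge0_le_integral => //.
  - exact: (measurable_funS measurableT).
  - exact: (measurable_funS measurableT).
  move=> x [xB _]; rewrite lee_fin ler_wpM2r// /q; apply: ge0_ler_powR; rewrite ?nnegrE//.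
  by move: xB; rewrite /B/= in_itv/= -ler_norml.
apply: (@le_trans _ _ (\int[mu]_(x in L `|` U) (q * f x)%:E)%E).
  apply: ge0_subset_integral => //; first exact: measurableU.
  exact: (measurable_funS measurableT).
rewrite ge0_integral_setU//; last 2 first.
- exact: (measurable_funS measurableT).
- apply/disj_setPS => x [/=]; rewrite /L /U /= !in_itv/= andbT => xL xU.
  by have := pow2_gt0 n; lra.
under eq_integral do rewrite EFinM.
under [X in (_ + X)%E]eq_integral do rewrite EFinM.
rewrite !ge0_integralZl_EFin//; try by [move=> x _; rewrite lee_fin | apply/measurable_EFinP; exact: (measurable_funS measurableT)].
rewrite F_EFin tail_EFin -!EFinM -EFinD lee_fin -mulrDr.
apply: (le_trans (ler_wpM2l q0 (hM _ n1))).
rewrite /q exprS powRM ?exprn_ge0// -!powR_mulrn ?powR_ge0// -!powRrM.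
rewrite le_eqVlt; apply/orP; left; apply/eqP.
rewrite (_ : n%:R * - lam = (- lam) * n%:R) 1?mulrC// (_ : (p - lam) * n%:R = n%:R * p + (- lam) * n%:R); last by ring.
rewrite powRD; last by rewrite (_ : (2 : R) != 0) ?implybT// pnatr_eq0.
by ring.
Qed.

(** The dyadic shell at distance [2 ^ n] has mass [O(2 ^ (- n * lam))], and the weight is
    [O(2 ^ (n * p))] there. *)
Lemma normal_attraction_moment : mu.-integrable setT (EFin \o (fun x => `|x| `^ p * f x)).
Proof.
have [M M0 hM] := tail_le.
pose rho := (2 : R) `^ (p - lam).
have r1 : rho < 1.
  by rewrite /rho /powR pnatr_eq0/= expR_lt1 pmulr_llt0 ?subr_lt0// ln_gt0// ltr1n.
have r0 : 0 <= rho by exact: powR_ge0.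
pose c := 2 `^ p * M.
have c0 : 0 <= c by rewrite mulr_ge0// powR_ge0.
have bound n : (\int[mu]_(x in B n) (`|x| `^ p * f x)%:E <=
    (1 + c * ((1 - rho ^+ n) / (1 - rho)))%:E)%E.
  elim: n => [|n IH].
    rewrite expr0 subrr mul0r mulr0 addr0.
    apply: (@le_trans _ _ (\int[mu]_(x in B 0) (f x)%:E)%E).
      apply: ge0_le_integral => //.
      - exact: measurable_itv.
      - by move=> x _; rewrite lee_fin mulr_ge0// powR_ge0.
      - by apply/measurable_EFinP; exact: (measurable_funS measurableT).
      - by apply/measurable_EFinP; exact: (measurable_funS measurableT).
      move=> x; rewrite /B/= expr0 in_itv/= -ler_norml => x1; rewrite lee_fin ler_piMl//.
      by apply: (@le_trans _ _ (1 `^ p)); [apply: ge0_ler_powR; rewrite ?nnegrE|rewrite powR1].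
    rewrite -f1; apply: ge0_subset_integral => //; [exact: measurable_itv|exact/measurable_EFinP|].
    by move=> x _; rewrite lee_fin.
  apply: (le_trans (shell_le n hM)); apply: (le_trans (leeD2r _ IH)).
  rewrite -EFinD lee_fin -/c -/rho -addrA lerD2l -mulrDr le_eqVlt; apply/orP; left; apply/eqP.
  by congr (_ * _); rewrite exprS; field; rewrite subr_eq0 eq_sym lt_eqF.
have U : \bigcup_i B i = setT.
  apply/seteqP; split => // x _.
  exists (Num.bound `|x|) => //; rewrite /B/= in_itv/= -ler_norml.
  apply: (le_trans (ltW (archi_boundP (normr_ge0 x)))).
  by rewrite -natrX ler_nat ltnW// ltn_expl.
rewrite -U; apply: (@ge0_integrable_bigcup _ _ _ (1 + c / (1 - rho))).
- move=> n m nm; apply/subsetPset; apply: subset_itv; rewrite bnd_simp.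
    by rewrite lerN2 ler_weXn2l ?ler1n.
  by rewrite ler_weXn2l ?ler1n.
- by move=> i; exact: measurable_itv.
- by rewrite U.
- by move=> x; rewrite mulr_ge0// powR_ge0.
- move=> i; apply: (le_trans (bound i)); rewrite lee_fin lerD2l ler_wpM2l//.
  by rewrite ler_pdivrMr ?subr_gt0// mulVf ?gt_eqF ?subr_gt0// lerBlDr lerDl exprn_ge0.
Qed.

End moments.

(** * The differential equation of the characteristic function *)

Section transform_derivative.
Context {R : realType}.
Notation mu := (@lebesgue_measure R).
Variable f : R -> R.
Hypothesis fi : mu.-integrable setT (EFin \o f).
Hypothesis xfi : mu.-integrable setT (EFin \o (fun x => x * f x)).

Let is_derive_integral (K dK : R -> R) (xi : R) :
  (forall t : R, is_derive t 1 K (dK t)) -> (forall t, `|K t| <= 1) -> (forall t, `|dK t| <= 1) ->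
  measurable_fun setT K ->
  is_derive xi 1 (fun xi : R => \int[mu]_x (f x * K (xi * x)))
    (\int[mu]_x (x * f x * dK (xi * x))).
Proof.
move=> KdK K1 dK1 mK.
pose h (xi x : R) := f x * K (xi * x).
have dh (t x : R) : is_derive t 1 (h^~ x) (x * f x * dK (t * x)).
  have d1 : is_derive t 1 (fun t : R => t * x) x.
    by apply: is_derive_eq; rewrite scaler0 add0r; exact: mulr1.
  have d2 := @is_derive1_comp R K (fun t => t * x) t _ _ (KdK (t * x)) d1.
  have := is_deriveZ (f x) d2; rewrite /GRing.scale/= (_ : f x * _ = x * f x * dK (t * x)) //.
  by ring.
have p12 t x : partial1of2 h t x = x * f x * dK (t * x).
  by rewrite /partial1of2 derive1E; have [_ ->] := dh t x.
have hi t : mu.-integrable setT (EFin \o h t).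
  apply: (@integrable_dom _ _ _ mu setT _ (fun x => `|f x|) measurableT).
  - apply: measurable_funM; first exact: integrable_measR fi.
    by apply: measurableT_comp => //; exact: measurable_funM.
  - by move=> x _; rewrite normrM ler_piMr.
  - exact: integrable_normR.
have xI : `]xi - 1, xi + 1[%classic xi by rewrite /= in_itv/= ltrBlDr ltrDl ltr01.
have G0 x : 0 <= `|x * f x| by [].
have Gi : mu.-integrable setT (EFin \o (fun x => `|x * f x|)) by exact: integrable_normR.
have Gb (t x : R) : `]xi - 1, xi + 1[%classic t -> [set: R] x -> `|partial1of2 h t x| <= `|x * f x|.
  by move=> _ _; rewrite p12 normrM ler_piMr.
have dd (t x : R) : `]xi - 1, xi + 1[%classic t -> [set: R] x -> derivable (h^~ x) t 1.
  by move=> _ _; have [] := dh t x.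
have hi' (t : R) : `]xi - 1, xi + 1[%classic t -> mu.-integrable setT (EFin \o h t) by move=> _.
have D1 := derivable_under_integral measurableT xI hi' dd G0 Gi Gb.
have D2 := differentiation_under_integral measurableT xI hi' dd G0 Gi Gb.
apply: DeriveDef => //; rewrite -derive1E D2.
by apply: eq_Rintegral => x _; rewrite p12.
Qed.

Lemma is_derive_cos_transform (xi : R) :
  is_derive xi 1 (cos_transform f) (- sin_transform (fun x => x * f x) xi).
Proof.
have := @is_derive_integral cos (fun t => - sin t) xi.
rewrite (_ : \int[mu]_x _ = - sin_transform (fun x => x * f x) xi); last first.
  rewrite /sin_transform -[RHS]mulN1r -RintegralZl//; last exact: integrable_sin_mul.
  by apply: eq_Rintegral => x _; rewrite mulrN mulN1r.
apply.
- by move=> t; rewrite ler_norml cos_geN1 cos_le1.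
- by move=> t; rewrite normrN ler_norml sin_geN1 sin_le1.
- by apply: continuous_measurable_fun; exact: continuous_cos.
Qed.

Lemma is_derive_sin_transform (xi : R) :
  is_derive xi 1 (sin_transform f) (cos_transform (fun x => x * f x) xi).
Proof.
apply: (@is_derive_integral sin cos xi).
- by move=> t; rewrite ler_norml sin_geN1 sin_le1.
- by move=> t; rewrite ler_norml cos_geN1 cos_le1.
- by apply: continuous_measurable_fun; exact: continuous_sin.
Qed.

End transform_derivative.

Section linear_ode.
Context {R : realType}.
Variables (lam s A : R) (F h : R -> R).
Hypothesis lam0 : 0 < lam.
Hypothesis s0 : 0 < s.
Hypothesis F_ode : forall xi : R, 0 < xi -> is_derive xi 1 F (h xi - lam * xi `^ (lam - 1) * F xi).
Hypothesis F_cont : continuous F.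
Hypothesis h_le : forall xi, 0 < xi -> `|h xi| <= A * xi `^ s.

(** The integrating factor of the equation is [expR (xi `^ lam)]. *)
Lemma linear_ode_bound xi : 0 < xi -> xi <= 1 ->
  `|F xi - F 0 * expR (- xi `^ lam)| <= expR 1 * A * xi `^ (1 + s).
Proof.
move=> xi0 xi1.
pose H t := F t * expR (t `^ lam).
have dH (t : R) : 0 < t -> is_derive t 1 H (h t * expR (t `^ lam)).
  move=> t0.
  have d1 := @is_derive1_powR R lam t t0.
  have d2 := @is_derive1_comp R expR (fun t => t `^ lam) t _ _ (is_derive_expR _) d1.
  have d3 := is_deriveM (F_ode t0) d2.
  by apply: (is_derive_eq d3); rewrite /GRing.scale/=; ring.
have contH : {within `[0, xi], continuous H}.
  apply/(continuous_within_itvP H xi0); split.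
  - move=> t; rewrite in_itv/= => /andP[t0 _].
    by apply: differentiable_continuous; apply/derivable1_diffP; have [] := dH t t0.
  - rewrite /H powR0 ?gt_eqF//; apply: cvgM; first by apply: cvg_at_right_filter; exact: F_cont.
    apply: (@cvg_comp _ _ _ (fun t : R => t `^ lam) expR); first exact: (powR_cvg0 lam0).
    exact: continuous_expR.
  - apply: cvg_at_left_filter.
    by apply: differentiable_continuous; apply/derivable1_diffP; have [] := dH xi xi0.
have dH' t : t \in `]0, xi[ -> is_derive t 1 H (h t * expR (t `^ lam)).
  by rewrite in_itv/= => /andP[t0 _]; exact: dH.
have [th] := MVT xi0 dH' contH.
rewrite in_itv/= => /andP[th0 thx] E.
have e0 : 0 < expR (- xi `^ lam) by exact: expR_gt0.
have -> : F xi - F 0 * expR (- xi `^ lam) = expR (- xi `^ lam) * (H xi - H 0).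
  rewrite /H powR0 ?gt_eqF// expR0 mulrBr mulr1 (mulrC (F xi)) mulrA -expRD addNr expR0 mul1r.
  by rewrite mulrC.
rewrite E subr0 !normrM (gtr0_norm (expR_gt0 _)) (gtr0_norm (expR_gt0 _)) (gtr0_norm xi0).
have e1 : expR (- xi `^ lam) <= 1 by rewrite expR_le1 oppr_le0 powR_ge0.
apply: (@le_trans _ _ (1 * (`|h th| * expR (th `^ lam) * xi))).
  by rewrite ler_wpM2r// !mulr_ge0// ?expR_ge0// ltW.
rewrite mul1r.
have A0 : 0 <= A.
  by have := le_trans (normr_ge0 _) (h_le xi0); rewrite pmulr_lge0// powR_gt0.
have h1 : `|h th| <= A * xi `^ s.
  apply: (le_trans (h_le th0)); rewrite ler_wpM2l//.
  by apply: ge0_ler_powR; rewrite ?nnegrE ?ltW.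
have h2 : expR (th `^ lam) <= expR 1.
  rewrite ler_expR; apply: (@le_trans _ _ (1 `^ lam)); last by rewrite powR1.
  by apply: ge0_ler_powR; rewrite ?nnegrE ?ltW// (lt_le_trans thx).
rewrite (_ : expR 1 * A * _ = A * xi `^ s * expR 1 * xi); last first.
  rewrite powRD; last by rewrite (gt_eqF xi0) implybT.
  by rewrite powRr1 ?ltW//; ring.
by apply: ler_wpM2r; [exact: ltW|apply: ler_pM => //; exact: expR_ge0].
Qed.

End linear_ode.

Lemma le_powR_min {R : realType} (a t s : R) : 0 < s -> s <= 1 -> 0 <= t ->
  a <= 1 -> a <= t -> a <= t `^ s.
Proof.
move=> s0 s1 t0 a1 at_; have [t1|/ltW t1] := leP t 1.
  apply: (le_trans at_); have [->|tn0] := eqVneq t 0; first exact: powR_ge0.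
  by apply: ger1_powR => //; rewrite t1 lt_def tn0 t0.
apply: (le_trans a1); rewrite -(powRr0 t); apply: ler_powR => //; exact: ltW.
Qed.

Section near_zero.
Context {R : realType}.
Notation mu := (@lebesgue_measure R).
Variables (lam : R) (f g : R -> R).
Hypothesis lam12 : 1 < lam < 2.
Hypothesis attr : normal_attraction lam f.
Hypothesis fg : is_fractional_derivative (lam - 1) f g.
Hypothesis w_int : mu.-integrable setT (EFin \o fisher_integrand f g lam).
Hypothesis zero_set : \forall x \ae mu, f x = 0 -> g x = 0.

Let lam1 : 1 < lam. Proof. by case/andP: lam12. Qed.
Let lam2 : lam < 2. Proof. by case/andP: lam12. Qed.
Let lam0 : 0 < lam. Proof. by apply: lt_trans lam1. Qed.
Let fd : is_density f. Proof. by case: attr. Qed.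
Let f0 x : 0 <= f x. Proof. by case: fd. Qed.
Let mf : measurable_fun setT f. Proof. by case: fd. Qed.
Let fi : mu.-integrable setT (EFin \o f). Proof. exact: density_integrable. Qed.
Let xfi : mu.-integrable setT (EFin \o (fun x => x * f x)). Proof. by case: attr => _ []. Qed.
Let gi : mu.-integrable setT (EFin \o g). Proof. by case: fg. Qed.

(* Halfway between [lam - 1], below which nothing is gained, and [lam / 2], where the
   moments of order [2 * s] stop being finite. *)
Let s : R := (3 * lam - 2) / 4.
Let s0 : 0 < s. Proof. by rewrite /s; have := lam1; lra. Qed.
Let s1 : s <= 1. Proof. by rewrite /s; have := lam2; lra. Qed.

(** A version of [g + y * f / lam] that vanishes where [f] does. *)
Let r y := (g y * (f y)^-1 + y / lam) * f y.

Let mr : measurable_fun setT r.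
Proof.
apply: measurable_funM => //; apply: measurable_funD; last exact: measurable_funM.
by apply: measurable_funM; [exact: integrable_measR gi|exact: measurable_inv_ge0].
Qed.

Let r_le t y : t * `|r y| <= 2^-1 * (t ^+ 2 * f y + fisher_integrand f g lam y).
Proof.
rewrite /r /fisher_integrand normrM (ger0_norm (f0 y)); set rh := g y * _ + _.
rewrite -[rh ^+ 2]real_normK ?num_real//; set q := `|rh|; rewrite -subr_ge0.
rewrite (_ : _ - _ = 2^-1 * (f y * (t - q) ^+ 2)); last by field.
by rewrite mulr_ge0// mulr_ge0// sqr_ge0.
Qed.

Let ri : mu.-integrable setT (EFin \o r).
Proof.
apply: (@integrable_dom _ _ _ mu setT _
  (fun y => 2^-1 * (f y + fisher_integrand f g lam y)) measurableT) => //.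
  by move=> y _; have := r_le 1 y; rewrite mul1r expr1n mul1r.
by apply: integrable_mulR => //; exact: integrable_addR.
Qed.

Let rsi : mu.-integrable setT (EFin \o (fun y => `|y| `^ s * `|r y|)).
Proof.
apply: (@integrable_dom _ _ _ mu setT _
  (fun y => 2^-1 * (`|y| `^ (2 * s) * f y + fisher_integrand f g lam y)) measurableT) => //.
- by apply: measurable_funM; [exact: measurable_powR_norm|exact: measurableT_comp].
- move=> y _; rewrite ger0_norm; last by rewrite mulr_ge0// powR_ge0.
  have := r_le (`|y| `^ s) y; rewrite -powR_mulrn ?powR_ge0// -powRrM.
  by rewrite (mulrC s).
- apply: integrable_mulR => //; apply: integrable_addR => //.
  apply: (normal_attraction_moment lam0 attr); first by rewrite mulr_ge0// ltW.
  by rewrite /s; have := lam2; lra.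
Qed.

Let A : R := \int[mu]_y (`|y| `^ s * `|r y|).

Let r_ae (h : R -> R) : measurable_fun setT h ->
  \int[mu]_y (r y * h y) = \int[mu]_y ((g y + y / lam * f y) * h y).
Proof.
move=> mh; congr fine; apply: ae_eq_integral => //.
- by apply/measurable_EFinP; exact: measurable_funM.
- apply/measurable_EFinP; apply: measurable_funM => //; apply: measurable_funD.
    exact: integrable_measR gi.
  by apply: measurable_funM => //; exact: measurable_funM.
apply: ae_mono zero_set => y fg0 _; congr (_ * _)%:E; rewrite /r.
have [fy|fy] := eqVneq (f y) 0; first by rewrite fy !mulr0 addr0 fg0.
by rewrite mulrDl divfK.
Qed.

Let r_transform xi : cos_transform r xi =
    signed_powR (lam - 1) xi * sin_transform f xi + lam^-1 * cos_transform (fun x => x * f x) xi /\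
  sin_transform r xi =
    - (signed_powR (lam - 1) xi * cos_transform f xi) + lam^-1 * sin_transform (fun x => x * f x) xi.
Proof.
have [<- <-] := fractional_derivative_transform xi fi fg.
split; rewrite [LHS]r_ae.
- rewrite /cos_transform -RintegralZl//; last exact: integrable_cos_mul.
  rewrite -RintegralD//; last 2 first.
  + exact: integrable_cos_mul.
  + by apply: integrable_mulR => //; exact: integrable_cos_mul.
  by apply: eq_Rintegral => y _; rewrite mulrDl; congr (_ + _); rewrite mulrA; ring.
- exact: measurable_cos_mul.
- rewrite /sin_transform -RintegralZl//; last exact: integrable_sin_mul.
  rewrite -RintegralD//; last 2 first.
  + exact: integrable_sin_mul.
  + by apply: integrable_mulR => //; exact: integrable_sin_mul.
  by apply: eq_Rintegral => y _; rewrite mulrDl; congr (_ + _); rewrite mulrA; ring.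
- exact: measurable_sin_mul.
Qed.

Let sin_r_le xi : 0 < xi -> `|sin_transform r xi| <= A * xi `^ s.
Proof.
move=> xi0; rewrite mulrC /A -RintegralZl//; apply: Rintegral_dom => //.
- by apply: measurable_funM => //; exact: measurable_sin_mul.
- move=> y _; rewrite normrM mulrA -powRM ?(ltW xi0)// mulrC.
  apply: ler_wpM2r => //; rewrite -[xi in leRHS]gtr0_norm// -normrM.
  apply: le_powR_min => //; last exact: norm_sin_le.
  by rewrite ler_norml sin_geN1 sin_le1.
- exact: integrable_mulR.
Qed.

Let r_int0 : \int[mu]_y r y = 0.
Proof.
have [H _] := r_transform 0.
rewrite /signed_powR normr0 !mul0r add0r /cos_transform in H.
have E : \int[mu]_x (x * f x * cos (0 * x)) = 0.
  case: attr => _ [_ xf0] _ _; rewrite -[RHS]xf0.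
  by apply: eq_Rintegral => x _; rewrite mul0r cos0 mulr1.
rewrite E mulr0 in H; rewrite -[RHS]H.
by apply: eq_Rintegral => x _; rewrite mul0r cos0 mulr1.
Qed.

Let cos_r_le xi : 0 < xi -> `|cos_transform r xi| <= 2 * A * xi `^ s.
Proof.
move=> xi0.
have -> : cos_transform r xi = \int[mu]_y (r y * (cos (xi * y) - 1)).
  rewrite -[LHS]subr0 -r_int0 -RintegralB//; last exact: integrable_cos_mul.
  by apply: eq_Rintegral => y _; rewrite mulrBr mulr1.
rewrite (_ : 2 * A * xi `^ s = \int[mu]_y (2 * xi `^ s * (`|y| `^ s * `|r y|))); last first.
  by rewrite RintegralZl// -/A; ring.
apply: Rintegral_dom => //.
- by apply: measurable_funM => //; apply: measurable_funB => //; exact: measurable_cos_mul.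
- move=> y _; rewrite normrM (_ : 2 * _ * _ = `|r y| * (2 * (xi `^ s * `|y| `^ s))); last by ring.
  rewrite ler_wpM2l// -powRM ?(ltW xi0)// -[xi in leRHS]gtr0_norm// -normrM.
  have h0 := one_sub_cos_ge0 (xi * y); have h2 := one_sub_cos_le2 (xi * y).
  have h1 := one_sub_cos_le_norm (xi * y).
  rewrite distrC (ger0_norm h0) -ler_pdivrMl// mulrC.
  by apply: le_powR_min => //; have := normr_ge0 (xi * y); lra.
- exact: integrable_mulR.
Qed.

Let transforms_at0 : cos_transform f 0 = 1 /\ sin_transform f 0 = 0.
Proof.
split.
  have [_ _ f1] := fd.
  rewrite -[RHS]/(fine 1%:E) -f1; apply: eq_Rintegral => y _.
  by rewrite mul0r cos0 mulr1.
transitivity (\int[mu]_y (0 * f y)); last by rewrite RintegralZl// mul0r.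
by apply: eq_Rintegral => y _; rewrite mul0r sin0 mulr0 mul0r.
Qed.

Lemma norm_transform_le1 xi : `|cos_transform f xi| <= 1 /\ `|sin_transform f xi| <= 1.
Proof.
have [C0 _] := transforms_at0.
have f1 : \int[mu]_y f y = 1.
  by rewrite -C0; apply: eq_Rintegral => y _; rewrite mul0r cos0 mulr1.
split; rewrite -[leRHS]f1; apply: Rintegral_dom => //.
- by apply: measurable_funM => //; exact: measurable_cos_mul.
- by move=> y _; rewrite normrM ger0_norm// ler_piMr// ler_norml cos_geN1 cos_le1.
- by apply: measurable_funM => //; exact: measurable_sin_mul.
- by move=> y _; rewrite normrM ger0_norm// ler_piMr// ler_norml sin_geN1 sin_le1.
Qed.

(** Near the origin the characteristic function differs from that of the stable
    law by [O(`|xi| `^ (1 + s))]: [r] solves the linear equation whose solution with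
    [r = 0] is the stable law, and has a moment of order [s]. *)
Lemma char_function_near_zero : exists2 B, 0 <= B & forall xi,
  `|cos_transform f xi - expR (- `|xi| `^ lam)| <= B * `|xi| `^ (1 + s) /\
  `|sin_transform f xi| <= B * `|xi| `^ (1 + s).
Proof.
have [C0 D0] := transforms_at0.
have A0 : 0 <= A by apply: Rintegral_ge0 => y _; rewrite mulr_ge0// powR_ge0.
have dC (xi : R) := is_derive_cos_transform fi xfi xi.
have dD (xi : R) := is_derive_sin_transform fi xfi xi.
have cC : continuous (cos_transform f).
  by move=> xi; apply: differentiable_continuous; apply/derivable1_diffP; have [] := dC xi.
have cD : continuous (sin_transform f).
  by move=> xi; apply: differentiable_continuous; apply/derivable1_diffP; have [] := dD xi.
have oC (xi : R) : 0 < xi -> is_derive xi 1 (cos_transform f)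
    (- lam * sin_transform r xi - lam * xi `^ (lam - 1) * cos_transform f xi).
  move=> xi0; apply: (is_derive_eq (dC xi)); have [_ ->] := r_transform xi.
  by rewrite signed_powR_gt0E//; field; rewrite gt_eqF.
have oD (xi : R) : 0 < xi -> is_derive xi 1 (sin_transform f)
    (lam * cos_transform r xi - lam * xi `^ (lam - 1) * sin_transform f xi).
  move=> xi0; apply: (is_derive_eq (dD xi)); have [-> _] := r_transform xi.
  by rewrite signed_powR_gt0E//; field; rewrite gt_eqF.
have hC (xi : R) : 0 < xi -> `|- lam * sin_transform r xi| <= lam * (2 * A) * xi `^ s.
  move=> xi0; rewrite normrM normrN (gtr0_norm lam0) -mulrA ler_wpM2l ?(ltW lam0)//.
  apply: (le_trans (sin_r_le xi0)); rewrite ler_wpM2r ?powR_ge0//.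
  by move: A0; move: (A) => a a0; lra.
have hD (xi : R) : 0 < xi -> `|lam * cos_transform r xi| <= lam * (2 * A) * xi `^ s.
  by move=> xi0; rewrite normrM (gtr0_norm lam0) -mulrA ler_wpM2l ?(ltW lam0)// cos_r_le.
pose B := expR 1 * (lam * (2 * A)) + 2.
have BA : expR 1 * (lam * (2 * A)) <= B by rewrite /B lerDl.
have B2 : 2 <= B by rewrite /B lerDr !mulr_ge0 ?expR_ge0// ltW.
have B0 : 0 <= B by apply: le_trans B2.
have pos (xi : R) : 0 < xi ->
    `|cos_transform f xi - expR (- xi `^ lam)| <= B * xi `^ (1 + s) /\
    `|sin_transform f xi| <= B * xi `^ (1 + s).
  move=> xi0; have [xi1|xi1] := leP xi 1.
    have h1 := linear_ode_bound lam0 s0 oC cC hC xi0 xi1.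
    have h2 := linear_ode_bound lam0 s0 oD cD hD xi0 xi1.
    rewrite C0 mul1r in h1; rewrite D0 mul0r subr0 in h2.
    by split; [apply: (le_trans h1)|apply: (le_trans h2)]; rewrite ler_wpM2r ?powR_ge0.
  have p1 : 1 <= xi `^ (1 + s).
    apply: (@le_trans _ _ (xi `^ 0)); first by rewrite powRr0.
    apply: ler_powR; first exact: ltW.
    by rewrite addr_ge0// ltW.
  have b2 : 2 <= B * xi `^ (1 + s) by rewrite -[2]mulr1; apply: ler_pM.
  have [c1 d1] := norm_transform_le1 xi.
  split; last by apply: (le_trans d1); apply: le_trans b2; rewrite ler1n.
  apply: (le_trans (ler_normB _ _)); apply: le_trans b2.
  have : `|expR (- xi `^ lam)| <= 1 by rewrite ger0_norm ?expR_ge0// expR_le1 oppr_le0 powR_ge0.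
  by move: c1; lra.
exists B => // xi.
have [xi0|xi0|->] := ltgtP xi 0.
- have [h1 h2] := pos (- xi) (ltac:(by rewrite oppr_gt0)).
  rewrite (ltr0_norm xi0); split.
    apply: le_trans h1; rewrite le_eqVlt; apply/orP; left; apply/eqP; congr `| _ - _|.
    by apply: eq_Rintegral => y _; rewrite mulNr cosN.
  apply: le_trans h2; rewrite -normrN le_eqVlt; apply/orP; left; apply/eqP; congr `| _|.
  rewrite /sin_transform -[LHS]mulN1r -RintegralZl//; last exact: integrable_sin_mul.
  by apply: eq_Rintegral => y _; rewrite [- xi * y]mulNr sinN mulN1r mulrN.
- by rewrite (gtr0_norm xi0); exact: pos.
- by rewrite C0 D0 normr0 powR0 ?gt_eqF// oppr0 expR0 subrr normr0 !mulr_ge0 ?powR_ge0.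
Qed.

End near_zero.

(** * Decay of the characteristic function *)

Import ComplexField.Normc.

Section normc.
Context {R : realType}.
Implicit Types (z : R[i]) (a b u v M : R).

Lemma normcE a b : normc (a +i* b)%C = Num.sqrt (a ^+ 2 + b ^+ 2).
Proof. by []. Qed.

Lemma normc_ge0 z : 0 <= normc z.
Proof. by case: z => a b; exact: sqrtr_ge0. Qed.

Lemma sqr_normc a b : normc (a +i* b)%C ^+ 2 = a ^+ 2 + b ^+ 2.
Proof. by rewrite normcE sqr_sqrtr// addr_ge0 ?sqr_ge0. Qed.

Lemma normc_le a b M : `|a| <= M -> `|b| <= M -> normc (a +i* b)%C <= 2 * M.
Proof.
move=> aM bM; have M0 : 0 <= M by apply: le_trans aM.
rewrite -(@ler_pXn2r _ 2) ?nnegrE ?normc_ge0 ?mulr_ge0// sqr_normc.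
rewrite -(real_normK (num_real a)) -(real_normK (num_real b)).
have a2 : `|a| ^+ 2 <= M ^+ 2 by rewrite ler_pXn2r ?nnegrE.
have b2 : `|b| ^+ 2 <= M ^+ 2 by rewrite ler_pXn2r ?nnegrE.
by rewrite exprMn; have := sqr_ge0 M; lra.
Qed.

Lemma normc_ge_linear a b u v : u ^+ 2 + v ^+ 2 = 1 -> u * a + v * b <= normc (a +i* b)%C.
Proof.
move=> uv; apply: (le_trans (ler_norm _)).
rewrite -(@ler_pXn2r _ 2) ?nnegrE ?normc_ge0// sqr_normc real_normK ?num_real//.
rewrite -subr_ge0 (_ : _ - _ = (u * b - v * a) ^+ 2); first exact: sqr_ge0.
rewrite (_ : a ^+ 2 + b ^+ 2 = (u ^+ 2 + v ^+ 2) * (a ^+ 2 + b ^+ 2)); last by rewrite uv mul1r.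
by ring.
Qed.

Lemma normc_real a : 0 <= a -> normc a%:C%C = a.
Proof. by move=> a0; rewrite normcE expr0n addr0 sqrtr_sqr ger0_norm. Qed.

Lemma normc_triangle z1 z2 : normc (z1 + z2) <= normc z1 + normc z2.
Proof. exact: (@le_normcD R z1 z2). Qed.

Lemma normcX z n : normc (z ^+ n) = normc z ^+ n.
Proof. by elim: n => [|n IH]; rewrite ?expr0 ?normc1// !exprS normcM IH. Qed.

Lemma normc_sub_sqr z1 z2 : normc (z1 - z2) ^+ 2 <= 2 * normc z1 ^+ 2 + 2 * normc z2 ^+ 2.
Proof.
case: z1 => a b; case: z2 => u v.
rewrite (_ : (_ - _)%R = ((a - u) +i* (b - v))%C)// !sqr_normc -subr_ge0.
rewrite (_ : _ - _ = (a + u) ^+ 2 + (b + v) ^+ 2); last by ring.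
by rewrite addr_ge0 ?sqr_ge0.
Qed.

Lemma normc_sub_expr z1 z2 M n : normc z1 <= M -> normc z2 <= M ->
  normc (z1 ^+ n.+1 - z2 ^+ n.+1) <= n.+1%:R * normc (z1 - z2) * M ^+ n.
Proof.
move=> h1 h2; have M0 : 0 <= M by apply: le_trans h1; exact: normc_ge0.
elim: n => [|n IH]; first by rewrite !expr1 mul1r expr0 mulr1.
rewrite [z1 ^+ _]exprSr [z2 ^+ _]exprSr.
rewrite (_ : _ - _ = z1 ^+ n.+1 * (z1 - z2) + (z1 ^+ n.+1 - z2 ^+ n.+1) * z2); last by ring.
apply: (le_trans (normc_triangle _ _)); rewrite !normcM normcX.
have e1 : normc z1 ^+ n.+1 * normc (z1 - z2) <= M ^+ n.+1 * normc (z1 - z2).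
  by rewrite ler_wpM2r ?normc_ge0// ler_pXn2r ?nnegrE ?normc_ge0.
have e2 : normc (z1 ^+ n.+1 - z2 ^+ n.+1) * normc z2 <= n.+1%:R * normc (z1 - z2) * M ^+ n * M.
  by apply: ler_pM; rewrite ?normc_ge0.
apply: (le_trans (lerD e1 e2)); rewrite le_eqVlt; apply/orP; left; apply/eqP.
by rewrite -[n.+2]addn1 natrD exprS; ring.
Qed.

End normc.

Section decay.
Context {R : realType}.
Notation mu := (@lebesgue_measure R).
Variables (nu : R) (f g : R -> R).
Hypothesis fd : is_density f.
Hypothesis nu0 : 0 < nu.
Hypothesis fg : is_fractional_derivative nu f g.

Let f0 x : 0 <= f x. Proof. by case: fd. Qed.
Let mf : measurable_fun setT f. Proof. by case: fd. Qed.
Let fi := density_integrable fd.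
Let f1 : \int[mu]_y f y = 1. Proof. by have [_ _ h1] := fd; rewrite /Rintegral h1. Qed.

(** Multiplied by [`|xi| `^ nu], the transform of [f] has the modulus of the transform of the
    integrable function [g]. *)
Lemma fourier_powR_decay : exists2 A, 0 < A & forall xi, xi != 0 ->
  normc (fourier f xi) <= A * `|xi| `^ (- nu).
Proof.
have gi : mu.-integrable setT (EFin \o g) by case: fg.
pose A := \int[mu]_y `|g y|.
have A0 : 0 <= A by apply: Rintegral_ge0.
exists (2 * (A + 1)) => [|xi xi0]; first by rewrite mulr_gt0// ltr_wpDl.
have axi : 0 < `|xi| by rewrite normr_gt0.
have S : `|signed_powR nu xi| = `|xi| `^ nu.
  rewrite /signed_powR normrM normrM normfV normr_id divff ?gt_eqF// mul1r.
  by rewrite ger0_norm ?powR_ge0.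
have [hc hs] := fractional_derivative_transform xi fi fg.
have ic : `|cos_transform g xi| <= A.
  apply: Rintegral_dom => //; last exact: integrable_normR.
    exact: (integrable_measR (integrable_cos_mul xi gi)).
  by move=> y _; rewrite normrM ler_piMr// ler_norml cos_geN1 cos_le1.
have is_ : `|sin_transform g xi| <= A.
  apply: Rintegral_dom => //; last exact: integrable_normR.
    exact: (integrable_measR (integrable_sin_mul xi gi)).
  by move=> y _; rewrite normrM ler_piMr// ler_norml sin_geN1 sin_le1.
rewrite hc (normrM (signed_powR _ _)) S in ic.
rewrite hs normrN (normrM (signed_powR _ _)) S in is_.
move: ic is_.
rewrite -!ler_pdivlMl ?powR_gt0// => ic is_.
rewrite fourierE//; apply: (@le_trans _ _ (2 * ((`|xi| `^ nu)^-1 * A))).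
  by apply: normc_le => //; rewrite normrN.
by rewrite powRN -mulrA ler_wpM2l// mulrC ler_wpM2r ?invr_ge0 ?powR_ge0// lerDl.
Qed.

Let double_arith (p q v : R) : 0 <= 2^-1 * (1 + v) - p ^+ 2 -> v <= q -> 1 - q <= 4 * (1 - p).
Proof. by have := sqr_ge0 (p - 1); rewrite sqrrB mulr1 expr1n; lra. Qed.

(** Let [u x] be [cos (xi * x - a)], where the phase [a] makes its mean equal to the modulus
    [p] of the transform at [xi].  The mean of [u ^ 2 = (1 + cos (2 * xi * x - 2 * a)) / 2]
    is at least [p ^ 2], whence [2 * p ^ 2 - 1 <= `|fourier f (2 * xi)|]. *)
Lemma fourier_double xi :
  1 - normc (fourier f (2 * xi)) <= 4 * (1 - normc (fourier f xi)).
Proof.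
set p := normc (fourier f xi).
have p0 : 0 <= p by exact: normc_ge0.
have q0 := normc_ge0 (fourier f (2 * xi)).
have [/eqP p_eq0|pn0] := boolP (p == 0); first by rewrite p_eq0; lra.
have pp : 0 < p by rewrite lt_def pn0.
pose c := cos_transform f xi / p; pose d := sin_transform f xi / p.
have p2 : p ^+ 2 = cos_transform f xi ^+ 2 + sin_transform f xi ^+ 2.
  by rewrite /p fourierE// sqr_normc sqrrN.
have cd : c ^+ 2 + d ^+ 2 = 1.
  by rewrite /c /d !expr_div_n -mulrDl -p2 divff// expf_neq0.
pose u x := c * cos (xi * x) + d * sin (xi * x).
have iu : mu.-integrable setT (EFin \o (fun x => f x * u x)).
  have := integrable_addR measurableT (integrable_mulR measurableT c (integrable_cos_mul xi fi))
    (integrable_mulR measurableT d (integrable_sin_mul xi fi)).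
  by congr (_.-integrable _ (_ \o _)); apply/funext => x; rewrite /u; ring.
have Eu : \int[mu]_x (f x * u x) = p.
  transitivity (c * cos_transform f xi + d * sin_transform f xi).
    rewrite /cos_transform /sin_transform -!RintegralZl//; last 2 first.
    - exact: integrable_sin_mul.
    - exact: integrable_cos_mul.
    rewrite -RintegralD//; last 2 first.
    - by apply: integrable_mulR => //; exact: integrable_cos_mul.
    - by apply: integrable_mulR => //; exact: integrable_sin_mul.
    by apply: eq_Rintegral => x _; rewrite /u; ring.
  by rewrite /c /d mulrAC [X in _ + X]mulrAC -!expr2 -mulrDl -p2 expr2 mulfK.
pose v x := (c ^+ 2 - d ^+ 2) * cos (2 * xi * x) + 2 * c * d * sin (2 * xi * x).
have u2 x : u x ^+ 2 = 2^-1 * (1 + v x).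
  rewrite /u /v -(mulrA 2 xi) mulr_natl mulr2n cosD sinD.
  have := cos2Dsin2 (xi * x); set C := cos _; set S := sin _ => CS.
  have S2 : S ^+ 2 = 1 - C ^+ 2 by rewrite -CS; ring.
  have d2 : d ^+ 2 = 1 - c ^+ 2 by rewrite -cd; ring.
  transitivity (c ^+ 2 * C ^+ 2 + d ^+ 2 * S ^+ 2 + 2 * c * d * C * S); first by ring.
  transitivity (2^-1 * (1 + (c ^+ 2 - d ^+ 2) * (C ^+ 2 - S ^+ 2) + 4 * c * d * C * S)); last by field.
  by rewrite d2 S2; field.
have iv : mu.-integrable setT (EFin \o (fun x => f x * v x)).
  have := integrable_addR measurableT
    (integrable_mulR measurableT (c ^+ 2 - d ^+ 2) (integrable_cos_mul (2 * xi) fi))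
    (integrable_mulR measurableT (2 * c * d) (integrable_sin_mul (2 * xi) fi)).
  by congr (_.-integrable _ (_ \o _)); apply/funext => x; rewrite /v; ring.
have Ev : \int[mu]_x (f x * v x) <= normc (fourier f (2 * xi)).
  have -> : \int[mu]_x (f x * v x) =
      (c ^+ 2 - d ^+ 2) * cos_transform f (2 * xi) + (- (2 * c * d)) * - sin_transform f (2 * xi).
    rewrite mulrNN /cos_transform /sin_transform -!RintegralZl//; last 2 first.
    - exact: integrable_sin_mul.
    - exact: integrable_cos_mul.
    rewrite -RintegralD//; last 2 first.
    - by apply: integrable_mulR => //; exact: integrable_cos_mul.
    - by apply: integrable_mulR => //; exact: integrable_sin_mul.
    by apply: eq_Rintegral => x _; rewrite /v; ring.
  rewrite fourierE//; apply: normc_ge_linear.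
  by transitivity ((c ^+ 2 + d ^+ 2) ^+ 2); [ring|rewrite cd expr1n].
have var : 0 <= \int[mu]_x (f x * (u x - p) ^+ 2).
  by apply: Rintegral_ge0 => x _; rewrite mulr_ge0// sqr_ge0.
have E : \int[mu]_x (f x * (u x - p) ^+ 2) =
    2^-1 * (1 + \int[mu]_x (f x * v x)) - p ^+ 2.
  transitivity (\int[mu]_x ((2^-1 + p ^+ 2) * f x + (2^-1 * (f x * v x) - 2 * p * (f x * u x)))).
    apply: eq_Rintegral => x _.
    have -> : (u x - p) ^+ 2 = 2^-1 * (1 + v x) - 2 * p * u x + p ^+ 2 by rewrite -u2; ring.
    by ring.
  have iv2 := integrable_mulR measurableT 2^-1 iv.
  have iu2 := integrable_mulR measurableT (2 * p) iu.
  have if2 := integrable_mulR measurableT (2^-1 + p ^+ 2) fi.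
  rewrite (RintegralD measurableT if2 (integrable_subR measurableT iv2 iu2)).
  rewrite (RintegralB measurableT iv2 iu2) !RintegralZl// Eu f1.
  by field.
rewrite E in var.
exact: double_arith var Ev.
Qed.

(** Doubling carries a frequency bounded below into the region where the
    characteristic function is at most [1 / 2]. *)
Lemma fourier_away_from_zero dl : 0 < dl -> exists2 c, 0 < c &
  forall xi, dl <= `|xi| -> normc (fourier f xi) <= expR (- c).
Proof.
move=> dl0.
have [A A0 hA] := fourier_powR_decay.
have [k hk] : exists k, forall xi, dl <= `|xi| -> normc (fourier f (2 ^+ k * xi)) <= 2^-1.
  pose N := (2 * A) `^ nu^-1.
  have N0 : 0 < N by rewrite powR_gt0// mulr_gt0.
  exists (Num.bound (N / dl)) => xi hxi.
  have hN : N <= `|2 ^+ Num.bound (N / dl) * xi|.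
    rewrite normrM ger0_norm ?exprn_ge0//.
    apply: (@le_trans _ _ (2 ^+ Num.bound (N / dl) * dl)); last by rewrite ler_wpM2l ?exprn_ge0.
    rewrite -ler_pdivrMr//; apply: (le_trans (ltW (archi_boundP _))); first by rewrite divr_ge0// ltW.
    by rewrite -natrX ler_nat ltnW// ltn_expl.
  set eta := 2 ^+ _ * xi in hN *.
  have eta0 : 0 < `|eta| by exact: lt_le_trans hN.
  apply: (le_trans (hA _ _)); first by rewrite -normr_gt0.
  rewrite powRN ler_pdivrMr ?powR_gt0// mulrC ler_pdivlMr// mulrC.
  have -> : 2 * A = N `^ nu by rewrite /N -powRrM mulVf ?gt_eqF// powRr1// mulr_ge0// ltW.
  by apply: ge0_ler_powR; rewrite ?nnegrE// ltW.
have dbl j xi : 1 - normc (fourier f (2 ^+ j * xi)) <= 4 ^+ j * (1 - normc (fourier f xi)).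
  elim: j => [|j IH]; first by rewrite !expr0 !mul1r.
  rewrite exprS -mulrA; apply: (le_trans (fourier_double _)).
  by rewrite exprS -mulrA ler_wpM2l.
have k4 : 0 < 4 ^+ k :> R by exact: exprn_gt0.
have k41 : 1 <= 4 ^+ k :> R by rewrite exprn_ege1// ler1n.
pose q : R := 1 - 2^-1 / 4 ^+ k.
have q1 : q < 1 by rewrite /q gtrBl divr_gt0.
have q0 : 0 < q.
  rewrite /q subr_gt0 ltr_pdivrMr// mul1r; apply: lt_le_trans k41.
  by rewrite invf_lt1// ltr1n.
exists (- ln q); first by rewrite oppr_gt0 ln_lt0// q0.
move=> xi hxi; rewrite opprK lnK ?posrE//.
have h1 := hk xi hxi; have h2 := dbl k xi.
have h3 : 2^-1 <= 4 ^+ k * (1 - normc (fourier f xi)) by lra.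
by move: h3; rewrite -ler_pdivrMl// mulrC /q; lra.
Qed.

End decay.

(** * Powers of the characteristic function *)

Section exponential_bounds.
Context {R : realType}.

Lemma expR_dominates_exprn (c : R) m : 0 < c ->
  exists2 C, 0 <= C & forall u : R, 0 <= u -> (1 + u) ^+ m * expR (- c * u) <= C.
Proof.
move=> c0; case: m => [|m].
  by exists 1 => // u u0; rewrite expr0 mul1r expR_le1 mulNr oppr_le0 mulr_ge0// ltW.
pose a : R := Num.min 1 (c / m.+1%:R).
have a0 : 0 < a by rewrite lt_min ltr01 divr_gt0.
have a1 : a <= 1 by rewrite ge_min lexx.
have ac : a <= c / m.+1%:R by rewrite ge_min lexx orbT.
exists (a ^- m.+1); first by rewrite invr_ge0 exprn_ge0// ltW.
move=> u u0; rewrite mulNr expRN ler_pdivrMr ?expR_gt0// mulrC ler_pdivlMr ?exprn_gt0//.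
rewrite -exprMn.
have -> : expR (c * u) = expR (c / m.+1%:R * u) ^+ m.+1.
  by rewrite -expRM_natl; congr expR; field.
rewrite ler_pXn2r ?nnegrE ?expR_ge0//; last by rewrite mulr_ge0 ?addr_ge0// ltW.
apply: le_trans (expR_ge1Dx _); rewrite mulrDl mul1r (mulrC u).
by apply: lerD => //; apply: ler_wpM2r.
Qed.

Lemma powR_le_exprn (x t : R) : 1 <= x -> x `^ t <= x ^+ Num.bound t.
Proof.
move=> x1; rewrite -powR_mulrn; last exact: le_trans x1.
apply: ler_powR => //; have [t0|t0] := leP 0 t; first exact: ltW (archi_boundP t0).
by apply: (le_trans (ltW t0)); rewrite ler0n.
Qed.

Lemma expR_dominates_powR_nat (c t : R) : 0 < c ->
  exists2 C, 0 <= C & forall n, (0 < n)%N -> n%:R `^ t * expR (- c * n%:R) <= C.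
Proof.
move=> c0; have [C C0 hC] := expR_dominates_exprn (Num.bound t) c0.
exists C => // n n0; apply: le_trans (hC n%:R (ler0n _ _)); rewrite ler_wpM2r ?expR_ge0//.
apply: (le_trans (powR_le_exprn _ _)); first by rewrite ler1n.
by rewrite ler_pXn2r ?nnegrE ?addr_ge0// lerDr.
Qed.

Lemma expR_powR_dominates (lam c K : R) : 1 <= lam -> 0 < c ->
  exists2 C, 0 <= C & forall xi : R,
    (1 + `|xi| ^+ 2) `^ K * expR (- c * `|xi| `^ lam) <= C.
Proof.
move=> lam1 c0; have [C C0 hC] := expR_dominates_exprn (2 * Num.bound K) c0.
exists (C * expR c); first by rewrite mulr_ge0// expR_ge0.
move=> xi; have u0 := normr_ge0 xi; move: `|xi| u0 => u u0.
have e1 : (1 + u ^+ 2) `^ K <= (1 + u) ^+ (2 * Num.bound K).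
  apply: (le_trans (powR_le_exprn _ _)); first by rewrite lerDl sqr_ge0.
  rewrite exprM ler_pXn2r ?nnegrE ?addr_ge0 ?sqr_ge0//.
  by rewrite sqrrD expr1n mul1r lerD2r lerDl mulrn_wge0.
have e2 : expR (- c * u `^ lam) <= expR (- c * u) * expR c.
  have ul : u - 1 <= u `^ lam.
    have [u1|/ltW u1] := leP u 1; first by apply: le_trans (powR_ge0 _ _); rewrite subr_le0.
    by apply: (le_trans _ (le1r_powR u1 lam1)); rewrite gerBl.
  rewrite -expRD ler_expR.
  by have := ler_wpM2l (ltW c0) ul; rewrite mulrBr mulr1 !mulNr; lra.
apply: (@le_trans _ _ ((1 + u) ^+ (2 * Num.bound K) * (expR (- c * u) * expR c))).
  by apply: ler_pM; rewrite ?powR_ge0 ?expR_ge0.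
by rewrite mulrA ler_wpM2r ?expR_ge0// hC.
Qed.

End exponential_bounds.

Section power_comparison.
Context {R : realType}.
Variables (lam s B nu A : R) (phi : R -> R[i]).
Hypothesis lam1 : 1 <= lam.
Hypothesis s0 : 0 <= s.
Hypothesis s_lam : lam < 1 + s.
Hypothesis B0 : 0 <= B.
Hypothesis nu0 : 0 < nu.
Hypothesis A0 : 0 < A.
Hypothesis phi_near : forall xi,
  normc (phi xi - (expR (- `|xi| `^ lam))%:C%C) <= B * `|xi| `^ (1 + s).
Hypothesis phi_decay : forall xi, xi != 0 -> normc (phi xi) <= A * `|xi| `^ (- nu).
Hypothesis phi_away : forall dl, 0 < dl -> exists2 c, 0 < c &
  forall xi, dl <= `|xi| -> normc (phi xi) <= expR (- c).

Let lam0 : 0 < lam. Proof. exact: lt_le_trans lam1. Qed.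
Let tau : R := (1 + s) / lam - 1.
Let tau0 : 0 < tau. Proof. by rewrite /tau subr_gt0 ltr_pdivlMr// mul1r. Qed.

Let small_arith (p q x t e1 et ht : R) : q <= x -> x <= t * (e1 / 2) -> et * (1 + t / 2) <= ht ->
  p <= q + et -> t * (e1 / 2) <= et * (t / 2) -> p <= ht.
Proof. by rewrite mulrDr mulr1; lra. Qed.

(** Because [1 + s] exceeds [lam], the error is a small fraction of [`|xi| `^ lam]
    near the origin, and half of the exponential decay survives. *)
Let phi_small : exists2 dl, 0 < dl & forall xi, `|xi| <= dl ->
  normc (phi xi) <= expR (- (`|xi| `^ lam / 2)).
Proof.
pose b : R := (expR (-1) / 2) / (B + 1).
have b0 : 0 < b by rewrite !divr_gt0 ?expR_gt0// ltr_wpDl.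
pose dl := Num.min 1 (b `^ (1 + s - lam)^-1).
have dl0 : 0 < dl by rewrite lt_min ltr01 powR_gt0.
exists dl => // xi hxi; set u := `|xi| in hxi *.
have u0 : 0 <= u by exact: normr_ge0.
have u1 : u <= 1 by apply: (le_trans hxi); rewrite ge_min lexx.
have ub : u `^ (1 + s - lam) <= b.
  have sl : 0 < 1 + s - lam by rewrite subr_gt0.
  apply: (@le_trans _ _ ((b `^ (1 + s - lam)^-1) `^ (1 + s - lam))).
    apply: ge0_ler_powR; rewrite ?nnegrE ?powR_ge0//; first exact: ltW.
    by apply: (le_trans hxi); rewrite ge_min lexx orbT.
  by rewrite -powRrM mulVf ?gt_eqF// powRr1// ltW.
have t0 : 0 <= u `^ lam by exact: powR_ge0.
have t1 : u `^ lam <= 1.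
  apply: (@le_trans _ _ (1 `^ lam)); last by rewrite powR1.
  by apply: ge0_ler_powR; rewrite ?nnegrE// ltW.
have E : u `^ (1 + s) = u `^ lam * u `^ (1 + s - lam).
  have [->|un0] := eqVneq u 0.
    have s1 : 0 < 1 + s by rewrite ltr_pwDl.
    by rewrite (powR0 (x := lam)) ?gt_eqF// mul0r powR0// gt_eqF.
  by rewrite -powRD ?un0 ?implybT//; congr (_ `^ _); ring.
have h := phi_near xi; rewrite -/u in h.
set t := u `^ lam in t0 t1 E h *.
have h1 : B * u `^ (1 + s) <= t * (expR (-1) / 2).
  rewrite E mulrCA ler_wpM2l//; apply: (@le_trans _ _ ((B + 1) * b)).
    by apply: ler_pM => //; rewrite ?powR_ge0// lerDl.
  by rewrite /b mulrC divfK// gt_eqF// ltr_wpDl.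
have h2 : expR (-1) <= expR (- t) by rewrite ler_expR lerN2.
have h3 : expR (- t) * (1 + t / 2) <= expR (- (t / 2)).
  rewrite (_ : - (t / 2) = - t + t / 2); last by field.
  by rewrite expRD ler_wpM2l ?expR_ge0// expR_ge1Dx.
have h4 : normc (phi xi) <= normc (phi xi - (expR (- t))%:C%C) + expR (- t).
  rewrite -[leLHS](_ : normc (phi xi - (expR (- t))%:C%C + (expR (- t))%:C%C) = _); last by rewrite subrK.
  by apply: (le_trans (normc_triangle _ _)); rewrite lerD2l normc_real// expR_ge0.
have h5 : t * (expR (-1) / 2) <= expR (- t) * (t / 2).
  have t2 : 0 <= t / 2 by rewrite divr_ge0.
  by have := ler_wpM2l t2 h2; rewrite mulrCA mulrC (mulrC (expR (- t))) -mulrA (mulrC 2^-1).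
exact: small_arith h h1 h3 h4 h5.
Qed.

(** The telescoped difference of the two powers: each of the [n] terms is at most the
    error at the small frequency [xi / n `^ (1 / lam)] times nearly the full stable
    decay at [xi]. *)
Let power_near K : exists C, exists2 dl, 0 < dl & 0 <= C /\
  forall n xi, (2 <= n)%N -> `|(n%:R `^ lam^-1)^-1 * xi| <= dl ->
  normc (phi ((n%:R `^ lam^-1)^-1 * xi) ^+ n - (expR (- `|xi| `^ lam))%:C%C) ^+ 2 *
    (1 + `|xi| ^+ 2) `^ K <= C * n%:R `^ (- (2 * tau)).
Proof.
have [dl dl0 hdl] := phi_small.
have [C C0 hC] := @expR_powR_dominates R lam 2^-1 (K + (1 + s)) lam1 (ltac:(by rewrite invr_gt0)).
exists (B ^+ 2 * C); exists dl => //; split; first by rewrite mulr_ge0 ?sqr_ge0.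
move=> n xi n2 hxi; set c := (n%:R `^ lam^-1)^-1 in hxi *; set eta := c * xi in hxi *.
have n0 : 0 < n%:R :> R by rewrite ltr0n (leq_trans _ n2).
have c0 : 0 < c by rewrite invr_gt0 powR_gt0.
have cE p : c `^ p = n%:R `^ (- (p / lam)).
  rewrite /c -powR_inv1 ?powR_ge0// -!powRrM; congr (_ `^ _); field.
  by rewrite gt_eqF.
have eE p : `|eta| `^ p = n%:R `^ (- (p / lam)) * `|xi| `^ p.
  by rewrite /eta normrM (gtr0_norm c0) powRM ?(ltW c0)// cE.
have elam : n%:R * `|eta| `^ lam = `|xi| `^ lam.
  by rewrite eE divff ?gt_eqF// powR_inv1 ?ltW// mulrA divff ?gt_eqF// mul1r.
have E : (expR (- `|xi| `^ lam))%:C%C = (expR (- `|eta| `^ lam))%:C%C ^+ n.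
  rewrite -(rmorphXn (real_complex R)); congr (_%:C)%C.
  by rewrite -expRM_natl -elam mulrN.
case: n n2 n0 @c @eta hxi c0 cE eE elam E => // n n2 n0 c eta hxi c0 cE eE elam E.
have h1 := hdl eta hxi.
have h2 : normc (expR (- `|eta| `^ lam))%:C%C <= expR (- (`|eta| `^ lam / 2)).
  rewrite normc_real ?expR_ge0// ler_expR lerN2 ler_pdivrMr// ler_peMr ?powR_ge0//.
  by rewrite ler1n.
have h3 := normc_sub_expr n h1 h2.
have h4 : expR (- (`|eta| `^ lam / 2)) ^+ n <= expR (- (`|xi| `^ lam / 4)).
  rewrite -expRM_natl ler_expR mulrN lerN2 -elam.
  have e0 : 0 <= `|eta| `^ lam by exact: powR_ge0.
  have n1 : 1 <= n%:R :> R by rewrite ler1n.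
  rewrite -[n.+1]addn1 natrD; move: (`|eta| `^ lam) e0 (n%:R) n1 => t t0 m m1.
  by rewrite -subr_ge0 (_ : _ - _ = t * (m - 1) / 4); [rewrite divr_ge0// mulr_ge0// subr_ge0|field].
have h5 : n.+1%:R * (B * `|eta| `^ (1 + s)) = B * (n.+1%:R `^ (- tau) * `|xi| `^ (1 + s)).
  have hn : n.+1%:R `^ (- tau) = n.+1%:R * n.+1%:R `^ (- ((1 + s) / lam)).
    rewrite (_ : - tau = 1 + - ((1 + s) / lam)); last by rewrite /tau; ring.
    by rewrite powRD ?(gt_eqF n0) ?implybT// powRr1// ltW.
  by rewrite eE mulrCA hn !mulrA.
have h6 : normc (phi eta ^+ n.+1 - (expR (- `|xi| `^ lam))%:C%C) <=
    B * (n.+1%:R `^ (- tau) * `|xi| `^ (1 + s)) * expR (- (`|xi| `^ lam / 4)).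
  rewrite E -h5; apply: (le_trans h3); apply: ler_pM => //.
  - by rewrite mulr_ge0 ?normc_ge0.
  - by rewrite ler_wpM2l.
have h7 : (B * (n.+1%:R `^ (- tau) * `|xi| `^ (1 + s)) * expR (- (`|xi| `^ lam / 4))) ^+ 2 =
    B ^+ 2 * n.+1%:R `^ (- (2 * tau)) * (`|xi| ^+ 2) `^ (1 + s) * expR (- 2^-1 * `|xi| `^ lam).
  rewrite !exprMn -expRM_natl -!(powR_mulrn 2) ?powR_ge0// -!powRrM.
  rewrite (_ : - tau * 2%:R = - (2 * tau)); last by ring.
  rewrite (mulrC (1 + s)) (_ : 2 * - (`|xi| `^ lam / 4) = - 2^-1 * `|xi| `^ lam); last by field.
  by rewrite !mulrA.
have x1 : 1 <= 1 + `|xi| ^+ 2 by rewrite lerDl sqr_ge0.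
apply: (@le_trans _ _ (B ^+ 2 * n.+1%:R `^ (- (2 * tau)) * (1 + `|xi| ^+ 2) `^ (1 + s) *
    expR (- 2^-1 * `|xi| `^ lam) * (1 + `|xi| ^+ 2) `^ K)).
  apply: ler_wpM2r; first exact: powR_ge0.
  apply: (@le_trans _ _ ((B * (n.+1%:R `^ (- tau) * `|xi| `^ (1 + s)) * expR (- (`|xi| `^ lam / 4))) ^+ 2)).
    rewrite ler_pXn2r ?nnegrE ?normc_ge0//.
    by rewrite !mulr_ge0 ?powR_ge0 ?expR_ge0.
  rewrite h7 ler_wpM2r ?expR_ge0// ler_wpM2l ?mulr_ge0 ?powR_ge0 ?sqr_ge0//.
  by apply: ge0_ler_powR; rewrite ?nnegrE ?addr_ge0 ?sqr_ge0// lerDr.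
have := hC xi; rewrite powRD; last by rewrite (gt_eqF (lt_le_trans ltr01 x1)) implybT.
set a := (1 + _) `^ K; set b := (1 + _) `^ (1 + s); set e := expR _ => h8.
rewrite (_ : _ * b * e * a = B ^+ 2 * n.+1%:R `^ (- (2 * tau)) * (a * b * e)); last by ring.
rewrite (_ : B ^+ 2 * C * _ = B ^+ 2 * n.+1%:R `^ (- (2 * tau)) * C); last by ring.
by rewrite ler_wpM2l ?mulr_ge0 ?powR_ge0 ?sqr_ge0.
Qed.

Let weighted_sum_le (x y w a b t : R) : x * w <= a * t -> y * w <= b * t ->
  (2 * x + 2 * y) * w <= (2 * a + 2 * b) * t.
Proof. lra. Qed.

Let mul_reorder (a b c d e x y : R) : a * b * c * d * (e * x * y) = a * c * x * (d * y) * (e * b).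
Proof. ring. Qed.

(** Away from the origin geometric decay beats every power of [n]; finitely many of
    the [n] factors are spent on the polynomial decay, which pays for the weight. *)
Let power_far K dl : 0 <= K -> 0 < dl -> exists C, exists2 m, 0 <= C &
  forall n xi, (m <= n)%N -> (0 < n)%N -> dl <= `|(n%:R `^ lam^-1)^-1 * xi| ->
  normc (phi ((n%:R `^ lam^-1)^-1 * xi) ^+ n - (expR (- `|xi| `^ lam))%:C%C) ^+ 2 *
    (1 + `|xi| ^+ 2) `^ K <= C * n%:R `^ (- (2 * tau)).
Proof.
move=> K0 dl0; have [c c0 hc] := phi_away dl0.
pose m := Num.bound (K / nu).
have hm : K <= nu * m%:R.
  by rewrite mulrC -ler_pdivrMr// ltW// archi_boundP// divr_ge0// ltW.
have [C2 C20 hC2] := @expR_dominates_powR_nat R (2 * c) (2 * K + 2 * tau) (ltac:(by rewrite mulr_gt0)).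
have [C3 C30 hC3] := @expR_powR_dominates R lam 1 K lam1 ltr01.
have [C4 C40 hC4] := @expR_dominates_powR_nat R (dl `^ lam) (2 * tau) (powR_gt0 _ dl0).
pose D := 1 + dl ^- 2.
have D0 : 0 < D by rewrite ltr_wpDr// invr_ge0 sqr_ge0.
pose C1 := expR (2 * c * m%:R) * A ^+ (2 * m) * D `^ K * dl `^ (- (2 * (nu * m%:R - K))).
have C10 : 0 <= C1 by rewrite !mulr_ge0 ?powR_ge0 ?expR_ge0 ?exprn_ge0// ltW.
exists (2 * (C1 * C2) + 2 * (C3 * C4)); exists m.
  by apply: addr_ge0; do 2 apply: mulr_ge0 => //.
move=> n xi mn n0 hxi; set cn := (n%:R `^ lam^-1)^-1 in hxi *; set eta := cn * xi in hxi *.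
have nR : 0 < n%:R :> R by rewrite ltr0n.
have n1 : 1 <= n%:R :> R by rewrite ler1n.
have eta0 : 0 < `|eta| by exact: lt_le_trans hxi.
have xE : `|xi| = n%:R `^ lam^-1 * `|eta|.
  by rewrite /eta /cn normrM normfV (ger0_norm (powR_ge0 _ _)) mulrA divff ?mul1r// gt_eqF// powR_gt0.
have elam : `|xi| `^ lam = n%:R * `|eta| `^ lam.
  by rewrite xE powRM ?powR_ge0// -powRrM mulVf ?gt_eqF// powRr1// ltW.
have x2 : 1 + `|xi| ^+ 2 <= n%:R ^+ 2 * D * `|eta| ^+ 2.
  have e1 : 1 <= dl ^- 2 * `|eta| ^+ 2.
    by rewrite mulrC ler_pdivlMr ?exprn_gt0// mul1r ler_pXn2r ?nnegrE// ltW.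
  have e2 : `|xi| ^+ 2 <= n%:R ^+ 2 * `|eta| ^+ 2.
    rewrite -exprMn ler_pXn2r ?nnegrE ?mulr_ge0// xE ler_wpM2r//.
    by apply: ler1_powR => //; rewrite invf_le1.
  have e3 : 1 <= n%:R ^+ 2 * (dl ^- 2 * `|eta| ^+ 2).
    by rewrite -[leLHS]mulr1; apply: ler_pM => //; rewrite exprn_ege1.
  by rewrite /D mulrDr mulr1 mulrDl -(mulrA _ (dl ^- 2)) addrC lerD.
set p := normc (phi eta).
have p0 : 0 <= p by exact: normc_ge0.
have p1 : p <= expR (- c) by exact: hc.
have p2 : p <= A * `|eta| `^ (- nu) by apply: phi_decay; rewrite -normr_gt0.
have pn : p ^+ n <= expR (- c) ^+ (n - m) * (A * `|eta| `^ (- nu)) ^+ m.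
  rewrite -[X in p ^+ X](subnK mn) exprD; apply: ler_pM; rewrite ?exprn_ge0//.
    by case: (n - m)%N => [|j]; rewrite ?expr0// ler_pXn2r ?nnegrE ?expR_ge0.
  by case: (m) => [|j]; rewrite ?expr0// ler_pXn2r ?nnegrE ?mulr_ge0 ?powR_ge0// ltW.
have phi_part : (p ^+ n) ^+ 2 * (1 + `|xi| ^+ 2) `^ K <= C1 * C2 * n%:R `^ (- (2 * tau)).
  have q1 : (p ^+ n) ^+ 2 <= expR (2 * c * m%:R) * expR (- (2 * c) * n%:R) *
      A ^+ (2 * m) * `|eta| `^ (- (2 * (nu * m%:R))).
    apply: (@le_trans _ _ ((expR (- c) ^+ (n - m) * (A * `|eta| `^ (- nu)) ^+ m) ^+ 2)).
      rewrite ler_pXn2r ?nnegrE ?exprn_ge0// mulr_ge0 ?exprn_ge0 ?expR_ge0//.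
      by rewrite mulr_ge0 ?powR_ge0// ltW.
    rewrite exprMn -!exprM -expRM_natl exprMn -(powR_mulrn _ (powR_ge0 _ _)) -powRrM -expRD.
    have -> : ((n - m) * 2)%:R * - c = 2 * c * m%:R + - (2 * c) * n%:R.
      by rewrite natrM natrB//; ring.
    have -> : - nu * (m * 2)%:R = - (2 * (nu * m%:R)) by rewrite natrM; ring.
    by rewrite mulrA (mulnC m).
  have q2 : (1 + `|xi| ^+ 2) `^ K <= n%:R `^ (2 * K) * D `^ K * `|eta| `^ (2 * K).
    apply: (@le_trans _ _ ((n%:R ^+ 2 * D * `|eta| ^+ 2) `^ K)).
      by apply: ge0_ler_powR; rewrite ?nnegrE ?addr_ge0 ?mulr_ge0 ?sqr_ge0// ltW.
    rewrite !powRM ?mulr_ge0 ?sqr_ge0 ?(ltW D0)//.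
    have h2 y : 0 < y -> y `^ (2 * K) = y `^ K * y `^ K.
      by move=> y0; rewrite mulr_natl mulr2n powRD// (gt_eqF y0) implybT.
    by rewrite !h2.
  have q3 : `|eta| `^ (- (2 * (nu * m%:R))) * `|eta| `^ (2 * K) <= dl `^ (- (2 * (nu * m%:R - K))).
    rewrite -powRD; last by rewrite (gt_eqF eta0) implybT.
    rewrite (_ : _ + _ = - (2 * (nu * m%:R - K))); last by ring.
    by apply: powR_antitone => //; rewrite oppr_le0 mulr_ge0// subr_ge0.
  have q4 : n%:R `^ (2 * K) * expR (- (2 * c) * n%:R) <= C2 * n%:R `^ (- (2 * tau)).
    rewrite powRN ler_pdivlMr ?powR_gt0// mulrAC -powRD ?(gt_eqF nR) ?implybT//.
    exact: hC2.
  have w0 := powR_ge0 (1 + `|xi| ^+ 2) K.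
  apply: (le_trans (ler_pM (sqr_ge0 _) w0 q1 q2)).
  rewrite mul_reorder -[leRHS]mulrA; apply: ler_pM => //.
  - by rewrite !mulr_ge0 ?powR_ge0 ?expR_ge0 ?exprn_ge0// ltW.
  by rewrite /C1 ler_wpM2l// !mulr_ge0 ?powR_ge0 ?expR_ge0 ?exprn_ge0// ltW.
have gauss_part : expR (- `|xi| `^ lam) ^+ 2 * (1 + `|xi| ^+ 2) `^ K <= C3 * C4 * n%:R `^ (- (2 * tau)).
  have g1 := hC3 xi; rewrite mulN1r in g1.
  have g2 : expR (- `|xi| `^ lam) <= C4 * n%:R `^ (- (2 * tau)).
    apply: (@le_trans _ _ (expR (- dl `^ lam * n%:R))).
      rewrite ler_expR mulNr lerN2 elam mulrC; apply: ler_wpM2l => //.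
      by apply: ge0_ler_powR; rewrite ?nnegrE// ltW.
    by rewrite powRN ler_pdivlMr ?powR_gt0// mulrC; exact: hC4.
  rewrite expr2 mulrC mulrA -(mulrA C3).
  by apply: ler_pM => //; rewrite ?mulr_ge0 ?powR_ge0 ?expR_ge0.
apply: (@le_trans _ _ ((2 * (p ^+ n) ^+ 2 + 2 * expR (- `|xi| `^ lam) ^+ 2) * (1 + `|xi| ^+ 2) `^ K)).
  rewrite ler_wpM2r ?powR_ge0//; apply: (le_trans (normc_sub_sqr _ _)).
  by rewrite normcX normc_real ?expR_ge0.
exact: weighted_sum_le phi_part gauss_part.
Qed.

Lemma power_comparison K : 0 <= K -> exists C, exists2 n0, 0 <= C &
  forall n xi, (n0 <= n)%N ->
  normc (phi ((n%:R `^ lam^-1)^-1 * xi) ^+ n - (expR (- `|xi| `^ lam))%:C%C) ^+ 2 *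
    (1 + `|xi| ^+ 2) `^ K <= C * n%:R `^ (- (2 * ((1 + s) / lam - 1))).
Proof.
move=> K0; have [C1 [dl dl0 [C10 near]]] := power_near K.
have [C2 [m C20 far]] := power_far K0 dl0.
exists (C1 + C2); exists (maxn 2 m); first by rewrite addr_ge0.
move=> n xi; rewrite geq_max => /andP[n2 mn]; rewrite mulrDl.
have [h|/ltW h] := leP `|(n%:R `^ lam^-1)^-1 * xi| dl.
  by apply: (le_trans (near n xi n2 h)); rewrite lerDl mulr_ge0// powR_ge0.
by apply: (le_trans (far n xi mn (ltnW n2) h)); rewrite lerDr mulr_ge0// powR_ge0.
Qed.

End power_comparison.

(** * Characteristic functions of normalized sums *)

Section eq_integral_of_indicator.
Context {d1 d2 : measure_display} {T1 : measurableType d1} {T2 : measurableType d2}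
  {R : realType}.
Variables (m1 : {measure set T1 -> \bar R}) (m2 : {measure set T2 -> \bar R}).
Variables (Y1 V1 : T1 -> R) (Y2 V2 : T2 -> R).
Hypothesis mY1 : measurable_fun setT Y1.
Hypothesis mY2 : measurable_fun setT Y2.
Hypothesis iV1 : m1.-integrable setT (EFin \o V1).
Hypothesis iV2 : m2.-integrable setT (EFin \o V2).
Hypothesis eq_indic : forall A : set R, measurable A ->
  \int[m1]_x (\1_A (Y1 x) * V1 x) = \int[m2]_x (\1_A (Y2 x) * V2 x).

Let integrable_weight {d} {T : measurableType d} (m : {measure set T -> \bar R})
  (Y V : T -> R) (k : R -> R) : measurable_fun setT Y ->
  m.-integrable setT (EFin \o V) -> measurable_fun setT k -> (forall y, `|k y| <= 1) ->
  m.-integrable setT (EFin \o (fun x => k (Y x) * V x)).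
Proof.
move=> mY iV mk k1.
apply: (@integrable_dom _ _ _ m setT _ (fun x => `|V x|) measurableT).
- by apply: measurable_funM; [exact: measurableT_comp|exact: integrable_measR iV].
- by move=> x _; rewrite normrM ler_piMl.
- exact: integrable_normR.
Qed.

(** Halving: a function with values in [[0, 1]] is half the sum of an indicator and
    of another such function, so the discrepancy of the two integrals is at most
    half the largest discrepancy, at any depth. *)
Let discrepancy_le n (k : R -> R) : measurable_fun setT k -> (forall y, 0 <= k y <= 1) ->
  `|\int[m1]_x (k (Y1 x) * V1 x) - \int[m2]_x (k (Y2 x) * V2 x)| <=
  (2^-1) ^+ n * (\int[m1]_x `|V1 x| + \int[m2]_x `|V2 x|).
Proof.
elim: n k => [|n IH] k mk k01.
  have k1 y : `|k y| <= 1 by rewrite ger0_norm; have /andP[] := k01 y.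
  rewrite expr0 mul1r; apply: (le_trans (ler_normB _ _)); apply: lerD.
    apply: Rintegral_dom => //; last exact: integrable_normR.
      exact: (integrable_measR (integrable_weight mY1 iV1 mk k1)).
    by move=> x _; rewrite normrM ler_piMl.
  apply: Rintegral_dom => //; last exact: integrable_normR.
    exact: (integrable_measR (integrable_weight mY2 iV2 mk k1)).
  by move=> x _; rewrite normrM ler_piMl.
pose A : set R := [set y | 2^-1 <= k y].
have mA : measurable A.
  rewrite (_ : A = setT `&` k @^-1` `[2^-1, +oo[); first exact: mk.
  by rewrite setTI; apply/seteqP; split => y; rewrite /A/= in_itv/= andbT.
pose r y := 2 * k y - \1_A y.
have r01 y : 0 <= r y <= 1.
  have /andP[h1 h2] := k01 y; rewrite /r indicE.
  have [yA|yA] := boolP (y \in A).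
    by move: yA; rewrite inE /A/= => yA; apply/andP; split; lra.
  by move/negP: yA; rewrite inE /A/= => /negP; rewrite -ltNge => yA; apply/andP; split; lra.
have mr : measurable_fun setT r by apply: measurable_funB; [exact: measurable_funM|exact: measurable_indic].
have kE y : k y = 2^-1 * (\1_A y + r y) by rewrite /r; field.
have i1 y : `|\1_A y| <= 1 :> R by rewrite indicE normr_nat lern1 leq_b1.
have r1 y : `|r y| <= 1 by rewrite ger0_norm; have /andP[] := r01 y.
have mI : measurable_fun setT (\1_A : R -> R) by exact: measurable_indic.
have splitE d (T : measurableType d) (m : {measure set T -> \bar R}) (Y V : T -> R) :
    measurable_fun setT Y -> m.-integrable setT (EFin \o V) ->
    \int[m]_x (k (Y x) * V x) =
    2^-1 * (\int[m]_x (\1_A (Y x) * V x) + \int[m]_x (r (Y x) * V x)).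
  move=> mY iV.
  have ii := integrable_weight mY iV mI i1; have ir := integrable_weight mY iV mr r1.
  rewrite -RintegralD// -RintegralZl//; last exact: integrable_addR.
  by apply: eq_Rintegral => x _; rewrite kE -mulrDl mulrA.
rewrite !splitE// eq_indic// -mulrBr opprD addrACA subrr add0r normrM ger0_norm ?invr_ge0//.
by rewrite exprS -mulrA ler_wpM2l ?invr_ge0// IH.
Qed.

Lemma eq_integral_of_indicator (k : R -> R) :
  measurable_fun setT k -> (forall y, `|k y| <= 1) ->
  \int[m1]_x (k (Y1 x) * V1 x) = \int[m2]_x (k (Y2 x) * V2 x).
Proof.
move=> mk k1.
pose h y := (k y + 1) / 2.
have mh : measurable_fun setT h by apply: measurable_funM => //; exact: measurable_funD.
have h01 y : 0 <= h y <= 1.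
  by have := k1 y; rewrite ler_norml /h => /andP[? ?]; apply/andP; split; lra.
have h1 y : `|h y| <= 1 by rewrite ger0_norm; have /andP[] := h01 y.
have E : \int[m1]_x (h (Y1 x) * V1 x) = \int[m2]_x (h (Y2 x) * V2 x).
  apply/eqP; rewrite -subr_eq0 -normr_le0.
  pose c := \int[m1]_x `|V1 x| + \int[m2]_x `|V2 x|.
  have ccvg : (2^-1) ^+ n * c @[n --> \oo] --> 0 * c.
    by apply: cvgMl; apply: cvg_expr; rewrite ger0_norm ?invr_ge0// invf_lt1// ltr1n.
  rewrite mul0r in ccvg; apply: (cvgr_to_ge ccvg).
  by apply: nearW => n; exact: discrepancy_le.
have mT : measurable_fun setT (cst 1 : R -> R) by [].
have T1' y : `|(cst 1 : R -> R) y| <= 1 by rewrite normr1.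
have E1 : \int[m1]_x V1 x = \int[m2]_x V2 x.
  have := eq_indic (@measurableT _ R).
  under eq_Rintegral do rewrite indicT mul1r.
  by under [RHS]eq_Rintegral do rewrite indicT mul1r.
have splitE d (T : measurableType d) (m : {measure set T -> \bar R}) (Y V : T -> R) :
    measurable_fun setT Y -> m.-integrable setT (EFin \o V) ->
    \int[m]_x (k (Y x) * V x) = 2 * \int[m]_x (h (Y x) * V x) - \int[m]_x V x.
  move=> mY iV; have ih := integrable_weight mY iV mh h1.
  rewrite -RintegralZl// -RintegralB//; last exact: integrable_mulR.
  by apply: eq_Rintegral => x _; rewrite /h; field.
by rewrite !splitE// E E1.
Qed.

End eq_integral_of_indicator.

Section sums.
Context {d : measure_display} {T : measurableType d} {R : realType}.
Variables (P : probability T R) (X : nat -> {RV P >-> R}).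
Hypothesis X_indep : mutually_independent P (fun j => X j : T -> R).
Notation mu := (@lebesgue_measure R).

Let mX j : measurable_fun setT (X j). Proof. exact: measurable_funPT. Qed.

Let pr j (A : set R) : R := fine (P (X j @^-1` A)).

Let events (s : seq nat) (A : nat -> set R) (w : T) : R := \prod_(i <- s) \1_(A i) (X i w).

(** A bounded variable [W] is independent of the coordinates from [n] on, in a form
    that passes to products with bounded functions of the coordinate [n]. *)
Definition independent_from (W : T -> R) n : Prop :=
  [/\ measurable_fun setT W, exists M, forall w, `|W w| <= M &
   forall (s : seq nat) (A : nat -> set R), uniq s -> (forall i, i \in s -> (n <= i)%N) ->
   (forall i, measurable (A i)) ->
   \int[P]_w (W w * events s A w) = \int[P]_w W w * \prod_(i <- s) pr i (A i)].

Lemma bounded_integrable (W : T -> R) M : measurable_fun setT W -> (forall w, `|W w| <= M) ->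
  P.-integrable setT (EFin \o W).
Proof.
move=> mW WM; apply: (@integrable_dom _ _ _ P setT _ (cst M) measurableT) => //.
exact: finite_measure_integrable_cst.
Qed.

Let events01 s A w : 0 <= events s A w <= 1.
Proof.
rewrite /events; elim/big_rec: _ => [|i x _ /andP[x0 x1]]; first by rewrite ler01 lexx.
rewrite indicE; case: (_ \in _); last by rewrite mul0r lexx ler01.
by rewrite mul1r x0.
Qed.

Let measurable_events s A : (forall i, measurable (A i)) -> measurable_fun setT (events s A).
Proof.
move=> mA; rewrite /events.
have := @measurable_prod _ T R setT nat s (fun i w => \1_(A i) (X i w)).
by apply => i _; apply: measurableT_comp; [exact: measurable_indic|exact: mX].
Qed.

Let events_indic s A w : events s A w = \1_(\bigcap_(i in [set` s]) (X i @^-1` A i)) w.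
Proof.
rewrite /events indicE; have [|] := boolP (w \in _).
  rewrite inE => H; rewrite big_seq big1// => i si; rewrite indicE mem_set//.
  exact: (H i).
move=> /negP H; have [i si wi] : exists2 i, i \in s & ~ A i (X i w).
  apply: contrapT => nH; apply: H; rewrite inE => i si /=; apply: contrapT => wi.
  by apply: nH; exists i.
by apply/eqP; rewrite prodf_seq_eq0; apply/hasP; exists i => //=; rewrite indicE memNset.
Qed.

Let integral_one : \int[P]_w (cst 1 w : R) = 1.
Proof.
transitivity (1 * fine (P setT)); first exact: Rintegral_cst.
by rewrite probability_setT mulr1.
Qed.

Lemma independent_from_one : independent_from (cst 1) 0.
Proof.
split; first by [].
  by exists 1 => w; rewrite normr1.
move=> s A us _ mA.
have mB : measurable (\bigcap_(i in [set` s]) (X i @^-1` A i)).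
  by apply: bigcap_measurableType => i _; rewrite -[X in measurable X]setTI; exact: (mX i).
have -> : \int[P]_w (cst 1 w * events s A w) = fine (P (\bigcap_(i in [set` s]) (X i @^-1` A i))).
  rewrite -[in RHS](setIT (\bigcap_(_ in _) _)) -integral_indic//.
  by congr fine; apply: eq_integral => w _; rewrite /= mul1r events_indic.
rewrite integral_one mul1r X_indep//.
have -> : (\prod_(i <- s) P (X i @^-1` A i) = (\prod_(i <- s) pr i (A i))%R%:E)%E.
  elim: (s) => [|i s' IH]; first by rewrite !big_nil.
  rewrite !big_cons IH EFinM /pr fineK//; apply: fin_num_measure.
  by rewrite -[X in measurable X]setTI; exact: (mX i).
by [].
Qed.

Let integrable_events (W : T -> R) (M : R) s A : measurable_fun setT W -> (forall w, `|W w| <= M) ->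
  (forall i, measurable (A i)) ->
  P.-integrable setT (EFin \o (fun w => W w * events s A w)).
Proof.
move=> mW WM mA; apply: (@bounded_integrable _ M).
  by apply: measurable_funM => //; exact: measurable_events.
move=> w; rewrite normrM; have /andP[e0 e1] := events01 s A w.
by apply: le_trans (WM w); rewrite ler_piMr// ger0_norm.
Qed.

Lemma independent_fromB W1 W2 n : independent_from W1 n -> independent_from W2 n ->
  independent_from (fun w => W1 w - W2 w) n.
Proof.
move=> [m1 [M1 b1] h1] [m2 [M2 b2] h2]; split; first exact: measurable_funB.
  by exists (M1 + M2) => w; apply: (le_trans (ler_normB _ _)); rewrite lerD.
move=> s A us sn mA.
have i1 := integrable_events s m1 b1 mA; have i2 := integrable_events s m2 b2 mA.
under eq_Rintegral do rewrite mulrBl.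
rewrite (RintegralB measurableT i1 i2) h1// h2// -mulrBl; congr (_ * _).
apply/esym/RintegralB => //; first exact: (bounded_integrable m1 b1).
exact: (bounded_integrable m2 b2).
Qed.

Lemma independent_fromD W1 W2 n : independent_from W1 n -> independent_from W2 n ->
  independent_from (fun w => W1 w + W2 w) n.
Proof.
move=> [m1 [M1 b1] h1] [m2 [M2 b2] h2]; split; first exact: measurable_funD.
  by exists (M1 + M2) => w; apply: (le_trans (ler_normD _ _)); rewrite lerD.
move=> s A us sn mA.
have i1 := integrable_events s m1 b1 mA; have i2 := integrable_events s m2 b2 mA.
under eq_Rintegral do rewrite mulrDl.
rewrite (RintegralD measurableT i1 i2) h1// h2// -mulrDl; congr (_ * _).
apply/esym/RintegralD => //; first exact: (bounded_integrable m1 b1).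
exact: (bounded_integrable m2 b2).
Qed.

Let integral_indic_pr n (A : set R) : measurable A -> \int[P]_w \1_A (X n w) = pr n A.
Proof.
move=> mA; have mB : measurable (X n @^-1` A).
  by rewrite -[X in measurable X]setTI; exact: (mX n).
by rewrite /pr -[in RHS](setIT (X n @^-1` A)) -integral_indic.
Qed.

Lemma independent_fromM W n (k : R -> R) : measurable_fun setT k -> (forall y, `|k y| <= 1) ->
  independent_from W n ->
  \int[P]_w (W w * k (X n w)) = \int[P]_w W w * \int[P]_w k (X n w) /\
  independent_from (fun w => W w * k (X n w)) n.+1.
Proof.
move=> mk k1 [mW [M WM] hW].
have mkX : measurable_fun setT (fun w => k (X n w)) by exact: measurableT_comp.
have key s A : uniq s -> (forall i, i \in s -> (n.+1 <= i)%N) -> (forall i, measurable (A i)) ->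
    \int[P]_w (W w * k (X n w) * events s A w) =
    \int[P]_w W w * \int[P]_w k (X n w) * \prod_(i <- s) pr i (A i).
  move=> us sn mA.
  pose c := \int[P]_w W w * \prod_(i <- s) pr i (A i).
  have ic : P.-integrable setT (EFin \o (cst c : T -> R)) by exact: finite_measure_integrable_cst.
  have iV := integrable_events s mW WM mA.
  have ns : n \notin s by apply/negP => /sn; rewrite ltnn.
  have eqi A0 : measurable A0 -> \int[P]_w (\1_A0 (X n w) * (W w * events s A w)) =
      \int[P]_w (\1_A0 (X n w) * cst c w).
    move=> mA0; pose A' i := if i == n then A0 else A i.
    have e' : \int[P]_w (W w * events (n :: s) A' w) = pr n A0 * c.
      rewrite hW.
      - rewrite big_cons /A' eqxx mulrCA; congr (_ * (_ * _)); rewrite !big_seq.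
        by apply: eq_bigr => i si; case: eqP => // E; rewrite -E si in ns.
      - by rewrite /= ns.
      - by move=> i; rewrite inE => /orP[/eqP ->//|/sn /ltnW].
      - by move=> i; rewrite /A'; case: ifP.
    transitivity (pr n A0 * c).
      rewrite -e'; apply: eq_Rintegral => w _.
      rewrite /events big_cons /A' eqxx mulrCA; congr (_ * (_ * _)); rewrite !big_seq.
      by apply: eq_bigr => i si; case: eqP => // E; rewrite -E si in ns.
    under eq_Rintegral do rewrite mulrC.
    rewrite RintegralZl//; first by rewrite integral_indic_pr// mulrC.
    apply: (@bounded_integrable _ 1); first by apply: measurableT_comp; [exact: measurable_indic|exact: mX].
    by move=> w; rewrite indicE normr_nat lern1 leq_b1.
  have := eq_integral_of_indicator (mX n) (mX n) iV ic eqi mk k1.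
  under eq_Rintegral do rewrite mulrCA mulrA.
  move=> ->; under eq_Rintegral do rewrite mulrC.
  rewrite RintegralZl//; first by rewrite /c mulrAC.
  exact: (@bounded_integrable _ 1).
have E : \int[P]_w (W w * k (X n w)) = \int[P]_w W w * \int[P]_w k (X n w).
  have n0 i : i \in [::] -> (n < i)%N by [].
  have := key [::] (fun=> setT) isT n0 (fun=> measurableT).
  rewrite big_nil mulr1 => <-; apply: eq_Rintegral => w _.
  by rewrite /events big_nil mulr1.
split => //; split; first exact: measurable_funM.
  by exists M => w; rewrite normrM; apply: le_trans (WM w); rewrite ler_piMr.
by move=> s A us sn mA; rewrite key// E.
Qed.

Variables (f : R -> R).
Hypothesis Xf : forall j, has_density P (X j) f.

Lemma expectation_density (Y : T -> R) (h k : R -> R) : measurable_fun setT Y ->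
  has_density P Y h -> measurable_fun setT k -> (forall y, `|k y| <= 1) ->
  \int[P]_w k (Y w) = \int[mu]_y (h y * k y).
Proof.
move=> mY [hd hY] mk k1; have ih := density_integrable hd.
have i1 : P.-integrable setT (EFin \o (cst 1 : T -> R)) by exact: finite_measure_integrable_cst.
have H := @eq_integral_of_indicator _ _ _ _ R P mu Y (cst 1) id h mY (@measurable_id _ _ setT) i1 ih.
transitivity (\int[P]_w (k (Y w) * cst 1 w)); first by apply: eq_Rintegral => w _; rewrite mulr1.
rewrite H//; first by apply: eq_Rintegral => w _; rewrite mulrC.
move=> A mA; have mB : measurable (Y @^-1` A) by rewrite -[X in measurable X]setTI; exact: mY.
transitivity (fine (P (Y @^-1` A))).
  rewrite -[in RHS](setIT (Y @^-1` A)) -integral_indic//.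
  by congr fine; apply: eq_integral => w _; rewrite /= mulr1 !indicE.
rewrite hY// integral_mkcond; congr fine; apply: eq_integral => y _.
by rewrite patchE indicE; case: (_ \in _); rewrite ?mul1r ?mul0r.
Qed.

(** By the addition formulas, the means of the cosine and the sine of the partial sums obey
    the recursion of complex multiplication. *)
Lemma independent_from_sum (zeta : R) n :
  let S w := zeta * \sum_(j < n) X j w in
  let z := (cos_transform f zeta +i* sin_transform f zeta)%C in
  [/\ independent_from (fun w => cos (S w)) n, independent_from (fun w => sin (S w)) n,
    \int[P]_w cos (S w) = complex.Re (z ^+ n) & \int[P]_w sin (S w) = complex.Im (z ^+ n)].
Proof.
move=> /=; elim: n => [|n [Ic Is Ec Es]].
  have cE : (fun w => cos (zeta * \sum_(j < 0) X j w)) = cst 1.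
    by apply/funext => w; rewrite big_ord0 mulr0 cos0.
  have sE : (fun w => sin (zeta * \sum_(j < 0) X j w)) = (fun w => cst 1 w - cst 1 w).
    by apply/funext => w; rewrite big_ord0 mulr0 sin0 subrr.
  rewrite cE sE expr0; split.
  - exact: independent_from_one.
  - by apply: independent_fromB; exact: independent_from_one.
  - exact: integral_one.
  - transitivity (0 * fine (P setT)); last by rewrite mul0r.
    by rewrite -(Rintegral_cst P measurableT); apply: eq_Rintegral => w _; rewrite subrr.
have mc : measurable_fun setT (fun y => cos (zeta * y)) by exact: measurable_cos_mul.
have ms : measurable_fun setT (fun y => sin (zeta * y)) by exact: measurable_sin_mul.
have c1 y : `|cos (zeta * y)| <= 1 by rewrite ler_norml cos_geN1 cos_le1.
have s1 y : `|sin (zeta * y)| <= 1 by rewrite ler_norml sin_geN1 sin_le1.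
have [cc Icc] := independent_fromM mc c1 Ic; have [cs Ics] := independent_fromM ms s1 Ic.
have [sc Isc] := independent_fromM mc c1 Is; have [ss Iss] := independent_fromM ms s1 Is.
have EC : \int[P]_w cos (zeta * X n w) = cos_transform f zeta by exact: expectation_density.
have ES : \int[P]_w sin (zeta * X n w) = sin_transform f zeta by exact: expectation_density.
have i W k0 : independent_from W k0 -> P.-integrable setT (EFin \o W).
  by move=> [mW [M WM] _]; exact: bounded_integrable WM.
have cE w : cos (zeta * \sum_(j < n.+1) X j w) =
    cos (zeta * \sum_(j < n) X j w) * cos (zeta * X n w) -
    sin (zeta * \sum_(j < n) X j w) * sin (zeta * X n w).
  by rewrite big_ord_recr/= mulrDr cosD.
have sE w : sin (zeta * \sum_(j < n.+1) X j w) =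
    sin (zeta * \sum_(j < n) X j w) * cos (zeta * X n w) +
    cos (zeta * \sum_(j < n) X j w) * sin (zeta * X n w).
  by rewrite big_ord_recr/= mulrDr sinD.
rewrite (funext cE) (funext sE); split; [exact: independent_fromB|exact: independent_fromD|..].
  rewrite (RintegralB measurableT (i _ _ Icc) (i _ _ Iss)) cc ss Ec Es EC ES exprSr.
  by case: (_ ^+ n).
rewrite (RintegralD measurableT (i _ _ Isc) (i _ _ Ics)) sc cs Ec Es EC ES exprSr.
by case: (_ ^+ n) => a b /=; rewrite addrC.
Qed.

Let conj_expr (a b : R) n : ((a +i* - b) ^+ n = complex.Re ((a +i* b) ^+ n) +i*
  - complex.Im ((a +i* b) ^+ n))%C.
Proof.
elim: n => [|n IH]; first by rewrite !expr0 /= oppr0.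
rewrite !exprS IH; case: ((a +i* b)%C ^+ n) => x y /=.
by congr (_ +i* _)%C; ring.
Qed.

Lemma fourier_normalized_sum (lam : R) n (h : R -> R) xi :
  has_density P (normalized_sum lam (fun j => X j : T -> R) n) h ->
  fourier h xi = fourier f ((n%:R `^ lam^-1)^-1 * xi) ^+ n.
Proof.
move=> hT.
set c := (n%:R `^ lam^-1)^-1; pose zeta := c * xi.
have hi : mu.-integrable setT (EFin \o h) by apply: density_integrable; case: hT.
have fi : mu.-integrable setT (EFin \o f) by apply: density_integrable; case: (Xf 0).
have mT : measurable_fun setT (normalized_sum lam (fun j => X j : T -> R) n).
  apply: measurable_funM => //; apply: measurable_sum => j; exact: mX.
have [_ _ EC ES] := independent_from_sum zeta n.
rewrite !fourierE// -/zeta conj_expr -EC -ES; congr (_ +i* - _)%C.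
  rewrite /cos_transform -(expectation_density mT hT (measurable_cos_mul xi)).
    by apply: eq_Rintegral => w _; rewrite /normalized_sum /zeta -/c mulrA (mulrC xi).
  by move=> y; rewrite ler_norml cos_geN1 cos_le1.
rewrite /sin_transform -(expectation_density mT hT (measurable_sin_mul xi)).
  by apply: eq_Rintegral => w _; rewrite /normalized_sum /zeta -/c mulrA (mulrC xi).
by move=> y; rewrite ler_norml sin_geN1 sin_le1.
Qed.

End sums.

(** * Sobolev norms *)

Section sobolev.
Context {R : realType}.
Notation mu := (@lebesgue_measure R).

Let cauchy (x : R) : R := (1 + `|x| ^+ 2)^-1.

Let cauchy_integrable : mu.-integrable setT (EFin \o cauchy).
Proof.
have i02 : mu.-integrable setT
    (EFin \o (fun x : R => if `|x| <= 1 then `|x| `^ 0 else `|x| `^ (- 2))).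
  by apply: integrable_powR_split; [rewrite ltrN10|rewrite ltr1n].
apply: (@integrable_dom _ _ _ mu setT _
  (fun x => if `|x| <= 1 then `|x| `^ 0 else `|x| `^ (- 2)) measurableT) => //.
  apply: measurable_inv_ge0 => [|x]; last by rewrite addr_ge0 ?sqr_ge0.
  by apply: measurable_funD => //; apply: measurable_funX.
move=> x _; have h : 0 < 1 + `|x| ^+ 2 by rewrite ltr_pwDl ?sqr_ge0.
rewrite ger0_norm; last by rewrite invr_ge0 ltW.
case: ifPn => [_|].
  by rewrite powRr0 invf_le1// lerDl sqr_ge0.
rewrite -ltNge => x1; have x0 : 0 < `|x| by apply: lt_trans x1.
rewrite powRN powR_mulrn// lef_pV2 ?posrE ?exprn_gt0//.
by rewrite lerDr.
Qed.

Definition cauchy_mass : R := \int[mu]_x cauchy x.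

Lemma cauchy_mass_ge0 : 0 <= cauchy_mass.
Proof. by apply: Rintegral_ge0 => x _; rewrite invr_ge0 addr_ge0 ?sqr_ge0. Qed.

Let weighted_integral_le (h : R -> R) (D : R) : 0 <= D -> (forall xi, 0 <= h xi) ->
  (forall xi, h xi <= D * cauchy xi) -> (\int[mu]_xi (h xi)%:E <= (D * cauchy_mass)%:E)%E.
Proof.
move=> D0 h0 hD.
have iD := integrable_mulR measurableT D cauchy_integrable.
have -> : (D * cauchy_mass)%:E = (\int[mu]_xi (D * cauchy xi)%:E)%E.
  rewrite /cauchy_mass -RintegralZl//.
  exact: fineK (integrable_fin_num measurableT iD).
by apply: ge0_le_integralT => xi; rewrite lee_fin.
Qed.

(** A pointwise bound with one more power of [1 + xi ^ 2] than the norm asks for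
    leaves an integrable weight. *)
Lemma sobolev_norm_le k (h : R -> R) (D : R) : 0 <= D ->
  (forall xi, normc (fourier h xi) ^+ 2 * (1 + `|xi| ^+ 2) `^ (k + 1) <= D) ->
  (sobolev_norm k h <= (Num.sqrt (D * cauchy_mass))%:E)%E.
Proof.
move=> D0 hD.
rewrite -[leRHS]/(sqrte (D * cauchy_mass)%:E) lee_sqrt; last by rewrite lee_fin mulr_ge0// cauchy_mass_ge0.
apply: weighted_integral_le => // xi; first by rewrite mulr_ge0 ?sqr_ge0 ?powR_ge0.
have x0 : 0 < 1 + `|xi| ^+ 2 by rewrite ltr_pwDl ?sqr_ge0.
rewrite ler_pdivlMr// -mulrA -[X in _ * X](_ : (1 + `|xi| ^+ 2) `^ (k + 1) = _); first exact: hD.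
by rewrite powRD ?powRr1 ?(ltW x0)// (gt_eqF x0) implybT.
Qed.

Lemma homogeneous_sobolev_norm_le k (h : R -> R) (D : R) : 0 <= k -> 0 <= D ->
  (forall xi, normc (fourier h xi) ^+ 2 * (1 + `|xi| ^+ 2) `^ (k + 1) <= D) ->
  (homogeneous_sobolev_norm k h <= (Num.sqrt (D * cauchy_mass))%:E)%E.
Proof.
move=> k0 D0 hD.
rewrite -[leRHS]/(sqrte (D * cauchy_mass)%:E) lee_sqrt; last by rewrite lee_fin mulr_ge0// cauchy_mass_ge0.
apply: weighted_integral_le => // xi; first by rewrite mulr_ge0 ?sqr_ge0 ?powR_ge0.
have x0 : 0 < 1 + `|xi| ^+ 2 by rewrite ltr_pwDl ?sqr_ge0.
rewrite ler_pdivlMr//; apply: le_trans (hD xi).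
rewrite powRD; last by rewrite (gt_eqF x0) implybT.
rewrite powRr1 ?(ltW x0)// [leRHS]mulrA; apply: ler_wpM2r; first exact: ltW.
rewrite mulrC ler_wpM2l ?sqr_ge0// powRrM powR_mulrn//.
by apply: ge0_ler_powR; rewrite ?nnegrE ?addr_ge0 ?sqr_ge0// lerDr.
Qed.

Lemma fourierB (h1 h2 : R -> R) xi : mu.-integrable setT (EFin \o h1) ->
  mu.-integrable setT (EFin \o h2) ->
  fourier (h1 \- h2) xi = fourier h1 xi - fourier h2 xi.
Proof.
move=> i1 i2; have i12 := integrable_subR measurableT i1 i2.
rewrite !fourierE//.
have -> : cos_transform (h1 \- h2) xi = cos_transform h1 xi - cos_transform h2 xi.
  rewrite /cos_transform -(RintegralB measurableT (integrable_cos_mul xi i1) (integrable_cos_mul xi i2)).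
  by apply: eq_Rintegral => x _; rewrite mulrBl.
have -> : sin_transform (h1 \- h2) xi = sin_transform h1 xi - sin_transform h2 xi.
  rewrite /sin_transform -(RintegralB measurableT (integrable_sin_mul xi i1) (integrable_sin_mul xi i2)).
  by apply: eq_Rintegral => x _; rewrite mulrBl.
by rewrite opprD.
Qed.

Lemma locally_abs_continuous_continuous (f : R -> R) :
  locally_abs_continuous f -> continuous f.
Proof.
move=> ac x; apply/cvgrPdist_lt => eps eps0.
have [dl dl0 H] := ac (x - 1) (x + 1) eps eps0.
near=> t.
have tx : `|x - t| < Num.min dl 1.
  by near: t; apply: (@cvgr_dist_lt _ _ _ _ _ id x); [exact: cvg_id|rewrite lt_min dl0 ltr01].
move: tx; rewrite lt_min => /andP[td t1].
move: t1; rewrite ltr_norml => /andP[t1 t2].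
pose u := Num.min x t; pose v := Num.max x t.
have := H 1%N (fun=> u) (fun=> v); rewrite !big_ord1 => H1.
have uv : v - u = `|x - t|.
  rewrite /u /v; have [xt|tx] := leP x t; first by rewrite ler0_norm ?subr_le0// opprB.
  by rewrite gtr0_norm// subr_gt0.
have fuv : `|f v - f u| = `|f x - f t|.
  by rewrite /u /v; have [xt|tx] := leP x t => //; rewrite distrC.
rewrite -fuv; apply: H1; last by rewrite uv.
  move=> i _; rewrite /u /v; have [xt|tx] := leP x t; split; try (apply/andP; split); lra.
by move=> [|i] [|j].
Unshelve. all: by end_near. Qed.

Lemma cvg_powR_neg (tau : R) : 0 < tau -> n%:R `^ (- tau) @[n --> \oo] --> (0 : R).
Proof.
move=> t0; rewrite -cvg_shiftS.
have h := (cvg_at_rightP _ _ _).1 (powR_cvg0 t0) harmonic.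
have {}h : (harmonic n : R) `^ tau @[n --> \oo] --> (0 : R).
  apply: h; split; last exact: cvg_harmonic.
  by move=> n; rewrite /= invr_gt0.
rewrite (_ : (fun n => _) = (fun n => (harmonic n : R) `^ tau))//.
by apply/funext => n; rewrite /= -powR_inv1// -powRrM mulN1r.
Qed.

Lemma fisher_integrand_integrable lam (f g : R -> R) :
  is_density f -> mu.-integrable setT (EFin \o g) ->
  (relative_fractional_fisher lam f g < +oo)%E ->
  mu.-integrable setT (EFin \o fisher_integrand f g lam).
Proof.
move=> [mf f0 _] gi fin.
have mw : measurable_fun setT (fisher_integrand f g lam).
  apply: measurable_funM => //; apply: measurable_funX; apply: measurable_funD; last exact: measurable_funM.
  by apply: measurable_funM; [exact: integrable_measR gi|exact: measurable_inv_ge0].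
apply/integrableP; split; first exact/measurable_EFinP.
apply: le_lt_trans fin; rewrite /relative_fractional_fisher [leRHS]integral_mkcond.
rewrite le_eqVlt; apply/orP; left; apply/eqP; apply: eq_integral => x _.
rewrite patchE /= ger0_norm; last by rewrite mulr_ge0 ?sqr_ge0.
case: ifPn => // /negP; rewrite inE /= => /negP; rewrite -leNgt => fx.
have {}fx : f x = 0 by apply/eqP; rewrite eq_le fx f0.
by rewrite /fisher_integrand fx mulr0.
Qed.

End sobolev.

(** * Convergence in the Sobolev spaces *)

Theorem corollary7 (R : realType) (lam : R) (f omega : R -> R)
    (d : measure_display) (T : measurableType d) (P : probability T R)
    (X : nat -> {RV P >-> R}) (fn : nat -> R -> R) :
  1 < lam < 2 ->
  is_stable_density lam omega ->
  (forall j, has_density P (X j) f) ->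
  mutually_independent P (fun j => X j : T -> R) ->
  normal_attraction lam f ->
  bounded_fisher f ->
  fractional_fisher_attraction lam f ->
  (forall n, (1 <= n)%N ->
    has_density P (normalized_sum lam (fun j => X j : T -> R) n) (fn n)) ->
  (forall k : R, 0 <= k -> cvg_sobolev k fn omega) /\
  (forall k : R, 0 <= k ->
    exists (C : R) (n0 : nat), forall n, (n0 <= n)%N ->
      (homogeneous_sobolev_norm k (fn n \- omega)%R <=
       (C * (n%:R `^ (- ((2 - lam) / (4 * lam)))) `^ (2 / (2 * k + 3)))%:E)%E).
Proof.
move=> lam12 [omd omF] Xf Xi attr bf [g fg gfin] fnd.
have /andP[lam1 lam2] := lam12.
have lam0 : 0 < lam by exact: lt_trans lam1.
have fd : is_density f by case: attr.
have [mf f0 _] := fd.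
have fi := density_integrable fd.
have [gi _] := fg.
have f_cont := locally_abs_continuous_continuous (proj1 bf).
have f_lin := fisher_linear_bound mf f0 bf.
have w_int := fisher_integrand_integrable fd gi gfin.
have zero := fractional_derivative_zero_set lam12 f0 f_cont fi f_lin fg w_int.
have [B B0 near0] := char_function_near_zero lam12 attr fg w_int zero.
pose s : R := (3 * lam - 2) / 4.
have nu0 : 0 < lam - 1 by rewrite subr_gt0.
have [A A0 decay] := fourier_powR_decay fd fg.
have away := fourier_away_from_zero fd nu0 fg.
have near1 xi : normc (fourier f xi - (expR (- `|xi| `^ lam))%:C%C) <=
    2 * B * `|xi| `^ (1 + s).
  have [h1 h2] := near0 xi.
  rewrite fourierE// (_ : _ - _ = ((cos_transform f xi - expR (- `|xi| `^ lam)) +i*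
    (- sin_transform f xi - 0))%C)// subr0 -mulrA.
  by apply: normc_le => //; rewrite normrN.
pose tau : R := (2 - lam) / (4 * lam).
have tauE : (1 + s) / lam - 1 = tau by rewrite /s /tau; field; rewrite gt_eqF.
have tau0 : 0 < tau by rewrite divr_gt0 ?subr_gt0// mulr_gt0.
have s0 : 0 <= s by rewrite /s; lra.
have s_lam : lam < 1 + s by rewrite /s; lra.
have B20 : 0 <= 2 * B by rewrite mulr_ge0.
have omi := density_integrable omd.
(* Used with [K = k + 1]: one more derivative than asked makes the weight integrable. *)
have error K : 0 <= K -> exists C, exists2 n0, 0 <= C & forall n xi, (n0 <= n)%N ->
    normc (fourier (fn n \- omega) xi) ^+ 2 * (1 + `|xi| ^+ 2) `^ K <=
    C * n%:R `^ (- (2 * tau)) /\ (1 <= n)%N.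
  move=> K0.
  have [C [n0 C0 hC]] := power_comparison (ltW lam1) s0 s_lam B20 nu0 A0 near1 decay away K0.
  exists C; exists n0.+1 => // n xi nn; have n1 : (1 <= n)%N by apply: leq_trans nn.
  split=> //; have fnn := fnd n n1.
  rewrite fourierB//; last by apply: density_integrable; case: fnn.
  rewrite (fourier_normalized_sum Xi Xf xi fnn) omF -tauE.
  by apply: hC; exact: ltnW.
have power n : (n%:R `^ (- (2 * tau)) : R) = (n%:R `^ (- tau)) ^+ 2.
  by rewrite -powR_mulrn ?powR_ge0// -powRrM; congr (_ `^ _); ring.
have sqrt_rate C n : 0 <= C -> Num.sqrt (C * n%:R `^ (- (2 * tau)) * @cauchy_mass R) =
    Num.sqrt (C * @cauchy_mass R) * n%:R `^ (- tau).
  move=> C0; rewrite mulrAC sqrtrM; last by rewrite mulr_ge0// cauchy_mass_ge0.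
  by rewrite power sqrtr_sqr ger0_norm ?powR_ge0.
split=> k k0; have k10 : 0 <= k + 1 by rewrite addr_ge0.
  have [C [n0 C0 hC]] := error (k + 1) k10.
  have [C' C'0 hC'] := @expR_powR_dominates R lam 2 (k + 1) (ltW lam1) (ltr0n _ 2).
  have om_le xi : normc (fourier omega xi) ^+ 2 * (1 + `|xi| ^+ 2) `^ (k + 1) <= C'.
    rewrite omF normc_real ?expR_ge0// -expRM_natl mulrC mulrN -mulNr; exact: hC'.
  split.
  - by apply: (le_lt_trans (sobolev_norm_le C'0 om_le)); rewrite ltry.
  - exists n0.+1 => // n /= nn.
    have D0 : 0 <= 2 * (C * n%:R `^ (- (2 * tau))) + 2 * C'.
      by rewrite addr_ge0 ?mulr_ge0 ?powR_ge0.
    apply: (le_lt_trans (sobolev_norm_le D0 _)); last by rewrite ltry.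
    move=> xi; have [h n1] := hC n xi (ltnW nn).
    have fnn := fnd n n1; have ifn : (@lebesgue_measure R).-integrable setT (EFin \o fn n).
      by apply: density_integrable; case: fnn.
    have E : fourier (fn n) xi = fourier (fn n \- omega) xi - - fourier omega xi.
      by rewrite fourierB// opprK subrK.
    apply: (@le_trans _ _ ((2 * normc (fourier (fn n \- omega) xi) ^+ 2 +
      2 * normc (fourier omega xi) ^+ 2) * (1 + `|xi| ^+ 2) `^ (k + 1))).
      rewrite ler_wpM2r ?powR_ge0// E; apply: (le_trans (normc_sub_sqr _ _)).
      by rewrite normcN.
    by move: h (om_le xi); lra.
  - apply: (@squeeze_cvge _ _ _ _ (cst 0%E) _
      (fun n => (Num.sqrt (C * @cauchy_mass R) * n%:R `^ (- tau))%:E)).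
    + exists n0 => // n /= nn; rewrite sqrte_ge0 -sqrt_rate//.
      apply: sobolev_norm_le => [|xi]; first by rewrite mulr_ge0 ?powR_ge0.
      by have [] := hC n xi nn.
    + exact: cvg_cst.
    + apply: cvg_EFin; first exact: nearW.
      rewrite -[X in _ --> X](mulr0 (Num.sqrt (C * @cauchy_mass R))).
      by apply: cvgMr; exact: cvg_powR_neg.
have [C [n0 C0 hC]] := error (k + 1) k10.
exists (Num.sqrt (C * @cauchy_mass R)); exists n0 => n nn.
apply: (@le_trans _ _ (Num.sqrt (C * n%:R `^ (- (2 * tau)) * @cauchy_mass R))%:E).
  apply: homogeneous_sobolev_norm_le => [//||xi]; first by rewrite mulr_ge0 ?powR_ge0.
  by have [] := hC n xi nn.
rewrite sqrt_rate// lee_fin ler_wpM2l ?sqrtr_ge0// -/tau.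
have [_ n1] := hC n 0 nn.
apply: ger1_powR.
  rewrite powR_gt0 ?ltr0n//= powRN invf_le1 ?powR_gt0 ?ltr0n//.
  apply: (@le_trans _ _ (n%:R `^ 0)); first by rewrite powRr0.
  by apply: ler_powR; [rewrite ler1n|exact: ltW].
by rewrite ler_pdivrMr; [rewrite mul1r; lra|lra].
Qed.
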